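(* Let $G$ be a Lie group modelled on a sequentially complete locally convex space, with neutral element $e$ and Lie algebra $\mathfrak g=T_eG$, let $M$ be a smooth manifold modelled on a sequentially complete locally convex space and $\sigma\colon M\times G\to M$ a smooth map which is a right $G$-action. Let $a<b$ be real numbers. If $\gamma\in\mathcal{L}^1([a,b],\mathfrak g)$ has an evolution $\eta\in AC([a,b],G)$, then the differential equation $$\dot y(t)=\gamma(t)_\sharp(y(t))$$ on $M$ (given by the time-dependent vector field $[a,b]\times M\to TM$, $(t,y)\mapsto\gamma(t)_\sharp(y)$) satisfies local existence and local uniqueness of Carathéodory solutions. The mapping $$\mathrm{Fl}\colon[a,b]\times[a,b]\times M\to M,\quad(t,t_0,y_0)\mapsto\sigma(y_0,\eta(t_0)^{-1}\eta(t))$$ is the maximal flow of this differential equation. Moreover, the differential equation admits local flows which are pullbacks of $C^\infty$-maps.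
   Context: **Calculus.** Locally convex spaces are real and Hausdorff; an *sclc-space* is a sequentially complete locally convex space. A continuous map $f\colon U\to F$ from an open subset $U$ of a locally convex space $E$ to a locally convex space $F$ is $C^1$ if the directional derivatives $df(x,y)=\frac{d}{dt}|_{t=0}f(x+ty)$ exist for all $(x,y)\in U\times E$ and $df\colon U\times E\to F$ is continuous; $C^k$ ($k\ge2$) if it is $C^1$ and $df$ is $C^{k-1}$; smooth ($C^\infty$) if $C^k$ for all $k$. Manifolds (Hausdorff) and Lie groups modelled on locally convex spaces are defined with this notion. For a $C^1$-map $\phi$ from a manifold to an open subset of $E$, $d\phi$ is the second component of the tangent map $T\phi$. **Fundamental vector fields.** For $v\in\mathfrak g$, $v_\sharp(x):=(T_e\sigma(x,\cdot))(v)$ for $x\in M$. For $g\in G$, $v\in TG$: $g.v:=T\lambda_g(v)$ with $\lambda_g(h)=gh$. **Lusin measurability, $\mathcal{L}^1$.** $\lambda_1$ is Lebesgue–Borel measure. A map $\gamma\colon I\to X$ from an interval to a topological space is Lusin measurable if there are compact sets $K_j\subseteq I$ ($j\in\mathbb N$) with $\gamma|_{K_j}$ continuous and $I\setminus\bigcup_jK_j$ of Lebesgue measure $0$. For a locally convex space $E$, $\mathcal{L}^1([a,b],E)$ is the space of Lusin measurable $\gamma\colon[a,b]\to E$ with $\int_a^bq(\gamma(t))\,dt<\infty$ for every continuous seminorm $q$ on $E$. A map $\gamma\colon I\to E$ is locally integrable if $\gamma|_{[\alpha,\beta]}\in\mathcal{L}^1([\alpha,\beta],E)$ for all $[\alpha,\beta]\subseteq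 I$, $\alpha<\beta$; $[\gamma]$ denotes its class modulo Lusin measurable functions vanishing almost everywhere. **Absolute continuity.** Let $E$ be an sclc-space. A map $\eta\colon I\to E$ is absolutely continuous if there is a locally integrable $\gamma\colon I\to E$ with $\eta(t)=\eta(t_0)+\int_{t_0}^t\gamma(s)\,ds$ (weak integral) for all $t,t_0\in I$; then $[\gamma]$ is uniquely determined and $\eta':=[\gamma]$. For a $C^1$-manifold $N$ modelled on an sclc-space, $[\theta]$ denotes, for a Lusin measurable $\theta\colon I\to TN$, the set of all Lusin measurable maps $I\to TN$ with the same base point as $\theta$ at every $t$ and equal to $\theta$ almost everywhere. A continuous $\eta\colon[\alpha,\beta]\to N$ with image in the domain $U_\phi$ of a chart $\phi\colon U_\phi\to V_\phi$ is absolutely continuous if $\phi\circ\eta$ is so, and then $\dot\eta:=[t\mapsto T\phi^{-1}((\phi\circ\eta)(t),\gamma(t))]$ where $(\phi\circ\eta)'=[\gamma]$; this is independent of $\phi$. A continuous map $\eta\colon[\alpha,\beta]\to N$ is absolutely continuous if $[\alpha,\beta]$ can be subdivided into finitely many compact intervals on which $\eta$ is absolutely continuous with image in a chart domain, and a map on an interval $I$ is absolutely continuous if its restrictions to all $[\alpha,\beta]\subseteq I$ are; $\dot\eta$ is defined piecewise. $AC([a,b],N)$ is the set of absolutely continuous maps $[a,b]\to N$. **Evolution.** An evolution of $\gamma\in\mathcal{L}^1([a,b],\mathfrak g)$ is an $\eta\in AC([a,b],G)$ with $\eta(a)=e$ and $\dot\eta=[t\mapsto\eta(t).\gamma(t)]$.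 **Carathéodory solutions.** Let $N$ be a $C^1$-manifold modelled on an sclc-space, $J$ a non-degenerate interval, $W\subseteq J\times N$ and $f\colon W\to TN$ with $f(t,y)\in T_yN$. A map $\zeta\colon I\to N$ on a non-degenerate interval is a Carathéodory solution to $\dot y(t)=f(t,y(t))$ if it is absolutely continuous, $(t,\zeta(t))\in W$ for all $t\in I$ and $\dot\zeta=[t\mapsto f(t,\zeta(t))]$; it solves the initial value problem with $y(t_0)=y_0$ if moreover $t_0\in I$ and $\zeta(t_0)=y_0$. For $N=E$ an sclc-space and $f\colon W\to E$, one requires $\zeta'=[t\mapsto f(t,\zeta(t))]$, equivalently $\zeta(t)=\zeta(t_0)+\int_{t_0}^tf(s,\zeta(s))\,ds$. *Local existence*: for all $(t_0,y_0)\in W$ there is a Carathéodory solution to the initial value problem with $y(t_0)=y_0$ defined on a relatively open subinterval of $J$. *Local uniqueness*: if $\gamma_1\colon I_1\to N$, $\gamma_2\colon I_2\to N$ are Carathéodory solutions and $\gamma_1(t_0)=\gamma_2(t_0)$ for some $t_0\in I_1\cap I_2$, then $\gamma_1|_K=\gamma_2|_K$ for some interval $K$ which is an open neighbourhood of $t_0$ in $I_1\cap I_2$. **Maximal flow.** Under local existence and uniqueness, for each $(t_0,y_0)\in W$ there is a Carathéodory solution $\gamma_{t_0,y_0}\colon I_{t_0,y_0}\to N$ to the initial value problem with $y(t_0)=y_0$ which extends every other solution of it. The maximal flow is $\mathrm{Fl}\colon\Omega\to N$, $\mathrm{Fl}(t,t_0,y_0):=\gamma_{t_0,y_0}(t)$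 on $\Omega:=\bigcup_{(t_0,y_0)\in W}I_{t_0,y_0}\times\{(t_0,y_0)\}$. **Local flows in sclc-spaces.** Let $E$ be an sclc-space, $U\subseteq E$, $W\subseteq J\times U$ open, $f\colon W\to E$ and $k\in\mathbb N\cup\{\infty\}$. The equation $y'(t)=f(t,y(t))$ admits local flows which are pullbacks of $C^k$-maps if for all $(\bar t,\bar y)\in W$ there exist a compact interval $I\subseteq J$ which is a neighbourhood of $\bar t$ in $J$, an open neighbourhood $V$ of $\bar y$ in $U$ with $I\times V\subseteq W$ (below, $V$ is open in $E$) and a function $\Phi\colon I\times I\times V\to E$, $\Phi_{t,t_0}(y_0):=\Phi(t,t_0,y_0)$, such that: (a) for all $(t_0,y_0)\in I\times V$, $t\mapsto\Phi_{t,t_0}(y_0)$ is a Carathéodory solution on $I$ to $y'(t)=f(t,y(t))$, $y(t_0)=y_0$; (b) there is an open $\bar y$-neighbourhood $Y\subseteq V$ with $\Phi_{t_1,t_0}(Y)\subseteq V$ for all $t_0,t_1\in I$ and $\Phi_{t_2,t_1}(\Phi_{t_1,t_0}(y_0))=\Phi_{t_2,t_0}(y_0)$ for all $t_0,t_1,t_2\in I$, $y_0\in Y$; (c)$'$ there exist sclc-spaces $E_1,E_2$, open subsets $V_j\subseteq E_j$, absolutely continuous functions $\alpha\colon I\to E_1$ with image in $V_1$ and $\beta\colon I\to E_2$ with image in $V_2$, and a $C^k$-map $\Psi\colon V_1\times V_2\times V\to E$ with $\Phi(t,t_0,y_0)=\Psi(\alpha(t),\beta(t_0),y_0)$ for all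 $(t,t_0,y_0)$; moreover, for each continuous linear map $q\colon E\to F$ to a Banach space and each compact $C\subseteq V$ there are a Borel set $I_q\subseteq I$ with $\lambda_1(I\setminus I_q)=0$ and an open set $\Omega_q\subseteq V$ with $C\subseteq\Omega_q$ such that $\frac{d}{dt}q(\Phi_{t,t_0}(y_0))$ exists and equals $q(f(t,\Phi_{t,t_0}(y_0)))$ for all $y_0\in\Omega_q$, $t_0\in I$, $t\in I_q$. **Local flows on manifolds.** Let $M$ be a $C^k$-manifold modelled on an sclc-space $E$, $W\subseteq J\times M$ open, $f\colon W\to TM$ with $f(t,y)\in T_yM$. The equation $\dot y(t)=f(t,y(t))$ admits local flows which are pullbacks of $C^k$-maps if, for each chart $\phi\colon U_\phi\to V_\phi\subseteq E$ of $M$, the equation $y'(t)=f_\phi(t,y(t))$ does so, where $W_\phi:=\{(t,y)\in J\times V_\phi\colon(t,\phi^{-1}(y))\in W\}$ and $f_\phi\colon W_\phi\to E$, $f_\phi(t,y):=d\phi(f(t,\phi^{-1}(y)))$. *)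

(* Defs.v *)
From HB Require Import structures.
From mathcomp Require Import all_boot all_order all_algebra.
From mathcomp Require Import all_classical all_reals all_analysis.

Set Implicit Arguments.
Unset Strict Implicit.
Unset Printing Implicit Defensive.

Import Order.TTheory GRing.Theory Num.Theory.
Import numFieldTopology.Exports numFieldNormedType.Exports.

Local Open Scope classical_set_scope.
Local Open Scope ring_scope.

(* [tvsType R] is the library's type of locally convex spaces; it does not
   include the Hausdorff property.  Its uniformity is not required to be the
   translation-invariant one, so Cauchy sequences are defined here through the
   neighbourhoods of 0 rather than through [cauchy]. *)
Definition seq_complete (R : realType) (E : tvsType R) : Prop :=
  forall u : nat -> E,
    (forall U : set E, nbhs 0 U ->
       exists N, forall m n, (N <= m)%N -> (N <= n)%N -> U (u m - u n)) ->
    exists l : E, u n @[n --> \oo] --> l.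

Definition sclc_space (R : realType) (E : tvsType R) : Prop :=
  hausdorff_space E /\ seq_complete E.

(* A map defined on an open subset [U] of [E] is a total function of which only
   the values on [U] matter. *)

Definition is_dirder (R : realType) (E F : tvsType R) (f : E -> F) (x y : E)
    (l : F) : Prop :=
  t^-1 *: (f (x + t *: y) - f x) @[t --> (0 : R)^'] --> l.

Definition dirder (R : realType) (E F : tvsType R) (f : E -> F) (x y : E) : F :=
  xget 0 [set l | is_dirder f x y l].

Fixpoint Ck (R : realType) (k : nat) (E F : tvsType R) (U : set E)
    (f : E -> F) {struct k} : Prop :=
  {within U, continuous f} /\
  (if k is k'.+1 then
     (forall x y, U x -> exists l, is_dirder f x y l) /\
     Ck k' (U `*` [set: E]) (fun z : (E * E)%type => dirder f z.1 z.2)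
   else True).

Definition Csmooth (R : realType) (E F : tvsType R) (U : set E) (f : E -> F) :
  Prop := forall k, Ck k U f.

Record chart (R : realType) (E : tvsType R) (M : topologicalType) := Chart {
  chart_dom : set M;
  chart_img : set E;
  chart_map :> M -> E;
  chart_inv : E -> M;
  chart_dom_open : open chart_dom;
  chart_img_open : open chart_img;
  chart_map_img : forall x, chart_dom x -> chart_img (chart_map x);
  chart_inv_dom : forall v, chart_img v -> chart_dom (chart_inv v);
  chart_mapK : forall x, chart_dom x -> chart_inv (chart_map x) = x;
  chart_invK : forall v, chart_img v -> chart_map (chart_inv v) = v;
  chart_map_continuous : {within chart_dom, continuous chart_map};
  chart_inv_continuous : {within chart_img, continuous chart_inv}
}.

Definition smooth_transition (R : realType) (E : tvsType R)
    (M : topologicalType) (phi psi : chart E M) : Prop :=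
  Csmooth (chart_img phi `&` chart_inv phi @^-1` chart_dom psi)
          (psi \o chart_inv phi).

HB.mixin Record isSmoothManifold (R : realType) (E : tvsType R) M
    & Topological M := {
  manifold_hausdorff : hausdorff_space M;
  atlas : set (chart E M);
  atlas_cover : forall x : M, exists phi, atlas phi /\ chart_dom phi x;
  atlas_compat : forall phi psi, atlas phi -> atlas psi ->
    smooth_transition phi psi;
  atlas_maximal : forall phi,
    (forall psi, atlas psi ->
       smooth_transition phi psi /\ smooth_transition psi phi) ->
    atlas phi
}.

#[short(type="smoothManifoldType")]
HB.structure Definition SmoothManifold (R : realType) (E : tvsType R) :=
  {M of Topological M & isSmoothManifold R E M}.

Definition smooth_map (R : realType) (E F : tvsType R)
    (M : smoothManifoldType E) (N : smoothManifoldType F) (f : M -> N) : Prop :=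
  continuous f /\
  forall (phi : chart E M) (psi : chart F N), atlas phi -> atlas psi ->
    Csmooth (chart_img phi `&` (f \o chart_inv phi) @^-1` chart_dom psi)
            (psi \o f \o chart_inv phi).

(* Smoothness on the product manifold [M1 * M2], which is modelled on [E1 * E2];
   it is tested on the product charts [phi1 x phi2]. *)
Definition smooth_map2 (R : realType) (E1 E2 F : tvsType R)
    (M1 : smoothManifoldType E1) (M2 : smoothManifoldType E2)
    (N : smoothManifoldType F) (f : M1 -> M2 -> N) : Prop :=
  continuous (fun x : (M1 * M2)%type => f x.1 x.2) /\
  forall (phi1 : chart E1 M1) (phi2 : chart E2 M2) (psi : chart F N),
    atlas phi1 -> atlas phi2 -> atlas psi ->
    let g (v : (E1 * E2)%type) := f (chart_inv phi1 v.1) (chart_inv phi2 v.2) in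
    Csmooth ((chart_img phi1 `*` chart_img phi2) `&` g @^-1` chart_dom psi)
            (psi \o g).

(* A tangent vector at [p] is represented by its coordinate in a chart
   [chart_at p] around [p], chosen once and for all. Thus [T_p M] is the model
   space [E] as a locally convex space, and the coordinate in an arbitrary chart
   [phi] around [p] is [chart_diff phi]. *)

Definition chart_at (R : realType) (E : tvsType R) (M : smoothManifoldType E)
    (p : M) : chart E M := projT1 (cid (atlas_cover p)).

Definition tangent_space (R : realType) (E : tvsType R)
  (M : smoothManifoldType E) (p : M) : tvsType R := E.

Record tangent (R : realType) (E : tvsType R) (M : smoothManifoldType E) :=
  Tangent { tbase : M; tvec : tangent_space tbase }.

Section Tangent.
Context (R : realType) (E : tvsType R) (M : smoothManifoldType E).
Implicit Types (phi : chart E M) (u : tangent M).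

(* d phi : T U_phi -> E; [tvec u] is the coordinate with respect to [c], so this is
   the derivative of the chart change [phi o c^-1]. *)
Definition chart_diff phi u : E :=
  let c := chart_at (tbase u) in
  dirder (phi \o chart_inv c) (c (tbase u)) (tvec u).

(* T phi : T U_phi -> V_phi x E *)
Definition chart_tangent phi u : (E * E)%type := (phi (tbase u), chart_diff phi u).

(* (T phi)^-1 : V_phi x E -> T U_phi *)
Definition chart_tangent_inv phi (x v : E) : tangent M :=
  let p := chart_inv phi x in
  @Tangent R E M p (dirder (chart_at p \o chart_inv phi) x v).

HB.instance Definition _ := gen_eqMixin (tangent M).
HB.instance Definition _ := gen_choiceMixin (tangent M).

(* The topology of [TM] for which the sets [T U_phi] are open and the maps
   [T phi : T U_phi -> V_phi x E] are homeomorphisms. *)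
Definition tangent_open (A : set (tangent M)) : Prop :=
  forall phi, atlas phi -> exists O : set (E * E)%type, open O /\
    forall u, chart_dom phi (tbase u) -> (A u <-> O (chart_tangent phi u)).

Lemma tangent_openT : tangent_open setT.
Proof. by move=> phi _; exists setT; split=> //; exact: openT. Qed.

Lemma tangent_openI : setI_closed tangent_open.
Proof.
move=> A B oA oB phi hphi.
have [P [oP AP]] := oA phi hphi; have [Q [oQ BQ]] := oB phi hphi.
exists (P `&` Q); split; first exact: openI.
move=> u hu; split=> -[Au Bu].
  by split; [apply/(AP u hu)|apply/(BQ u hu)].
by split; [apply/(AP u hu)|apply/(BQ u hu)].
Qed.

Lemma tangent_open_bigU (I : Type) (A : I -> set (tangent M)) :
  (forall i, tangent_open (A i)) -> tangent_open (\bigcup_i A i).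
Proof.
move=> oA phi hphi; pose P i := projT1 (cid (oA i phi hphi)).
have oP : forall i, open (P i) by move=> i; rewrite /P; case: cid => /= ? [].
have AP : forall i u, chart_dom phi (tbase u) ->
    A i u <-> P i (chart_tangent phi u).
  by move=> i u; rewrite /P; case: cid => /= Q [_ QP]; exact: QP.
exists (\bigcup_i P i); split; first exact: bigcup_open.
by move=> u hu; split=> -[i _ hi]; exists i => //; apply/(AP i u hu).
Qed.

HB.instance Definition _ := isOpenTopological.Build (tangent M)
  tangent_openT tangent_openI tangent_open_bigU.

End Tangent.

Definition tangent_map (R : realType) (E F : tvsType R)
    (M : smoothManifoldType E) (N : smoothManifoldType F) (f : M -> N)
    (u : tangent M) : tangent N :=
  let p := tbase u in
  @Tangent R F N (f p)
    (dirder (chart_at (f p) \o f \o chart_inv (chart_at p))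
       (chart_at p p) (tvec u)).

HB.mixin Record isLieGroup (R : realType) (E : tvsType R) G
    & SmoothManifold R E G & Group G := {
  lie_mul_smooth : smooth_map2 (fun g h : G => (g * h)%g);
  lie_inv_smooth : smooth_map (fun g : G => (g^-1)%g)
}.

#[short(type="lieGroupType")]
HB.structure Definition LieGroup (R : realType) (E : tvsType R) :=
  {G of SmoothManifold R E G & Group G & isLieGroup R E G}.

Definition lie_algebra (R : realType) (E : tvsType R) (G : lieGroupType E) :
  tvsType R := tangent_space (1%g : G).

Definition lie_tangent (R : realType) (E : tvsType R) (G : lieGroupType E)
    (v : lie_algebra G) : tangent G := @Tangent R E G 1%g v.

Definition right_action (G : groupType) (M : Type) (sigma : M -> G -> M) :
    Prop :=
  (forall x, sigma x 1%g = x) /\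
  (forall x g h, sigma (sigma x g) h = sigma x (g * h)%g).

Definition fundamental_field (R : realType) (E F : tvsType R)
    (G : lieGroupType E) (M : smoothManifoldType F) (sigma : M -> G -> M)
    (v : lie_algebra G) (x : M) : tangent M :=
  tangent_map (sigma x) (lie_tangent v).

Definition left_translate (R : realType) (E : tvsType R) (G : lieGroupType E)
    (g : G) (v : tangent G) : tangent G :=
  tangent_map (fun h : G => (g * h)%g) v.

(* A map on an interval [I] is a total function on [R] of which only the values
   on [I] matter. *)

Definition nondeg_interval (R : realType) (I : set R) : Prop :=
  is_interval I /\ exists s t, [/\ I s, I t & s < t].

Definition lusin_measurable (R : realType) (X : topologicalType) (I : set R)
    (g : R -> X) : Prop :=
  exists K : nat -> set R,
    [/\ forall j, compact (K j) /\ K j `<=` I,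
        forall j, {within K j, continuous g} &
        lebesgue_measure (I `\` \bigcup_j K j) = 0%E].

Definition ae_eq_on (R : realType) (X : Type) (I : set R) (g h : R -> X) :
    Prop :=
  lebesgue_measure.-negligible (I `&` [set t | g t <> h t]).

Definition seminorm (R : realType) (E : tvsType R) (q : E -> R) : Prop :=
  (forall x y, q (x + y) <= q x + q y) /\
  (forall (r : R) x, q (r *: x) = `|r| * q x).

(* [q \o g] is Lebesgue measurable but possibly not Borel; the library's
   integral of a nonnegative function is the supremum of the integrals of the
   nonnegative simple functions below it, hence the Lebesgue integral here. *)
Definition L1 (R : realType) (E : tvsType R) (a b : R) (g : R -> E) : Prop :=
  lusin_measurable `[a, b]%classic g /\
  forall q : E -> R, seminorm q -> continuous q ->
    (\int[lebesgue_measure]_(t in `[a, b]%classic) (q (g t))%:E < +oo)%E.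

Definition locally_integrable (R : realType) (E : tvsType R) (I : set R)
    (g : R -> E) : Prop :=
  forall al be, al < be -> `[al, be]%classic `<=` I -> L1 al be g.

Definition oriented_integral (R : realType) (s t : R) (h : R -> R) : R :=
  if s <= t then \int[lebesgue_measure]_(u in `[s, t]%classic) h u
  else - \int[lebesgue_measure]_(u in `[t, s]%classic) h u.

Definition is_weak_integral (R : realType) (E : tvsType R) (g : R -> E)
    (s t : R) (x : E) : Prop :=
  forall l : {linear E -> R^o}, continuous l ->
    l x = oriented_integral s t (fun u => l (g u)).

Definition primitive_of (R : realType) (E : tvsType R) (I : set R)
    (g : R -> E) (eta : R -> E) : Prop :=
  locally_integrable I g /\
  forall t t0, I t -> I t0 -> is_weak_integral g t0 t (eta t - eta t0).

Definition abs_continuous (R : realType) (E : tvsType R) (I : set R)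
    (eta : R -> E) : Prop :=
  exists g, primitive_of I g eta.

(* The derivative of [eta] is the class of [h] modulo null sets. *)
Definition has_derivative (R : realType) (E : tvsType R) (I : set R)
    (eta h : R -> E) : Prop :=
  exists g, [/\ primitive_of I g eta, lusin_measurable I h & ae_eq_on I g h].

Section ManifoldAC.
Context (R : realType) (E : tvsType R) (N : smoothManifoldType E).
Implicit Types (I : set R) (eta : R -> N) (theta : R -> tangent N).

(* [theta2] belongs to the class of [theta1]: the base points agree everywhere on
   [I], the vectors almost everywhere. *)
Definition tangent_class I theta1 theta2 : Prop :=
  [/\ lusin_measurable I theta1, lusin_measurable I theta2,
      forall t, I t -> tbase (theta1 t) = tbase (theta2 t) &
      ae_eq_on I theta1 theta2].

Definition chart_abs_continuous (phi : chart E N) (al be : R) eta : Prop :=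
  [/\ {within `[al, be]%classic, continuous eta},
      forall t, `[al, be]%classic t -> chart_dom phi (eta t) &
      abs_continuous `[al, be]%classic (phi \o eta)].

(* [theta] belongs to the class of [t |-> T phi^-1 (phi (eta t), g t)]. *)
Definition chart_velocity (phi : chart E N) (al be : R) eta theta : Prop :=
  chart_abs_continuous phi al be eta /\
  exists g, primitive_of `[al, be]%classic g (phi \o eta) /\
    tangent_class `[al, be]%classic
      (fun t => chart_tangent_inv phi (phi (eta t)) (g t)) theta.

(* [P] holds, for some chart, on each piece of some subdivision
   [al = s 0 < ... < s n = be] *)
Definition piecewise_in_charts (P : chart E N -> R -> R -> Prop)
    (al be : R) : Prop :=
  exists (n : nat) (s : nat -> R),
    [/\ s 0%N = al, s n = be,
        forall i, (i < n)%N -> s i < s i.+1 &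
        forall i, (i < n)%N ->
          exists phi, atlas phi /\ P phi (s i) (s i.+1)].

Definition manifold_abs_continuous I eta : Prop :=
  forall al be, al < be -> `[al, be]%classic `<=` I ->
    {within `[al, be]%classic, continuous eta} /\
    piecewise_in_charts
      (fun phi s t => chart_abs_continuous phi s t eta) al be.

(* The class of [theta] is the velocity of the absolutely continuous [eta]. *)
Definition has_velocity I eta theta : Prop :=
  [/\ lusin_measurable I theta,
      forall t, I t -> tbase (theta t) = eta t &
      forall al be, al < be -> `[al, be]%classic `<=` I ->
        piecewise_in_charts
          (fun phi s t => chart_velocity phi s t eta theta) al be].

End ManifoldAC.

Definition is_evolution (R : realType) (E : tvsType R) (G : lieGroupType E)
    (a b : R) (gamma : R -> lie_algebra G) (eta : R -> G) : Prop :=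
  [/\ manifold_abs_continuous `[a, b]%classic eta,
      eta a = 1%g &
      has_velocity `[a, b]%classic eta
        (fun t => left_translate (eta t) (lie_tangent (gamma t)))].

(* y'(t) = f(t, y(t)) in the locally convex space E, with f : W -> E *)
Definition vs_solution (R : realType) (E : tvsType R) (W : set (R * E)%type)
    (f : R -> E -> E) (I : set R) (zeta : R -> E) : Prop :=
  [/\ nondeg_interval I, abs_continuous I zeta,
      forall t, I t -> W (t, zeta t) &
      has_derivative I zeta (fun t => f t (zeta t))].

Section ManifoldODE.
Context (R : realType) (E : tvsType R) (N : smoothManifoldType E).
Variables (J : set R) (W : set (R * N)%type) (f : R -> N -> tangent N).

Definition solution (I : set R) (zeta : R -> N) : Prop :=
  [/\ nondeg_interval I, manifold_abs_continuous I zeta,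
      forall t, I t -> W (t, zeta t) &
      has_velocity I zeta (fun t => f t (zeta t))].

Definition ivp_solution (t0 : R) (y0 : N) (I : set R) (zeta : R -> N) : Prop :=
  [/\ solution I zeta, I t0 & zeta t0 = y0].

Definition local_existence : Prop :=
  forall t0 y0, W (t0, y0) ->
    exists (I : set R) (zeta : R -> N),
      (exists O : set R, open O /\ I = J `&` O) /\ ivp_solution t0 y0 I zeta.

Definition local_uniqueness : Prop :=
  forall (I1 I2 : set R) (gamma1 gamma2 : R -> N) (t0 : R),
    solution I1 gamma1 -> solution I2 gamma2 -> I1 t0 -> I2 t0 ->
    gamma1 t0 = gamma2 t0 ->
    exists K : set R,
      [/\ is_interval K, K t0,
          exists O : set R, open O /\ K = (I1 `&` I2) `&` O &
          forall t, K t -> gamma1 t = gamma2 t].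

Definition maximal_solution (t0 : R) (y0 : N) (I : set R) (zeta : R -> N) :
    Prop :=
  ivp_solution t0 y0 I zeta /\
  forall I' zeta', ivp_solution t0 y0 I' zeta' ->
    I' `<=` I /\ forall t, I' t -> zeta' t = zeta t.

(* [Omega] consists of the [(t, t0, y0)] with [(t0, y0)] in [W] and [t] in the
   domain [Imax t0 y0] of the maximal solution. *)
Definition is_maximal_flow (Omega : set (R * R * N)%type)
    (Fl : R -> R -> N -> N) : Prop :=
  exists Imax : R -> N -> set R,
    (forall t0 y0, W (t0, y0) ->
       maximal_solution t0 y0 (Imax t0 y0) (fun t => Fl t t0 y0)) /\
    Omega = [set z | W (z.1.2, z.2) /\ Imax z.1.2 z.2 z.1.1].

End ManifoldODE.

(* [f : W -> E] with [U] open in [E] and [W] open in [J x U]; the interval [I]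
   is [`[c, d]]. *)
Definition vs_smooth_local_flows (R : realType) (E : tvsType R) (J : set R)
    (U : set E) (W : set (R * E)%type) (f : R -> E -> E) : Prop :=
  forall (tb : R) (yb : E), W (tb, yb) ->
  exists (c d : R) (V : set E) (Phi : R -> R -> E -> E),
    let I := `[c, d]%classic in
    [/\ [/\ c < d, I `<=` J &
            exists O : set R, [/\ open O, O tb & J `&` O `<=` I]],
        [/\ open V, V yb, V `<=` U & I `*` V `<=` W],
        forall t0 y0, I t0 -> V y0 ->
          vs_solution W f I (fun t => Phi t t0 y0) /\ Phi t0 t0 y0 = y0,
        exists Y : set E,
          [/\ open Y, Y yb, Y `<=` V,
              forall t0 t1 y, I t0 -> I t1 -> Y y -> V (Phi t1 t0 y) &
              forall t0 t1 t2 y0, I t0 -> I t1 -> I t2 -> Y y0 ->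
                Phi t2 t1 (Phi t1 t0 y0) = Phi t2 t0 y0] &
        (exists (E1 E2 : tvsType R) (V1 : set E1) (V2 : set E2)
                (alpha : R -> E1) (beta : R -> E2)
                (Psi : (E1 * E2 * E)%type -> E),
          [/\ [/\ sclc_space E1, sclc_space E2, open V1 & open V2],
              abs_continuous I alpha /\ (forall t, I t -> V1 (alpha t)),
              abs_continuous I beta /\ (forall t, I t -> V2 (beta t)),
              Csmooth (V1 `*` V2 `*` V) Psi &
              forall t t0 y0, I t -> I t0 -> V y0 ->
                Phi t t0 y0 = Psi (alpha t, beta t0, y0)]) /\
        (forall (F : completeNormedModType R) (q : {linear E -> F}),
          continuous q ->
          forall C : set E, compact C -> C `<=` V ->
          exists (Iq : set R) (Omegaq : set E),
            [/\ [/\ measurable Iq, Iq `<=` I &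
                    lebesgue_measure (I `\` Iq) = 0%E],
                [/\ open Omegaq, C `<=` Omegaq & Omegaq `<=` V] &
                (* one-sided at the end points of I *)
                forall y0 t0 t, Omegaq y0 -> I t0 -> Iq t ->
                  (s - t)^-1 *: (q (Phi s t0 y0) - q (Phi t t0 y0))
                    @[s --> within I t^'] --> q (f t (Phi t t0 y0))])].

Definition smooth_local_flows (R : realType) (E : tvsType R)
    (N : smoothManifoldType E) (J : set R) (W : set (R * N)%type)
    (f : R -> N -> tangent N) : Prop :=
  forall phi : chart E N, atlas phi ->
    vs_smooth_local_flows J (chart_img phi)
      [set z : (R * E)%type |
        [/\ J z.1, chart_img phi z.2 & W (z.1, chart_inv phi z.2)]]
      (fun t y => chart_diff phi (f t (chart_inv phi y))).

(* Main.v *)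
Require Import Defs.
From HB Require Import structures.
From mathcomp Require Import all_boot all_order all_algebra.
From mathcomp Require Import all_classical all_reals all_analysis.
From mathcomp Require Import measurable_realfun.
From mathcomp Require Import ring lra.

(** Put [Fl t t0 y0 = sigma y0 ((eta t0)^-1 * eta t)].

    Fl solves the equation. Fix [y0] in [M] and [g] in [G]. The curve
    [t |-> sigma y0 (g * eta t)] is the image of the evolution under a smooth map,
    and [sigma y0 (g * (h * k)) = sigma (sigma y0 (g * h)) k] shows that the tangent
    of this map sends [h.v] to the fundamental vector [v_sharp (sigma y0 (g * h))]
    ([transport_field]). As [eta] has velocity [eta.gamma], the curve has velocity
    [gamma_sharp] ([flow_velocity]).

    Every solution is of this form. If [y] is a solution, the curve
    [t |-> sigma (y t) (eta t)^-1] has velocity 0: the direction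
    [(v_sharp y, h.v)] at [(y, h)] is tangent to the orbit of the points
    [(sigma y k, h * k)], on which [(x, g) |-> sigma x g^-1] is constant
    ([comoving_derivative0]). So the curve is constant, and
    [y t = sigma (y s) ((eta s)^-1 * eta t)] ([solution_formula]). Local
    existence, local uniqueness and the maximality of [Fl] follow.

    The analysis behind both computations is the chain rule for absolutely
    continuous curves, [primitive_comp]. In a locally convex space such a curve
    need not be differentiable almost everywhere, so the rule is not obtained by
    differentiating. For a smooth [F] and a continuous seminorm [q], a
    second-order estimate for [F] along the compact image of the curve
    ([compact_estimate]) bounds the amount by which the integral formula for
    [F \o zeta] fails on a short interval by [2 e] times the integral of a
    seminorm of the integrand. This defect is additive in the interval, so the
    bound holds on the whole interval, for every [e > 0]. The Hahn-Banach theorem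
    reduces the mean value inequality and the bound of the seminorm of an integral
    by the integral of the seminorm to scalar statements.

    Near [(tb, yb)] the local flow is, in charts [phi] of [M] and [chi] of [G],
    [Phi t t0 y = Psi (chi (eta t), chi (eta t0), y)] for the smooth coordinate
    expression [Psi] of [(h, k, y) |-> sigma y (k^-1 * h)]. For a continuous linear
    [q] into a Banach space and a compact set [C], [uniform_estimate] provides one
    continuous seminorm [p] which controls the dependence of [q \o Psi] on its
    first variable for all [t0] and all [y] near [C]. The curve [chi \o eta] is
    differentiable with respect to [p] outside a null set ([lebesgue_points]), and
    [difference_quotient] carries this over to [q \o Phi]; hence the null set
    depends neither on [t0] nor on [y]. *)

Set Implicit Arguments.
Unset Strict Implicit.
Unset Printing Implicit Defensive.

Import Order.TTheory GRing.Theory Num.Theory.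
Import numFieldTopology.Exports numFieldNormedType.Exports.

Local Open Scope classical_set_scope.
Local Open Scope ring_scope.

(** * Continuous seminorms *)

Section Seminorms.
Context (R : realType) (E : tvsType R).
Implicit Types (p q : E -> R) (x y : E).

Lemma seminorm0 q : seminorm q -> q 0 = 0.
Proof. by case=> _ qZ; rewrite -(scale0r (0 : E)) qZ normr0 mul0r. Qed.

Lemma seminormN q x : seminorm q -> q (- x) = q x.
Proof. by case=> _ qZ; rewrite -scaleN1r qZ normrN1 mul1r. Qed.

Lemma seminorm_ge0 q x : seminorm q -> 0 <= q x.
Proof.
move=> sq; have := sq.1 x (- x); rewrite subrr (seminorm0 sq) (seminormN _ sq).
by rewrite -mulr2n pmulrn_lge0.
Qed.

Lemma seminormBC q x y : seminorm q -> q (x - y) = q (y - x).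
Proof. by move=> sq; rewrite -opprB seminormN. Qed.

Lemma seminormB q x y : seminorm q -> q (x - y) <= q x + q y.
Proof. by move=> sq; rewrite -(seminormN y sq); exact: sq.1. Qed.

Lemma seminorm_dist q x y : seminorm q -> `|q x - q y| <= q (x - y).
Proof.
move=> sq; rewrite ler_norml; apply/andP; split.
  rewrite lerNl opprB lerBlDr seminormBC//.
  by have := sq.1 (y - x) x; rewrite subrK.
by rewrite lerBlDr; have := sq.1 (x - y) y; rewrite subrK.
Qed.

Lemma nbhs0P (U : set E) x : nbhs x U <-> nbhs 0 [set h | U (x + h)].
Proof.
split=> [Ux|/(@nbhsT _ _ _ x)].
  have := @add_continuous E (x, 0) U; rewrite /= addr0 => /(_ Ux)[]/= [A B][/= Ax B0] AB.
  apply: filterS B0 => h Bh; apply: (AB (x, h)); split => //=.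
  exact: nbhs_singleton Ax.
by apply: filterS => _ [h Uxh <-].
Qed.

Lemma seminorm_continuous q : seminorm q ->
  (forall e, 0 < e -> nbhs 0 [set x | q x < e]) -> continuous q.
Proof.
move=> sq h x; apply/cvgrPdist_lt => e e0.
apply/nbhs0P; apply: filterS (h e e0) => y /= qy.
apply: le_lt_trans qy; rewrite (le_trans (seminorm_dist _ _ sq))//.
by rewrite opprD addNKr seminormN.
Qed.

Lemma seminorm_ball q x e : seminorm q -> continuous q -> 0 < e ->
  nbhs x [set y | q (y - x) < e].
Proof.
move=> sq cq e0; apply/nbhs0P.
have /cvgrPdist_lt /(_ _ e0) := cq 0; apply: filterS => y /=.
by rewrite (seminorm0 sq) sub0r normrN addrC addKr; apply: le_lt_trans; exact: ler_norm.
Qed.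

End Seminorms.

(** * The Hahn-Banach theorem *)

Section HahnBanach.
Context (R : realType) (E : tvsType R).
Variables (p : E -> R) (sp : seminorm p) (x0 : E).

(** The graph of a partial linear form dominated by [p] and equal to [p] at [x0].
    Domination makes such a linear relation single-valued, so relations need not
    be required to be functions. *)
Let good (A : set (E * R)) := [/\ A (x0, p x0),
  forall z w (t : R), A z -> A w -> A (t *: z.1 + w.1, t * z.2 + w.2) &
  forall z, A z -> z.2 <= p z.1].

Let good0 A : good A -> A (0, 0).
Proof.
by case=> A0 Al _; have := Al _ _ (-1) A0 A0; rewrite scaleN1r mulN1r !addNr.
Qed.

Let goodZ A t z : good A -> A z -> A (t *: z.1, t * z.2).
Proof.
move=> gA Az; have [_ Al _] := gA.
by have := Al _ _ t Az (good0 gA); rewrite /= !addr0.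
Qed.

Let good_fun A x r s : good A -> A (x, r) -> A (x, s) -> r = s.
Proof.
move=> gA Axr Axs; have [_ Al Ad] := gA.
have h u v : A (x, u) -> A (x, v) -> u <= v.
  move=> Au Av; have /Ad/= := Al _ _ (-1) Av Au.
  by rewrite scaleN1r addNr (seminorm0 sp) mulN1r addrC subr_le0.
by apply/le_anti; rewrite !h.
Qed.

(** One more dimension: the value [c] at [y] has to separate the numbers
    [r - p (x - y)] from the numbers [p (x + y) - r], for [(x, r)] in the graph,
    and the triangle inequality for [p] leaves room for the supremum of the
    former. *)
Let good_ext A y : good A -> exists B, [/\ good B, A `<=` B & exists c, B (y, c)].
Proof.
move=> gA; have [A0 Al Ad] := gA.
pose S := [set z.2 - p (z.1 - y) | z in A].
have Sub z w : A z -> A w -> z.2 - p (z.1 - y) <= p (w.1 + y) - w.2.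
  move=> Az Aw; have /Ad/= := Al _ _ 1 Az Aw.
  rewrite scale1r mul1r => h.
  rewrite lerBlDr addrAC lerBrDr (le_trans h)//.
  have -> : z.1 + w.1 = (w.1 + y) + (z.1 - y) by rewrite addrC addrACA subrr addr0.
  exact: sp.1.
have S0 : S !=set0 by exists (p x0 - p (x0 - y)); exists (x0, p x0).
have hasS : has_sup S.
  split=> //; exists (p (x0 + y) - p x0) => _ [z Az <-].
  exact: (Sub _ _ Az A0).
pose c := sup S.
have c1 z : A z -> z.2 - p (z.1 - y) <= c.
  by move=> Az; apply: sup_upper_bound => //; exists z.
have c2 w : A w -> c <= p (w.1 + y) - w.2.
  by move=> Aw; apply: ge_sup => // _ [z Az <-]; exact: Sub.
exists [set z | exists w t, A w /\ z = (w.1 + t *: y, w.2 + t * c)]; split.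
- split.
  + by exists (x0, p x0), 0; split=> //=; rewrite scale0r mul0r !addr0.
  + move=> _ _ t [w1 [t1 [Aw1 ->]]] [w2 [t2 [Aw2 ->]]] /=.
    exists (t *: w1.1 + w2.1, t * w1.2 + w2.2), (t * t1 + t2); split.
      exact: Al.
    congr pair; rewrite /=.
      by rewrite scalerDr scalerDl scalerA addrACA.
    by rewrite mulrDr mulrDl mulrA addrACA.
  + move=> _ [w [t [Aw ->]]] /=.
    have [t0|t0|->] := ltgtP t 0; last by rewrite scale0r mul0r !addr0 Ad.
    * have := c1 _ (goodZ (- t^-1) gA Aw) => /=.
      rewrite -(ler_pM2l (_ : 0 < - t)) ?oppr_gt0// mulrBr mulrA mulrNN divff ?lt_eqF// mul1r.
      have -> : - t * p (- t^-1 *: w.1 - y) = p (w.1 + t *: y).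
        rewrite -(ltr0_norm t0) -sp.2 -seminormN// scalerBr scalerA mulrN divff ?lt_eqF//.
        by rewrite scaleN1r opprB opprK addrC.
      by rewrite lerBlDr mulNr addrC -lerBlDr opprK.
    * have := c2 _ (goodZ (t^-1) gA Aw) => /=.
      rewrite -(ler_pM2l t0) mulrBr mulrA divff ?gt_eqF// mul1r.
      rewrite -{2}(gtr0_norm t0) -sp.2 scalerDr scalerA divff ?gt_eqF// scale1r.
      by rewrite lerBrDl.
- move=> [z1 z2] Az; exists (z1, z2), 0; split=> //=.
  by rewrite scale0r mul0r !addr0.
- exists c, (0, 0), 1; split; first exact: good0.
  by rewrite /= !add0r scale1r mul1r.
Qed.

(** Zorn's lemma for the graphs [good], ordered by inclusion. *)
Theorem hahn_banach : exists l : {linear E -> R^o},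
  l x0 = p x0 /\ forall x, `|l x| <= p x.
Proof.
(* the empty relation is admitted so that the union of the empty chain qualifies *)
have [F FP Ftot|A [PA Amax]] := @Zorn_bigcup _ [set A | A !=set0 -> good A].
  move=> [z0 [A0 FA0 A0z0]].
  have gA X : F X -> X !=set0 -> good X by move=> FX X0; exact: (FP X FX).
  have g0 := gA _ FA0 (ex_intro _ _ A0z0).
  split.
  - by exists A0 => //; case: g0.
  - move=> z w t [X FX Xz] [Y FY Yw].
    have [XY|YX] := Ftot _ _ FX FY.
      exists Y => //; have [_ + _] := gA _ FY (ex_intro _ _ Yw).
      by apply => //; exact: XY.
    exists X => //; have [_ + _] := gA _ FX (ex_intro _ _ Xz).
    by apply => //; exact: YX.
  - by move=> z [X FX Xz]; have [_ _] := gA _ FX (ex_intro _ _ Xz); exact.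
pose G0 := [set (t *: x0, t * p x0) | t in [set: R]].
have gG0 : good G0.
  split; first by exists 1 => //; rewrite scale1r mul1r.
    move=> _ _ t [t1 _ <-] [t2 _ <-] /=; exists (t * t1 + t2) => //.
    by rewrite scalerDl mulrDl scalerA mulrA.
  move=> _ [t _ <-] /=; rewrite sp.2 ler_wpM2r ?seminorm_ge0//.
  exact: ler_norm.
have A0 : A !=set0.
  apply: contrapT => nA; apply: (Amax G0) => //.
  rewrite properEneq; split; last by move=> z Az; case: nA; exists z.
  by apply/eqP => AG; apply: nA; rewrite AG; exists (x0, p x0); case: gG0.
have {}PA := PA A0.
have tot y : exists c, A (y, c).
  have [B [gB AB [c Bc]]] := good_ext y PA.
  exists c; apply: contrapT => nA; apply: (Amax B) => //.
  rewrite properEneq; split => //.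
  by apply/eqP => AE; apply: nA; rewrite AE.
pose l y : R^o := projT1 (cid (tot y)).
have lP y : A (y, l y) by rewrite /l; case: cid.
have [A1 Al Ad] := PA.
have ll : linear l.
  move=> t x y; apply: (good_fun PA (lP _)).
  exact: (Al (x, l x) (y, l y) t).
pose lL := GRing.isLinear.Build R E R^o *:%R l ll.
pose L : {linear E -> R^o} := HB.pack l lL.
exists L; split; first exact: (good_fun PA (lP _)).
move=> x; rewrite ler_norml; apply/andP; split; last exact: (Ad _ (lP x)).
rewrite lerNl -(seminormN x sp).
have -> : - L x = L (- x) by rewrite linearN.
exact: (Ad _ (lP (- x))).
Qed.

End HahnBanach.

(** * Minkowski gauges and separation *)

Section Gauge.
Context (R : realType) (E : tvsType R).

Lemma linear_le_continuous (q : E -> R) (l : {linear E -> R^o}) :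
  seminorm q -> continuous q -> (forall x, `|l x| <= q x) -> continuous l.
Proof.
move=> sq cq lq x; apply/cvgrPdist_lt => e e0.
apply: filterS (seminorm_ball x sq cq e0) => y /= h.
by rewrite -linearB; apply: le_lt_trans (lq _) _; rewrite seminormBC.
Qed.

Lemma scale_cvg0 (x : E) (U : set E) : nbhs 0 U ->
  \forall t \near (0 : R), U (t *: x).
Proof.
move=> U0; have := @scale_continuous _ E (0, x) U; rewrite /= scale0r => /(_ U0).
case=> -[A B] /= [A0 Bx] AB; apply: filterS A0 => t At.
by apply: (AB (t, x)); split => //=; exact: nbhs_singleton Bx.
Qed.

(** A convex neighbourhood intersected with its reflection is convex and
    symmetric. *)
Lemma convex_nbhs (U : set E) : nbhs 0 U -> exists C : set E,
  [/\ nbhs 0 C, C `<=` U, forall x, C x -> C (- x) &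
   forall x y (t : R), C x -> C y -> 0 <= t -> t <= 1 -> C (t *: x + (1 - t) *: y)].
Proof.
move=> U0; have [B Bc [Bo Bb]] := @locally_convex R E.
have [/= b [Bob b0] bU] := Bb 0 U U0.
exists (b `&` [set x | b (- x)]); split.
- apply: filterI; first by apply: open_nbhs_nbhs; split => //; exact: Bo.
  have : nbhs (- 0) b by rewrite oppr0; apply: open_nbhs_nbhs; split => //; exact: Bo.
  by move/(@opp_continuous E 0).
- by move=> x [/bU].
- by move=> x [? ?]; split => //=; rewrite opprK.
have cb x y (t : R) : b x -> b y -> 0 <= t -> t <= 1 -> b (t *: x + (1 - t) *: y).
  move=> bx b_y t0 t1.
  have bB : b \in B by exact/mem_set.
  pose k : {i01 R} := Itv01 t0 t1.
  by have /set_mem := Bc b bB x y k (mem_set bx) (mem_set b_y).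
move=> x y t [bx bnx] [b_y bny] t0 t1; split; first exact: cb.
by rewrite /= opprD -!scalerN; exact: cb.
Qed.

(** The Minkowski gauge of a convex symmetric neighbourhood. *)
Lemma seminorm_nbhs (U : set E) : nbhs 0 U -> exists q : E -> R,
  [/\ seminorm q, continuous q & forall x, q x < 1 -> U x].
Proof.
move=> /convex_nbhs[C [C0 CU CN Cc]].
have C00 : C 0 by exact: nbhs_singleton C0.
pose S x := [set r : R | 0 < r /\ C (r^-1 *: x)].
have S0 x : S x !=set0.
  have [e /= e0 eP] := scale_cvg0 x C0.
  exists (e / 2)^-1; split; first by rewrite invr_gt0 divr_gt0.
  rewrite invrK; apply: eP => /=.
  by rewrite sub0r normrN gtr0_norm ?divr_gt0// gtr_pMr// invf_lt1// ltr1n.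
have Slb x : lbound (S x) 0 by move=> r [/ltW].
have Si x : has_inf (S x) by split => //; exists 0.
pose q x := inf (S x).
have q_le x r : S x r -> q x <= r by move=> Sr; apply: ge_inf => //; exists 0.
have q_ge x m : (forall r, S x r -> m <= r) -> m <= q x by move=> h; exact: lb_le_inf.
have qlt x e : q x < e -> exists2 r, S x r & r < e.
  by move=> /(inf_lt (S0 x))[r Sr re]; exists r.
have q0 : q 0 = 0.
  apply/le_anti/andP; split; last exact: q_ge (Slb 0).
  apply/ler_addgt0Pr => e e0; rewrite add0r; apply: q_le; split => //.
  by rewrite scaler0.
have qZ1 (t : R) x : t != 0 -> q (t *: x) <= `|t| * q x.
  move=> t0; rewrite -ler_pdivrMl ?normr_gt0//; apply: q_ge => r [r0 Cr].
  rewrite ler_pdivrMl ?normr_gt0//; apply: q_le; split.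
    by rewrite mulr_gt0 ?normr_gt0.
  rewrite scalerA; have [t1|t1] := ltP 0 t.
    by rewrite gtr0_norm// invfM mulrAC mulVf// mul1r.
  rewrite ler0_norm// invfM invrN !mulNr mulrAC mulVf// mul1r scaleNr.
  exact: CN.
have qZ (t : R) x : q (t *: x) = `|t| * q x.
  have [->|t0] := eqVneq t 0; first by rewrite scale0r q0 normr0 mul0r.
  apply/le_anti; rewrite qZ1//= -ler_pdivlMl ?normr_gt0//.
  by rewrite -normfV (le_trans _ (qZ1 t^-1 (t *: x) _)) ?invr_eq0// scalerA mulVf// scale1r.
have qD x y : q (x + y) <= q x + q y.
  apply/ler_addgt0Pr => e e0.
  have [r [r0 Cr] rq] : exists2 r, S x r & r < q x + e / 2 by apply: qlt; rewrite ltrDl divr_gt0.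
  have [s [s0 Cs] sq] : exists2 r, S y r & r < q y + e / 2 by apply: qlt; rewrite ltrDl divr_gt0.
  apply: (@le_trans _ _ (r + s)); last first.
    by rewrite (le_trans (ltW (ltrD rq sq)))// addrACA -splitr.
  apply: q_le; have rs : 0 < r + s by rewrite addr_gt0.
  split=> //.
  have := Cc _ _ (r / (r + s)) Cr Cs; rewrite !scalerA.
  have -> : r / (r + s) / r = (r + s)^-1 by rewrite mulrAC divff ?gt_eqF// mul1r.
  have -> : (1 - r / (r + s)) / s = (r + s)^-1.
    rewrite -{1}(@divff _ (r + s)) ?gt_eqF// -mulrBl addrAC subrr add0r.
    by rewrite mulrAC divff ?gt_eqF// mul1r.
  rewrite -scalerDr; apply; first by rewrite divr_ge0 // ltW.
  by rewrite ler_pdivrMr// mul1r lerDl ltW.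
have sq : seminorm q by split.
have q1 x : q x < 1 -> C x.
  move=> /qlt[r [r0 Cr] r1].
  have := Cc _ _ r Cr C00 (ltW r0) (ltW r1).
  by rewrite scaler0 addr0 scalerA divff ?gt_eqF// scale1r.
exists q; split => //; last by move=> x /q1/CU.
apply: seminorm_continuous => // e e0.
have e2 : e / 2 != 0 by rewrite gt_eqF// divr_gt0.
apply: filterS (nbhs0Z e2 C0) => _ [y Cy <-] /=.
have : q y <= 1 by apply: q_le; split; rewrite ?invr1 ?scale1r.
rewrite qZ gtr0_norm ?divr_gt0// => h.
apply: (@le_lt_trans _ _ (e / 2 * 1)); first by rewrite ler_wpM2l ?divr_ge0// ltW.
by rewrite mulr1 ltr_pdivrMr// ltr_pMr// ltr1n.
Qed.

Lemma hausdorff_sep (x : E) : hausdorff_space E -> x != 0 ->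
  exists q : E -> R, [/\ seminorm q, continuous q & 0 < q x].
Proof.
move=> hE x0; move: (hE); rewrite open_hausdorff => /(_ _ _ x0)[[A B]]/=.
rewrite !inE => -[xA B0 [oA oB AB]].
have /seminorm_nbhs[q [sq cq qB]] : nbhs 0 B by apply: open_nbhs_nbhs.
exists q; split => //; rewrite ltNge; apply/negP => qx.
have /qB Bx : q x < 1 by apply: le_lt_trans qx _.
by have : (A `&` B) x by []; move/disjoints_subset: AB => /(_ x)/= /[swap] -[Ax _] /(_ Ax).
Qed.

(** Weak integrals are characterized by continuous linear forms; this turns an
    equality tested by such forms into an equality of vectors. *)
Lemma linear_sep (x : E) : hausdorff_space E ->
  (forall l : {linear E -> R^o}, continuous l -> l x = 0) -> x = 0.
Proof.
move=> hE h; apply/eqP; apply: contrapT => /negP x0.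
have [q [sq cq qx]] := hausdorff_sep hE x0.
have [l [lx lq]] := hahn_banach sq x.
by move: qx; rewrite -lx h ?ltxx//; exact: linear_le_continuous lq.
Qed.

(** Continuous seminorms are directed upwards (two of them are bounded by their
    sum), so bounds that are stable under enlarging the seminorm pass from
    neighbourhoods to compact sets. *)
Lemma compact_seminorm (T : topologicalType) (K : set T) (P : (E -> R) -> T -> Prop) :
  compact K ->
  (forall q q' x, seminorm q -> continuous q -> seminorm q' -> continuous q' ->
     (forall v, q v <= q' v) -> P q x -> P q' x) ->
  (forall x, K x -> exists q, [/\ seminorm q, continuous q &
     \forall x' \near x, P q x']) ->
  exists q, [/\ seminorm q, continuous q & forall x, K x -> P q x].
Proof.
move=> /compact_near_coveringP cK mono loc.
pose cs := [set q : E -> R | seminorm q /\ continuous q].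
pose F := filter_from cs (fun q => [set q' | cs q' /\ forall v, q v <= q' v]).
have cs0 : cs (fun=> 0).
  split; last by move=> ?; exact: cvg_cst.
  by split => *; rewrite ?addr0 ?mulr0.
have csD q q' : cs q -> cs q' -> cs (fun v => q v + q' v).
  move=> [sq cq] [sq' cq']; split; last by move=> v; apply: cvgD; [exact: cq|exact: cq'].
  split=> [x y|t x]; last by rewrite sq.2 sq'.2 mulrDr.
  by rewrite addrACA lerD// ?sq.1 ?sq'.1.
have FF : Filter F.
  apply: filter_from_filter; first by exists (fun=> 0).
  move=> q q' cq cq'; exists (fun v => q v + q' v); first exact: csD.
  move=> r [cr qr]; split; split=> // v; apply: le_trans (qr v).
    by rewrite lerDl seminorm_ge0//; case: cq'.
  by rewrite lerDr seminorm_ge0//; case: cq.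
have [|q [sq cq] qP] := cK _ F P FF.
  move=> x Kx; have [q [sq cq nP]] := loc x Kx.
  exists ([set x' | P q x'], [set q' | cs q' /\ forall v, q v <= q' v]).
    by split=> //=; exists q.
  by move=> [x' q'] [/= Px' [[sq' cq'] qq']]; exact: (mono q).
exists q; split => // x Kx; apply: (qP q) => //; split=> //.
Qed.

End Gauge.

(** * Limits in locally convex spaces *)

Section TvsTopology.
Context (R : realType).

Lemma open_nbhs_in (T : topologicalType) (U : set T) x : open U -> U x -> nbhs x U.
Proof. by move=> oU Ux; apply: open_nbhs_nbhs. Qed.

Lemma pair_cvg (T : Type) (U V : topologicalType) (F : set_system T) {FF : Filter F}
  (f : T -> U) (g : T -> V) (a : U) (b : V) :
  f @ F --> a -> g @ F --> b -> (fun x => (f x, g x)) @ F --> (a, b).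
Proof. by move=> fa gb; exact: cvg_pair fa gb. Qed.

Lemma tcvgD (E : tvsType R) (T : Type) (F : set_system T) {FF : Filter F}
  (f g : T -> E) (a b : E) :
  f @ F --> a -> g @ F --> b -> f x + g x @[x --> F] --> a + b.
Proof. by move=> fa gb; apply: continuous2_cvg fa gb; exact: (@add_continuous E (a, b)). Qed.

Lemma tcvgZ (E : tvsType R) (T : Type) (F : set_system T) {FF : Filter F}
  (s : T -> R) (g : T -> E) (a : R) (b : E) :
  s @ F --> a -> g @ F --> b -> s x *: g x @[x --> F] --> a *: b.
Proof.
move=> fa gb; apply: (@continuous2_cvg T R^o E E F FF s g (fun r x => r *: x)) fa gb.
exact: (@scale_continuous R E (a, b)).
Qed.

Lemma tcvgN (E : tvsType R) (T : Type) (F : set_system T) {FF : Filter F}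
  (f : T -> E) (a : E) : f @ F --> a -> - f x @[x --> F] --> - a.
Proof. by move=> fa; apply: continuous_cvg fa; exact: (@opp_continuous E a). Qed.

Lemma tcvgB (E : tvsType R) (T : Type) (F : set_system T) {FF : Filter F}
  (f g : T -> E) (a b : E) :
  f @ F --> a -> g @ F --> b -> f x - g x @[x --> F] --> a - b.
Proof. by move=> fa gb; apply: tcvgD fa _; exact: tcvgN. Qed.

(** Continuous seminorms determine the topology. *)
Lemma tvs_cvgP (E : tvsType R) (T : Type) (F : set_system T) {FF : Filter F}
  (f : T -> E) (l : E) :
  (forall q, seminorm q -> continuous q -> forall e : R, 0 < e ->
    \forall x \near F, q (f x - l) < e) -> f @ F --> l.
Proof.
move=> h U /nbhs0P /seminorm_nbhs[q [sq cq qU]].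
apply: filterS (h q sq cq 1 ltr01) => x /= /qU/=.
by rewrite addrC subrK.
Qed.

Lemma hausdorff_prod (S T : topologicalType) :
  hausdorff_space S -> hausdorff_space T -> hausdorff_space (S * T)%type.
Proof.
move=> hS hT [a b] [c d] cl; congr pair.
  apply: hS => A B Aa Bc.
  have [||[x y] [/= [Ax _] [Bx _]]] := cl (A `*` setT) (B `*` setT).
  - by exists (A, setT) => //=; split => //; exact: filterT.
  - by exists (B, setT) => //=; split => //; exact: filterT.
  by exists x.
apply: hT => A B Aa Bc.
have [||[x y] [/= [_ Ay] [_ By]]] := cl (setT `*` A) (setT `*` B).
- by exists (setT, A) => //=; split => //; exact: filterT.
- by exists (setT, B) => //=; split => //; exact: filterT.
by exists y.
Qed.

End TvsTopology.

(** * Directional derivatives and the mean value inequality *)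

Section DirectionalDerivative.
Context (R : realType) (E F : tvsType R).
Hypothesis hF : hausdorff_space F.
Implicit Types (f g : E -> F).

Lemma dirderE f x y l : is_dirder f x y l -> dirder f x y = l.
Proof.
move=> h; apply: xget_unique => // l' h'.
exact: (cvg_unique hF h' h).
Qed.

Lemma dirder_ex f x y : (exists l, is_dirder f x y l) -> is_dirder f x y (dirder f x y).
Proof. by move=> [l h]; rewrite (dirderE h). Qed.

(** Clearing the denominator gives an estimate that includes [t = 0]. *)
Lemma is_dirderP f x y l : is_dirder f x y l <->
  forall q, seminorm q -> continuous q -> forall e : R, 0 < e ->
   exists2 d : R, 0 < d & forall t : R, `|t| < d ->
     q (f (x + t *: y) - f x - t *: l) <= e * `|t|.
Proof.
have key q t : seminorm q -> t != 0 ->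
    q (f (x + t *: y) - f x - t *: l) =
    `|t| * q (t^-1 *: (f (x + t *: y) - f x) - l).
  by move=> sq t0; rewrite -sq.2 scalerBr scalerA divff// scale1r.
split=> [h q sq cq e e0|h].
  have /h := seminorm_ball l sq cq e0.
  case=> d /= d0 hd; exists d => // t td.
  have [->|t0] := eqVneq t 0.
    by rewrite !scale0r addr0 subrr subr0 (seminorm0 sq) normr0 mulr0.
  rewrite key// mulrC ler_wpM2r//; apply/ltW/hd => //=.
  by rewrite sub0r normrN.
apply: tvs_cvgP => q sq cq e e0.
have e2 : 0 < e / 2 by rewrite divr_gt0.
have [d d0 hd] := h q sq cq (e / 2) e2.
exists d => //= t; rewrite /= sub0r normrN => td t0.
have := hd t td; rewrite key// mulrC ler_pM2r ?normr_gt0//.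
by move/le_lt_trans; apply; rewrite ltr_pdivrMr// ltr_pMr// ltr1n.
Qed.

Lemma is_dirderZ f x y l (t : R) : is_dirder f x y l -> is_dirder f x (t *: y) (t *: l).
Proof.
move=> /is_dirderP h; apply/is_dirderP => q sq cq e e0.
have t1 : 0 < `|t| + 1 by rewrite ltr_wpDl.
have [d d0 hd] := h q sq cq (e / (`|t| + 1)) (divr_gt0 e0 t1).
exists (d / (`|t| + 1)); first exact: divr_gt0.
move=> s; rewrite ltr_pdivlMr// => sd; rewrite !scalerA.
have st : `|s * t| < d.
  by rewrite normrM (le_lt_trans _ sd)// ler_wpM2l// lerDl.
rewrite (le_trans (hd _ st))// normrM mulrA mulrAC ler_wpM2r//.
by rewrite -mulrA ler_piMr ?(ltW e0)// mulrC ler_pdivrMr// mul1r lerDl ler01.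
Qed.

(** A Hahn-Banach form that attains [p] at [f (x + h) - f x - z] reduces the claim
    to the mean value theorem for a real function. *)
Lemma mean_value (p : F -> R) f x h (D : R -> F) z m :
  seminorm p -> continuous p ->
  (forall s : R, 0 <= s <= 1 -> is_dirder f (x + s *: h) h (D s)) ->
  (forall s : R, 0 <= s <= 1 -> p (D s - z) <= m) ->
  p (f (x + h) - f x - z) <= m.
Proof.
move=> sp cp fD Dm.
have [l [lE lp]] := hahn_banach sp (f (x + h) - f x - z).
have cl := linear_le_continuous sp cp lp.
pose c (s : R) : R := l (f (x + s *: h)).
have dc (s : R) : 0 <= s <= 1 -> is_derive (s : R^o) (1 : R^o) (c : R^o -> R^o) (l (D s)).
  move=> s01.
  have dl : (fun t : R => t^-1 *: ((c \o shift s) (t *: (1 : R^o)) - c s)) @ (0 : R)^' --> l (D s).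
    rewrite (_ : (fun t : R => _) =
        l \o (fun t : R => t^-1 *: (f (x + s *: h + t *: h) - f (x + s *: h)))).
      exact: cvg_comp _ _ (fD s s01) (cl (D s)).
    have e t : x + (t *: (1 : R^o) + s) *: h = x + s *: h + t *: h.
      by rewrite -addrA -scalerDl [in RHS]addrC -[t *: _]/(t * 1) mulr1 [in RHS]addrC (addrC s).
    by apply/funext => t; rewrite /= linearZ /= -e; congr (_ *: _); exact: esym (linearB l _ _).
  split; first by apply/cvg_ex; exists (l (D s)).
  exact: (cvg_lim (@norm_hausdorff _ _) dl).
have [||s s01] := @MVT_segment R c (fun s => l (D s)) 0 1 ler01.
- by move=> s; rewrite in_itv/= => /andP[s0 s1]; apply: dc; rewrite !ltW.
- apply: derivable_within_continuous => s; rewrite in_itv/= => s01.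
  by have [] := dc s s01.
rewrite subr0 mulr1 {1}/c {1}/c scale1r scale0r addr0 -linearB => fDs.
rewrite -lE [X in X <= _]linearB fDs -[_ - _]linearB.
rewrite (le_trans (ler_norm _))// (le_trans (lp _))// Dm//.
Qed.

(** The germ at [x] of a C^1 condition: this is all that the chain rule uses of
    the outer map. *)
Definition C1at f x :=
  (\forall x' \near x, forall y, exists l, is_dirder f x' y l) /\
  (forall y, (fun z : (E * E)%type => dirder f z.1 z.2) @ (x, y) --> dirder f x y).

Lemma C1at_is f x y : C1at f x -> is_dirder f x y (dirder f x y).
Proof. by move=> [/nbhs_singleton h _]; apply: dirder_ex; exact: h. Qed.

Lemma dirderZ f x y t : C1at f x -> dirder f x (t *: y) = t *: dirder f x y.
Proof. by move=> h; apply: dirderE; apply: is_dirderZ; exact: C1at_is. Qed.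

(** Convergence of difference quotients when the base point, the step and the
    direction move at the same time. A moving base point yields additivity of the
    derivative, a moving direction yields the chain rule. *)
Lemma C1at_dq (T : Type) (G : set_system T) {FG : Filter G}
  (b : T -> E) (t : T -> R) (w : T -> E) f x y q e : C1at f x ->
  b @ G --> x -> t @ G --> (0 : R) -> w @ G --> y ->
  seminorm q -> continuous q -> 0 < e ->
  \forall i \near G, q (f (b i + t i *: w i) - f (b i) - t i *: dirder f x y)
     <= e * `|t i|.
Proof.
move=> [dx cx] bx t0 wy sq cq e0.
have /(cx y) [[U V] /= [Ux Vy] UV] := seminorm_ball (dirder f x y) sq cq e0.
pose U' := U `&` [set x' | forall y, exists l, is_dirder f x' y l].
have U'x : nbhs x U' by exact: filterI.
have : (fun z : (E * (R^o * E))%type => z.1 + z.2.1 *: z.2.2) @ (x, (0, y)) --> x + 0 *: y.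
  apply: tcvgD; first exact: cvg_fst.
  apply: (@tcvgZ _ _ _ _ _ (fun z : (E * (R^o * E))%type => z.2.1)).
    exact: (cvg_comp _ _ cvg_snd cvg_fst).
  exact: (cvg_comp _ _ cvg_snd cvg_snd).
rewrite scale0r addr0 => /(_ _ U'x)[[X S]] /= [Xx [[S1 S2] /= [[d /= d0 S1d] S2y] S12]] XS.
near=> i.
have Xb : X (b i) by near: i; exact: bx.
have td : `|t i| < d.
  by near: i; move/cvgrPdist_lt : t0 => /(_ _ d0); apply: filterS => j; rewrite sub0r normrN.
have S2w : S2 (w i) by near: i; exact: wy.
have Vw : V (w i) by near: i; exact: wy.
have seg (s : R) : 0 <= s <= 1 -> U' (b i + s *: (t i *: w i)).
  move=> /andP[s0 s1]; rewrite scalerA.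
  apply: (XS (b i, (s * t i, w i))); split => //=; apply: (S12 (_, _)); split => //=.
  apply: S1d; rewrite /= sub0r normrN normrM ger0_norm//.
  by rewrite (le_lt_trans _ td)// ler_piMl.
rewrite mulrC; apply: (@mean_value q f (b i) (t i *: w i)
    (fun s => t i *: dirder f (b i + s *: (t i *: w i)) (w i))) => //.
  by move=> s /seg [_ /(_ (w i)) h]; apply: is_dirderZ; exact: dirder_ex.
move=> s /seg [Us _]; rewrite -scalerBr sq.2 ler_wpM2l//; apply/ltW.
by apply: (UV (_, _)); split.
Unshelve. all: by end_near. Qed.

(** The increment from [x] to [x + t v + t w] is split at [x + t v]. *)
Lemma dirderD f x v w : C1at f x -> dirder f x (v + w) = dirder f x v + dirder f x w.
Proof.
move=> fx; apply: dirderE; apply/is_dirderP => q sq cq e e0.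
have e2 : 0 < e / 2 by rewrite divr_gt0.
have idn : (fun t : R => t) @ (0 : R) --> (0 : R) by exact: cvg_id.
have bv : (fun t : R => x + t *: v) @ (0 : R) --> x.
  rewrite -[X in _ --> X]addr0 -(scale0r v).
  by apply: tcvgD; [exact: cvg_cst|apply: tcvgZ => //; exact: cvg_cst].
have : \forall t \near nbhs (0 : R),
    q (f (x + t *: v) - f x - t *: dirder f x v) <= e / 2 * `|t| /\
    q (f (x + t *: v + t *: w) - f (x + t *: v) - t *: dirder f x w) <= e / 2 * `|t|.
  near=> t; split; near: t.
    by apply: (@C1at_dq R _ _ (fun=> x) id (fun=> v) f x v q) => //; exact: cvg_cst.
  by apply: (@C1at_dq R _ _ (fun t : R => x + t *: v) id (fun=> w) f x w q) => //; exact: cvg_cst.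
case=> d d0 h; exists d => // t td; have [|h1 h2] := h t; first by rewrite /= sub0r normrN.
rewrite (splitr e) mulrDl; apply: le_trans (lerD h2 h1); apply: le_trans (sq.1 _ _).
rewrite le_eqVlt; apply/orP; left; apply/eqP; congr q.
rewrite !scalerDr addrA; set A := f _; set B := f (x + t *: v).
by rewrite addrACA (addrA (A - B)) subrK -opprD [X in _ - X]addrC.
Unshelve. all: by end_near. Qed.

End DirectionalDerivative.

(** * Operations on maps of class C^k *)

Section ChainRule.
Context (R : realType).

Lemma nbhs_openP (T : topologicalType) (x : T) (A : set T) : nbhs x A ->
  exists U, [/\ open U, U x & U `<=` A].
Proof. by rewrite nbhsE => -[U [oU Ux] UA]; exists U. Qed.

Lemma is_dirder_ext (E F : tvsType R) (f g : E -> F) x y l :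
  (\forall x' \near x, f x' = g x') -> is_dirder f x y l -> is_dirder g x y l.
Proof.
move=> fg; apply: cvg_trans; apply: near_eq_cvg.
have c : (fun t : R => x + t *: y) @ (0 : R) --> x.
  rewrite -[X in _ --> X]addr0 -(scale0r y).
  by apply: tcvgD; [exact: cvg_cst|apply: tcvgZ; [exact: cvg_id|exact: cvg_cst]].
have /nbhs_dnbhs : nbhs (0 : R) [set t | f (x + t *: y) = g (x + t *: y)] by exact: c fg.
apply: filterS => t /= ->.
by rewrite (nbhs_singleton fg).
Qed.

Lemma dirder_ext (E F : tvsType R) (f g : E -> F) x y :
  (\forall x' \near x, f x' = g x') -> dirder f x y = dirder g x y.
Proof.
move=> fg; rewrite /dirder; congr xget; apply/seteqP; split=> l /=.
  exact: is_dirder_ext.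
by apply: is_dirder_ext; apply: filterS fg => ? ->.
Qed.

(** The difference quotient of [g] is a moving direction for [f]. *)
Lemma is_dirder_comp (E F H : tvsType R) (g : E -> F) (f : F -> H) x w l :
  hausdorff_space H ->
  is_dirder g x w l -> C1at f (g x) -> is_dirder (f \o g) x w (dirder f (g x) l).
Proof.
move=> hH gx fx; apply/is_dirderP => q sq cq e e0.
have : \forall t \near (0 : R)^',
  q (f (g x + t *: (t^-1 *: (g (x + t *: w) - g x))) - f (g x) - t *: dirder f (g x) l)
     <= e * `|t|.
  apply: (@C1at_dq R F H hH R (0 : R)^' _ (fun=> g x) id
    (fun t => t^-1 *: (g (x + t *: w) - g x)) f (g x) l q e) => //.
    exact: cvg_cst.
  exact: nbhs_dnbhs.
case=> d /= d0 h; exists d => // t td.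
have [->|t0] := eqVneq t 0.
  by rewrite !scale0r addr0 /= subrr subr0 (seminorm0 sq) normr0 mulr0.
have := h t; rewrite /= sub0r normrN => /(_ td t0).
by rewrite scalerA divff// scale1r [g x + _]addrC subrK.
Qed.

Lemma within_open (S T : topologicalType) (U : set S) (f : S -> T) : open U ->
  ({within U, continuous f} <-> forall x, U x -> f @ x --> f x).
Proof.
move=> oU; rewrite continuous_open_subspace//; split=> h x.
  by move=> Ux; apply: h; exact/mem_set.
by rewrite inE => /h.
Qed.

Lemma openXT (S T : topologicalType) (U : set S) : open U -> open (U `*` [set: T]).
Proof.
move=> oU; rewrite openE => -[x y] [/= Ux _].
by exists (U, setT) => //=; split; [exact: open_nbhs_in|exact: filterT].
Qed.

Lemma openXX (S T : topologicalType) (U : set S) (V : set T) :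
  open U -> open V -> open (U `*` V).
Proof.
move=> oU oV; rewrite openE => -[x y] [/= Ux Vy].
by exists (U, V) => //=; split; exact: open_nbhs_in.
Qed.

Implicit Types (k : nat).

Lemma Ck_cvg k (E F : tvsType R) (U : set E) (f : E -> F) x :
  open U -> Ck k U f -> U x -> f @ x --> f x.
Proof. by move=> oU; case: k => [|k] [/(within_open _ oU) h _]; exact: h. Qed.

Lemma Ck_C1at k (E F : tvsType R) (U : set E) (f : E -> F) x :
  open U -> Ck k.+1 U f -> U x -> C1at f x.
Proof.
move=> oU [_ [df dfc]] Ux; split.
  by apply: filterS (open_nbhs_in oU Ux) => x' Ux' y; exact: df.
move=> y; have := Ck_cvg (openXT (T := E) oU) dfc; apply.
by split.
Qed.

Lemma Ck_ext k (E F : tvsType R) (U : set E) (f g : E -> F) :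
  open U -> (forall x, U x -> f x = g x) -> Ck k U f -> Ck k U g.
Proof.
have near_fg (E' F' : tvsType R) (V : set E') (f' g' : E' -> F') : open V ->
    (forall x, V x -> f' x = g' x) -> forall x, V x -> \forall x' \near x, f' x' = g' x'.
  by move=> oV fg x Vx; apply: filterS (open_nbhs_in oV Vx) => x' /fg.
elim: k E F U f g => [|k IH] E F U f g oU fg /= [fc fd].
  split=> //; apply/within_open => // x Ux; rewrite -fg//.
  apply: cvg_trans ((within_open _ oU).1 fc x Ux); apply: near_eq_cvg.
  by apply: filterS (near_fg _ _ _ _ _ oU fg x Ux) => ? ->.
split.
  apply/within_open => // x Ux; rewrite -fg//.
  apply: cvg_trans ((within_open _ oU).1 fc x Ux); apply: near_eq_cvg.
  by apply: filterS (near_fg _ _ _ _ _ oU fg x Ux) => ? ->.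
case: fd => fd fdc; split.
  move=> x y Ux; have [l fl] := fd x y Ux; exists l.
  by apply: is_dirder_ext fl; exact: near_fg fg _ Ux.
apply: IH fdc; first exact: openXT.
move=> [x y] [/= Ux _]; apply: dirder_ext; exact: near_fg fg _ Ux.
Qed.

(** Being C^k is local: a neighbourhood [V] of [x] gives the neighbourhood
    [V * E] of [(x, y)] on which the derivative is C^(k-1). *)
Lemma Ck_local k (E F : tvsType R) (U : set E) (f : E -> F) : open U ->
  (forall x, U x -> exists V, [/\ open V, V x & Ck k V f]) -> Ck k U f.
Proof.
elim: k E F U f => [|k IH] E F U f oU h.
  split=> //; apply/within_open => // x Ux.
  by have [V [oV Vx fV]] := h x Ux; exact: Ck_cvg fV Vx.
split.
  apply/within_open => // x Ux.
  by have [V [oV Vx fV]] := h x Ux; exact: Ck_cvg fV Vx.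
split.
  by move=> x y Ux; have [V [oV Vx [_ [fV _]]]] := h x Ux; exact: fV.
apply: IH; first exact: openXT.
move=> [x y] [/= Ux _]; have [V [oV Vx [_ [_ fV]]]] := h x Ux.
by exists (V `*` setT); split => //; exact: openXT.
Qed.

Lemma Ck_sub k (E F : tvsType R) (U V : set E) (f : E -> F) : open V -> open U ->
  V `<=` U -> Ck k U f -> Ck k V f.
Proof.
elim: k E F U V f => [|k IH] E F U V f oV oU VU [fc fd].
  by split=> //; apply/within_open => // x /VU; exact: (within_open _ oU).1.
split; first by apply/within_open => // x /VU; exact: (within_open _ oU).1.
case: fd => fd fdc; split; first by move=> x y /VU; exact: fd.
apply: IH fdc; [exact: openXT|exact: openXT|].
by move=> [x y] [/VU].
Qed.

Lemma Ck_mono k (E F : tvsType R) (U : set E) (f : E -> F) : Ck k.+1 U f -> Ck k U f.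
Proof.
elim: k E F U f => [|k IH] E F U f [fc [fd fdc]]; first by [].
by split => //; split => //; exact: IH.
Qed.

(** A predicate on functions rather than a bundled linear map, so that
    projections and their pairings qualify as they are. *)
Definition clinear (E F : tvsType R) (L : E -> F) :=
  (forall (a : R) x y, L (a *: x + y) = a *: L x + L y) /\ continuous L.

Lemma is_dirder_clinear (E F : tvsType R) (L : E -> F) x y :
  clinear L -> is_dirder L x y (L y).
Proof.
move=> [Ll _]; apply: cvg_near_cst; near=> t.
rewrite [x + _]addrC Ll addrK scalerA mulVf ?scale1r//.
by near: t; exact: nbhs_dnbhs_neq.
Unshelve. all: by end_near. Qed.

Lemma Ck_clinear k (E F : tvsType R) (U : set E) (L : E -> F) :
  hausdorff_space F -> open U -> clinear L -> Ck k U L.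
Proof.
move=> hF; elim: k E U L => [|k IH] E U L oU cL.
  by split=> //; apply/within_open => // x Ux; exact: cL.2.
split; first by apply/within_open => // x Ux; exact: cL.2.
split; first by move=> x y _; exists (L y); exact: is_dirder_clinear.
apply: (@Ck_ext k _ _ _ (fun z => L z.2)); first exact: openXT.
  by move=> [x y] _ /=; apply/esym/dirderE => //; exact: is_dirder_clinear.
apply: IH; first exact: openXT.
split; first by move=> a x y /=; exact: cL.1.
by move=> z; apply: (cvg_comp _ _ cvg_snd); exact: cL.2.
Qed.

Lemma Ck_cst k (E F : tvsType R) (U : set E) (c : F) :
  hausdorff_space F -> open U -> Ck k U (fun _ : E => c).
Proof.
move=> hF; elim: k E U c => [|k IH] E U c oU.
  by split=> //; apply/within_open => // x Ux; exact: cvg_cst.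
have d x y : is_dirder (fun _ : E => c) x y 0.
  by apply: cvg_near_cst; near=> t; rewrite subrr scaler0.
split; first by apply/within_open => // x Ux; exact: cvg_cst.
split; first by move=> x y _; exists 0.
apply: (@Ck_ext k _ _ _ (fun=> 0)); first exact: openXT.
  by move=> [x y] _ /=; apply/esym/dirderE.
by apply: IH; exact: openXT.
Unshelve. all: by end_near. Qed.

Lemma is_dirder_pair (E F H : tvsType R) (f : E -> F) (g : E -> H) x y l m :
  is_dirder f x y l -> is_dirder g x y m ->
  is_dirder (fun z => (f z, g z)) x y (l, m).
Proof. by move=> fl gm; exact: (cvg_pair fl gm). Qed.

Lemma Ck_pair k (E F H : tvsType R) (U : set E) (f : E -> F) (g : E -> H) :
  hausdorff_space F -> hausdorff_space H -> open U ->
  Ck k U f -> Ck k U g -> Ck k U (fun z => (f z, g z)).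
Proof.
move=> hF hH; elim: k E U f g => [|k IH] E U f g oU fC gC.
  split=> //; apply/within_open => // x Ux.
  by apply: cvg_pair; [exact: Ck_cvg fC Ux|exact: Ck_cvg gC Ux].
split.
  apply/within_open => // x Ux.
  by apply: cvg_pair; [exact: Ck_cvg fC Ux|exact: Ck_cvg gC Ux].
case: fC gC => fc [fd fdc] [gc [gd gdc]].
have hFH : hausdorff_space (F * H)%type by exact: hausdorff_prod.
split.
  move=> x y Ux; have [l fl] := fd x y Ux; have [m gm] := gd x y Ux.
  by exists (l, m); exact: is_dirder_pair.
apply: (@Ck_ext k _ _ _ (fun z => (dirder f z.1 z.2, dirder g z.1 z.2))).
- exact: openXT.
- move=> [x y] [/= Ux _]; apply/esym/dirderE => //; apply: is_dirder_pair.
    by apply: dirder_ex => //; exact: fd.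
  by apply: dirder_ex => //; exact: gd.
by apply: IH => //; exact: openXT.
Qed.

Lemma clinear_fst (E F : tvsType R) : clinear (fst : (E * F)%type -> E).
Proof. by split=> // x; exact: cvg_fst. Qed.

Lemma clinear_snd (E F : tvsType R) : clinear (snd : (E * F)%type -> F).
Proof. by split=> // x; exact: cvg_snd. Qed.

Lemma clinear_comp (X Y Z : tvsType R) (L : X -> Y) (K : Y -> Z) :
  clinear L -> clinear K -> clinear (K \o L).
Proof.
move=> [Ll Lc] [Kl Kc]; split=> [a x y|x] /=; first by rewrite Ll Kl.
by apply: (cvg_comp _ _ (Lc x)); exact: Kc.
Qed.

Lemma clinear_pair (X Y Z : tvsType R) (L : X -> Y) (K : X -> Z) :
  clinear L -> clinear K -> clinear (fun x => (L x, K x)).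
Proof.
move=> [Ll Lc] [Kl Kc]; split=> [a x y|x] /=; first by rewrite Ll Kl.
by apply: pair_cvg; [exact: Lc|exact: Kc].
Qed.

(** Induction on [k]: the derivative of [f \o g] is the derivative of [f] composed
    with [(x, y) |-> (g x, dirder g x y)], and both are of class C^(k-1). *)
Lemma Ck_comp k (E F H : tvsType R) (U : set E) (V : set F) (f : F -> H) (g : E -> F) :
  hausdorff_space E -> hausdorff_space F -> hausdorff_space H ->
  open U -> open V -> (forall x, U x -> V (g x)) ->
  Ck k V f -> Ck k U g -> Ck k U (f \o g).
Proof.
elim: k E F H U V f g => [|k IH] E F H U V f g hE hF hH oU oV UV fC gC.
  split=> //; apply/within_open => // x Ux.
  by apply: (cvg_comp _ _ (Ck_cvg oU gC Ux)); exact: (Ck_cvg oV fC (UV _ Ux)).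
split.
  apply/within_open => // x Ux.
  by apply: (cvg_comp _ _ (Ck_cvg oU gC Ux)); exact: (Ck_cvg oV fC (UV _ Ux)).
have dfg x y : U x -> is_dirder (f \o g) x y (dirder f (g x) (dirder g x y)).
  move=> Ux; apply: is_dirder_comp => //; last by apply: (Ck_C1at oV fC); exact: UV.
  by apply: C1at_is => //; exact: (Ck_C1at oU gC).
split; first by move=> x y Ux; eexists; exact: dfg.
have gC' := Ck_mono gC.
case: fC gC dfg => fc [fd fdc] [gc [gd gdc]] dfg.
apply: (@Ck_ext k _ _ _ ((fun z : (F * F)%type => dirder f z.1 z.2) \o
    (fun z : (E * E)%type => (g z.1, dirder g z.1 z.2)))).
- exact: openXT.
- by move=> [x y] [/= Ux _]; apply/esym/dirderE => //; exact: dfg.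
apply: (IH _ _ _ _ (V `*` setT)) => //.
- exact: hausdorff_prod.
- exact: hausdorff_prod.
- exact: openXT.
- exact: openXT.
- by move=> [x y] [/= Ux _]; split => //=; exact: UV.
apply: Ck_pair => //; first exact: openXT.
apply: (IH (E * E)%type E F (U `*` setT) U g fst) => //.
- exact: hausdorff_prod.
- exact: openXT.
- by move=> [x y] [].
apply: Ck_clinear => //; first exact: openXT.
exact: clinear_fst.
Qed.

End ChainRule.

(** * Germs of smooth maps *)

Section Germs.
Context (R : realType).

(** One neighbourhood serves all orders of differentiability, so that the
    derivative of a smooth germ is again a smooth germ. *)
Definition smooth_at (E F : tvsType R) (f : E -> F) (x : E) : Prop :=
  exists U : set E, [/\ open U, U x & Csmooth U f].

Lemma smooth_at_near (E F : tvsType R) (f : E -> F) x :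
  smooth_at f x -> \forall x' \near x, smooth_at f x'.
Proof.
by move=> [U [oU Ux fU]]; apply: filterS (open_nbhs_in oU Ux) => x' Ux'; exists U.
Qed.

Lemma smooth_at_on (E F : tvsType R) (U : set E) (f : E -> F) x :
  open U -> Csmooth U f -> U x -> smooth_at f x.
Proof. by move=> *; exists U. Qed.

Lemma Csmooth_of_germs (E F : tvsType R) (U : set E) (f : E -> F) :
  open U -> (forall x, U x -> smooth_at f x) -> Csmooth U f.
Proof.
move=> oU h k; apply: Ck_local => // x Ux.
by have [V [oV Vx fV]] := h x Ux; exists V; split.
Qed.

Lemma smooth_at_cvg (E F : tvsType R) (f : E -> F) x : smooth_at f x -> f @ x --> f x.
Proof. by move=> [U [oU Ux fU]]; exact: Ck_cvg (fU 0%N) Ux. Qed.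

Lemma smooth_at_C1 (E F : tvsType R) (f : E -> F) x : smooth_at f x -> C1at f x.
Proof. by move=> [U [oU Ux fU]]; exact: Ck_C1at (fU 1%N) Ux. Qed.

Lemma smooth_at_ext (E F : tvsType R) (f g : E -> F) x :
  (\forall x' \near x, f x' = g x') -> smooth_at f x -> smooth_at g x.
Proof.
move=> fg [U [oU Ux fU]].
have [V [oV Vx VS]] := nbhs_openP fg.
exists (U `&` V); split => //; first exact: openI.
move=> k; apply: (@Ck_ext _ k _ _ _ f); first exact: openI.
  by move=> y [_ /VS].
by apply: (Ck_sub _ oU _ (fU k)); [exact: openI|move=> ? []].
Qed.

Lemma smooth_at_dirder (E F : tvsType R) (f : E -> F) x y : smooth_at f x ->
  smooth_at (fun z : (E * E)%type => dirder f z.1 z.2) (x, y).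
Proof.
move=> [U [oU Ux fU]]; exists (U `*` setT); split => //; first exact: openXT.
by move=> k; have [_ []] := fU k.+1.
Qed.

Lemma smooth_at_cst (E F : tvsType R) (c : F) (x : E) :
  hausdorff_space F -> smooth_at (fun _ : E => c) x.
Proof.
move=> hF; exists setT; split => //; first exact: openT.
by move=> k; apply: Ck_cst => //; exact: openT.
Qed.

Lemma smooth_at_clinear (E F : tvsType R) (L : E -> F) x :
  hausdorff_space F -> clinear L -> smooth_at L x.
Proof.
move=> hF cL; exists setT; split => //; first exact: openT.
by move=> k; apply: Ck_clinear => //; exact: openT.
Qed.

Lemma smooth_at_id (E : tvsType R) (x : E) : hausdorff_space E -> smooth_at id x.
Proof. by move=> hE; apply: smooth_at_clinear => //; split => // ?; exact: cvg_id. Qed.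

Lemma smooth_at_pair (E F H : tvsType R) (f : E -> F) (g : E -> H) x :
  hausdorff_space F -> hausdorff_space H ->
  smooth_at f x -> smooth_at g x -> smooth_at (fun z => (f z, g z)) x.
Proof.
move=> hF hH [U [oU Ux fU]] [V [oV Vx gV]]; exists (U `&` V); split => //.
  exact: openI.
move=> k; have oUV : open (U `&` V) by exact: openI.
apply: Ck_pair => //.
  by apply: (Ck_sub _ oU _ (fU k)) => // ? [].
by apply: (Ck_sub _ oV _ (gV k)) => // ? [].
Qed.

Lemma smooth_at_comp (E F H : tvsType R) (f : F -> H) (g : E -> F) x :
  hausdorff_space E -> hausdorff_space F -> hausdorff_space H ->
  smooth_at g x -> smooth_at f (g x) -> smooth_at (f \o g) x.
Proof.
move=> hE hF hH gx [V [oV Vx fV]].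
have [W [oW Wx WV]] : exists W, [/\ open W, W x & W `<=` [set x' | V (g x')]].
  by apply: nbhs_openP; apply: (smooth_at_cvg gx); exact: open_nbhs_in.
case: gx => [U [oU Ux gU]].
have oUW : open (U `&` W) by exact: openI.
exists (U `&` W); split => // k.
apply: (@Ck_comp R k _ _ _ (U `&` W) V) => //; first by move=> y [_ /WV].
by apply: (Ck_sub _ oU _ (gU k)) => // ? [].
Qed.

Lemma dirder_comp (E F H : tvsType R) (f : F -> H) (g : E -> F) x y :
  hausdorff_space F -> hausdorff_space H ->
  smooth_at g x -> smooth_at f (g x) ->
  dirder (f \o g) x y = dirder f (g x) (dirder g x y).
Proof.
move=> hF hH gx fx; apply: dirderE => //; apply: is_dirder_comp => //.
  by apply: C1at_is => //; exact: smooth_at_C1.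
exact: smooth_at_C1.
Qed.

Lemma dirder_clinear (E F : tvsType R) (L : E -> F) x y :
  hausdorff_space F -> clinear L -> dirder L x y = L y.
Proof. by move=> hF cL; apply: dirderE => //; exact: is_dirder_clinear. Qed.

Lemma dirder_cst (E F : tvsType R) (c : F) (x y : E) :
  hausdorff_space F -> dirder (fun _ : E => c) x y = 0.
Proof.
move=> hF; apply: dirderE => //; apply: cvg_near_cst; near=> t.
by rewrite subrr scaler0.
Unshelve. all: by end_near. Qed.

Lemma dirder_pair (E F H : tvsType R) (f : E -> F) (g : E -> H) x y :
  hausdorff_space F -> hausdorff_space H -> smooth_at f x -> smooth_at g x ->
  dirder (fun z => (f z, g z)) x y = (dirder f x y, dirder g x y).
Proof.
move=> hF hH fx gx; apply: dirderE; first exact: hausdorff_prod.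
by apply: is_dirder_pair; apply: C1at_is => //; exact: smooth_at_C1.
Qed.

(** Freezing the second variable is an affine substitution with derivative
    [w |-> (w, 0)]. *)
Lemma dirder_partial (X P H : tvsType R) (T : (X * P)%type -> H) x z w :
  hausdorff_space X -> hausdorff_space P -> hausdorff_space H ->
  smooth_at T (x, z) ->
  smooth_at (fun x => T (x, z)) x /\ dirder (fun x => T (x, z)) x w = dirder T (x, z) (w, 0).
Proof.
move=> hX hP hH Tx.
have s : smooth_at (fun x : X => (x, z)) x.
  by apply: smooth_at_pair => //; [exact: smooth_at_id|exact: smooth_at_cst].
split.
  by apply: (smooth_at_comp (f := T) (g := fun x => (x, z))) => //; exact: hausdorff_prod.
have -> : (w, 0) = dirder (fun x : X => (x, z)) x w.
  rewrite dirder_pair//; last 2 first.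
    exact: smooth_at_id.
    exact: smooth_at_cst.
  by rewrite dirder_cst// (dirder_clinear (L := id))//; split => // ?; exact: cvg_id.
by rewrite -(dirder_comp (f := T) (g := fun x => (x, z)))//; exact: hausdorff_prod.
Qed.

End Germs.

(** * Second-order estimates near compact sets *)

Section UniformEstimate.
Context (R : realType).

(** Rescaling [w] by [(q w + e)^-1] and letting [e] tend to 0, which covers the
    case [q w = 0]. *)
Lemma homog_bound (X H : tvsType R) (q : X -> R) (p : H -> R) (L : X -> H) m :
  seminorm q -> seminorm p -> (forall (t : R) w, L (t *: w) = t *: L w) -> 0 <= m ->
  (forall w, q w < 1 -> p (L w) <= m) -> forall w, p (L w) <= m * q w.
Proof.
move=> sq sp Lh m0 h w; have qw := seminorm_ge0 w sq.
have key (e : R) : 0 < e -> p (L w) <= m * (q w + e).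
  move=> e0; have c0 : 0 < q w + e by rewrite ltr_wpDl.
  have := h ((q w + e)^-1 *: w).
  rewrite sq.2 Lh sp.2 gtr0_norm ?invr_gt0// mulrC ltr_pdivrMr// mul1r ltrDl.
  by move=> /(_ e0); rewrite mulrC ler_pdivrMr// mulrC.
apply/ler_addgt0Pr => e e0.
have m1 : 0 < m + 1 by rewrite ltr_wpDl.
apply: (le_trans (key (e / (m + 1)) _)); first by rewrite divr_gt0.
rewrite mulrDr lerD2l mulrA ler_pdivrMr// mulrC ler_pM2l//.
by rewrite lerDl.
Qed.

Lemma is_dirder_scale (X H : tvsType R) (f : X -> H) x y l (t : R) :
  is_dirder f x y l -> is_dirder (fun z => t *: f z) x y (t *: l).
Proof.
move=> fl.
have : (fun s : R => t *: (s^-1 *: (f (x + s *: y) - f x))) @ (0 : R)^' --> t *: l.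
  by apply: tcvgZ => //; exact: cvg_cst.
apply: cvg_trans; apply: near_eq_cvg.
by near=> s; rewrite -scalerBr !scalerA mulrC.
Unshelve. all: by end_near. Qed.

(** A product neighbourhood: the bound will be rescaled in the direction [w]
    alone. *)
Lemma product_bound (Z W : topologicalType) (H : tvsType R) (p : H -> R)
    (k : Z * W -> H) (z : Z) (w : W) : seminorm p -> continuous p ->
  k (z, w) = 0 -> k @ (z, w) --> k (z, w) ->
  exists A B, [/\ nbhs z A, nbhs w B & forall z' w', A z' -> B w' -> p (k (z', w')) < 1].
Proof.
move=> sp cp k0; rewrite k0.
have := seminorm_ball 0 sp cp (ltr01 : 0 < 1 :> R).
move=> h /(_ _ h)[[A B] /= [Az Bw] AB].
exists A, B; split => // z' w' Az' Bw'.
by have := AB (z', w') (conj Az' Bw'); rewrite /= subr0.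
Qed.

Context (X P H : tvsType R).
Hypotheses (hX : hausdorff_space X) (hP : hausdorff_space P) (hH : hausdorff_space H).
Variable T : (X * P)%type -> H.

Let dT (z : (X * P)%type) (w : X) : H := dirder T z (w, 0).
Let ddT (z : (X * P)%type) (w v : X) : H := dirder (fun z' => dT z' w) z (v, 0).

Let smooth_dT (z : (X * P)%type) w : smooth_at T z -> smooth_at (fun z' => dT z' w) z.
Proof.
move=> Tz; have hXP := hausdorff_prod hX hP.
apply: (smooth_at_comp (f := fun z : (X * P) * (X * P) => dirder T z.1 z.2)
  (g := fun z' : X * P => (z', (w, 0 : P)))) => //.
- exact: hausdorff_prod.
- by apply: smooth_at_pair => //; [by apply: smooth_at_id|by apply: smooth_at_cst].
- exact: smooth_at_dirder.
Qed.

(** The iterated partial derivative is a value of the derivative of the smooth map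
    [dirder T]; this gives its joint continuity. *)
Let ddTE (z : (X * P)%type) w v : smooth_at T z ->
  ddT z w v = dirder (fun z : (X * P) * (X * P) => dirder T z.1 z.2)
     (z, (w, 0)) ((v, 0), 0).
Proof.
move=> Tz; have hXP := hausdorff_prod hX hP; rewrite /ddT.
rewrite (dirder_comp (f := fun z : (X * P) * (X * P) => dirder T z.1 z.2)
  (g := fun z' : X * P => (z', (w, 0 : P)))) //.
- rewrite dirder_pair// ?dirder_cst//; last 2 first.
    exact: smooth_at_id.
    exact: smooth_at_cst.
  by rewrite (dirder_clinear (L := id))//; split => // ?; exact: cvg_id.
- exact: hausdorff_prod.
- by apply: smooth_at_pair => //; [by apply: smooth_at_id|by apply: smooth_at_cst].
- exact: smooth_at_dirder.
Qed.

Let pairZ (t : R) w : (t *: w, 0) = t *: ((w, 0) : X * P).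
Proof. by rewrite -[RHS]/(t *: w, t *: 0) scaler0. Qed.

Let dTZ (z : (X * P)%type) (t : R) w : smooth_at T z -> dT z (t *: w) = t *: dT z w.
Proof.
move=> /smooth_at_C1 Tz; by rewrite -(dirderZ hH _ _ Tz) -pairZ.
Qed.

Let ddTZr (z : (X * P)%type) (t : R) w v : smooth_at T z -> ddT z w (t *: v) = t *: ddT z w v.
Proof.
move=> Tz; have /smooth_at_C1 dTz := smooth_dT w Tz.
by rewrite -(dirderZ hH _ _ dTz) -pairZ.
Qed.

Let ddTZl (z : (X * P)%type) (t : R) w v : smooth_at T z -> ddT z (t *: w) v = t *: ddT z w v.
Proof.
move=> Tz; rewrite /ddT.
rewrite (@dirder_ext _ _ _ _ (fun z' => t *: dT z' w)).
  apply: dirderE => //; apply: is_dirder_scale.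
  by apply: C1at_is => //; apply: smooth_at_C1; exact: smooth_dT.
by apply: filterS (smooth_at_near Tz) => z'; exact: dTZ.
Qed.

Variable p : H -> R.
Hypotheses (sp : seminorm p) (cp : continuous p).

(** [q] controls [T] at [z] to second order in the first variable, as far as [p]
    can see. *)
Let bounded_by (q : X -> R) (z : (X * P)%type) :=
  (forall w, p (dT z w) <= q w) /\
  (forall x', q (x' - z.1) < 1 -> smooth_at T (x', z.2) /\
     forall w, p (dT (x', z.2) w - dT z w) <= q (x' - z.1) * q w).

Let bounded_mono q q' (z : (X * P)%type) : seminorm q -> seminorm q' ->
  (forall v, q v <= q' v) -> bounded_by q z -> bounded_by q' z.
Proof.
move=> sq sq' qq' [b1 b2]; split; first by move=> w; apply: le_trans (qq' w).
move=> x' qx'; have [|Tx' dx'] := b2 x'; first exact: le_lt_trans qx'.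
split => // w; apply: le_trans (dx' w) _.
by rewrite ler_pM// seminorm_ge0.
Qed.

(** The first and the second partial derivative vanish in the direction 0 and are
    continuous, so [p] of them is less than 1 for small directions; by
    homogeneity they are bounded by [q w] and [q w * q v] for a seminorm [q], near
    [z]. The mean value inequality turns the second bound into a Lipschitz
    bound for the first derivative. *)
Let bounded_near (z : (X * P)%type) : smooth_at T z ->
  exists q, [/\ seminorm q, continuous q & \forall z' \near z, bounded_by q z'].
Proof.
move=> Tz; have hXP := hausdorff_prod hX hP.
pose k := fun z : (X * P) * (X * P) => dirder T z.1 z.2.
have kz w : smooth_at k (z, w) by exact: smooth_at_dirder.
have k0 : k (z, 0) = 0.
  by rewrite /k/= -(scale0r (0 : (X * P)%type)) dirderZ ?scale0r//; exact: smooth_at_C1.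
have dk0 : dirder k (z, 0) 0 = 0.
  by rewrite -(scale0r (0 : (X * P) * (X * P))) dirderZ ?scale0r//; exact: smooth_at_C1.
have inj0 (U : set (X * P)%type) : nbhs (0 : (X * P)%type) U ->
    nbhs (0 : X) [set w | U (w, 0)].
  move=> [[A B] /= [A0 B0] AB]; apply: filterS A0 => w Aw.
  by apply: (AB (w, 0)); split => //=; exact: nbhs_singleton B0.
have [Z1 [U1' [Z1z /inj0 U10 ZU1]]] :=
  product_bound sp cp k0 (smooth_at_cvg (kz 0)).
set U1 := [set w | U1' (w, 0)] in U10.
have [A2 [B2 [A2z B2z AB2]]] :=
  product_bound (k := fun z : ((X * P) * (X * P)) * ((X * P) * (X * P)) => dirder k z.1 z.2)
    sp cp dk0 (smooth_at_cvg (smooth_at_dirder 0 (kz 0))).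
have [[Z2 U21'] /= [Z2z /inj0 U210] ZU2] := A2z.
set U21 := [set w | U21' (w, 0)] in U210.
have [[U22' O2] /= [/inj0 U220 /nbhs_singleton O20] UO2] := B2z.
set U22 := [set w | U22' (w, 0)] in U220.
have [[A B] /= [Ax By] AB] : nbhs z (Z1 `&` Z2 `&` smooth_at T).
  by apply: filterI; [exact: filterI|exact: (smooth_at_near Tz)].
have /seminorm_nbhs[q [sq cq qU]] : nbhs (0 : X)
    (U1 `&` U21 `&` U22 `&` [set h | A (z.1 + h)]).
  by apply: filterI; [apply: filterI => //; exact: filterI|by apply/(nbhs0P A z.1)].
have ball_A x : q (x - z.1) < 1 -> A x.
  by move=> /qU[_] /=; rewrite addrC subrK.
have bd1 z' w : (Z1 `&` Z2 `&` smooth_at T) z' -> p (dT z' w) <= q w.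
  move=> [[Z1z' _] Tz']; rewrite -[leRHS]mul1r.
  apply: homog_bound => //; first by move=> t w'; exact: dTZ.
  by move=> w' /qU[[[U1w' _] _] _]; apply/ltW; exact: (ZU1 z' (w', 0)).
have bd2 z' w v : (Z1 `&` Z2 `&` smooth_at T) z' -> p (ddT z' w v) <= q w * q v.
  move=> [[_ Z2z'] Tz'].
  apply: (@homog_bound _ _ q p (ddT z' w)) => //.
  - by move=> t v'; exact: ddTZr.
  - exact: seminorm_ge0.
  move=> v' /qU[[_ U22v'] _]; rewrite -[leRHS]mul1r.
  apply: (@homog_bound _ _ q p (fun w => ddT z' w v')) => //.
    by move=> t w'; exact: ddTZl.
  move=> w' /qU[[[_ U21w'] _] _]; rewrite ddTE//; apply/ltW.
  by apply: AB2; [apply: (ZU2 (_, _))|apply: (UO2 (_, _))].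
(* the factor 2 keeps the segments from [x] to [x'] in the unit ball of [q] at [z.1] *)
pose q2 x := 2 * q x.
have sq2 : seminorm q2.
  split=> [x y|t x]; rewrite /q2; first by rewrite -mulrDr ler_pM2l// sq.1.
  by rewrite sq.2 mulrCA.
have cq2 : continuous q2 by move=> x; apply: cvgM; [exact: cvg_cst|exact: cq].
have qq2 x : q x <= q2 x by rewrite /q2 ler_peMl// ?seminorm_ge0// ler1n.
exists q2; split => //.
exists ([set x | q (x - z.1) < 2^-1], B).
  by split=> //=; apply: seminorm_ball => //; rewrite invr_gt0.
move=> [x y] [/= xz B_y].
have goodz x' : q (x' - z.1) < 1 -> (Z1 `&` Z2 `&` smooth_at T) (x', y).
  by move=> /ball_A Ax'; exact: (AB (x', y)).
have h1 : 2^-1 < 1 :> R by rewrite invf_lt1// ltr1n.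
split.
  by move=> w; apply: le_trans (qq2 w); apply: bd1; apply: goodz; apply: lt_trans h1.
move=> x' /= xx'; have qxx' : q (x' - x) < 2^-1 by rewrite -(ltr_pM2l (ltr0Sn R 1)) divff.
have seg (s : R) : 0 <= s <= 1 -> q (x + s *: (x' - x) - z.1) < 1.
  move=> /andP[s0 s1]; rewrite addrAC (le_lt_trans (sq.1 _ _))//.
  rewrite (splitr 1) !div1r ltr_leD// (le_trans _ (ltW qxx'))//.
  by rewrite sq.2 ger0_norm// ler_piMl// seminorm_ge0.
have Tx' : smooth_at T (x', y).
  have := seg 1; rewrite ler01 lexx => /(_ isT).
  by rewrite scale1r [x + _]addrC subrK => /goodz[].
split=> // w.
apply: (@le_trans _ _ (q w * q (x' - x))); last first.
  by rewrite mulrC ler_pM ?seminorm_ge0.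
have := @mean_value R (X * P)%type H p (fun z' => dT z' w) (x, y) (x' - x, 0)
  (fun s => ddT ((x, y) + s *: (x' - x, 0)) w (x' - x)) 0 (q w * q (x' - x)) sp cp.
have -> : (x, y) + (x' - x, 0) = (x', y) :> X * P.
  by congr pair; rewrite /= ?addr0// [x + _]addrC subrK.
have segE (s : R) : (x, y) + s *: (x' - x, 0 : P) = (x + s *: (x' - x), y) :> X * P.
  by congr pair; rewrite /= scaler0 addr0.
rewrite subr0; apply.
  move=> s /seg/goodz[_ h]; apply: C1at_is => //; apply: smooth_at_C1.
  by rewrite segE; exact: smooth_dT.
by move=> s /seg/goodz h; rewrite subr0 segE; exact: bd2.
Qed.

(** Compactness of [K * C] makes the seminorm of the local bounds uniform, and
    compactness of [K] turns the neighbourhoods of the points [(x, y)] into one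
    neighbourhood of [C]. *)
Lemma uniform_estimate (K : set X) (C : set P) : compact K -> compact C ->
  (forall x y, K x -> C y -> smooth_at T (x, y)) ->
  exists (q : X -> R) (O : set P), [/\ seminorm q, continuous q, open O, C `<=` O &
    forall x y, K x -> O y ->
     (forall w, p (dirder T (x, y) (w, 0)) <= q w) /\
     (forall x', q (x' - x) < 1 -> smooth_at T (x', y) /\
       forall w, p (dirder T (x', y) (w, 0) - dirder T (x, y) (w, 0)) <= q (x' - x) * q w)].
Proof.
move=> cK cC KC.
have [||q [sq cq qKC]] := @compact_seminorm R X (X * P)%type (K `*` C)
    (fun q z => \forall z' \near z, bounded_by q z') (compact_setX cK cC).
- move=> q q' z sq _ sq' _ qq'; apply: filterS => z'; exact: bounded_mono.
- move=> [x y] [/= Kx Cy]; have [q [sq cq qz]] := bounded_near (KC x y Kx Cy).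
  exists q; split => //; exact: (near_join qz).
pose O := [set y | forall x, K x -> bounded_by q (x, y)]°.
exists q, O; split => //; first exact: open_interior.
  move=> y Cy; move/compact_near_coveringP: cK => cK.
  have := cK P (nbhs y) (fun y x => bounded_by q (x, y)) _; apply.
  move=> x Kx; have [[A B] /= [Ax By] AB] := qKC (x, y) (conj Kx Cy).
  by exists (A, B) => // -[x' y'] [/= Ax' By']; exact: (AB (x', y')).
move=> x y Kx /interior_subset Oy; exact: (Oy x Kx).
Qed.

End UniformEstimate.

(** * Integrals and null sets *)

Section NullSets.
Context (R : realType).
Notation mu := (@lebesgue_measure R).
Local Open Scope ereal_scope.
Import HBNNSimple.

(** Monotonicity for arbitrary integrands: the integral is a supremum over simple
    functions below. *)
Lemma nonneg_integral_le (D : set R) (f g : R -> \bar R) :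
  (forall x, D x -> 0 <= f x) -> (forall x, D x -> f x <= g x) ->
  \int[mu]_(x in D) f x <= \int[mu]_(x in D) g x.
Proof.
move=> f0 fg; rewrite !ge0_integralE//; last first.
  by move=> x Dx; apply: le_trans (fg x Dx); exact: f0.
apply: ge_ereal_sup => _ [h hf <-]; apply: ereal_sup_ubound; exists h => //= x.
apply: le_trans (hf x) _; rewrite !patchE; case: ifPn => // /set_mem; exact: fg.
Qed.

(** The integrand is arbitrary, so the null set is discarded for the simple
    functions below it. *)
Lemma nonneg_integral_null (D N : set R) (f : R -> \bar R) :
  @measurable _ (measurableTypeR R) N -> mu N = 0 -> (forall x, 0 <= f x) ->
  \int[mu]_(x in D) f x = \int[mu]_(x in D `\` N) f x.
Proof.
move=> mN N0 f0; apply/le_anti/andP; split; last first.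
  rewrite integral_mkcond [leRHS]integral_mkcond; apply: nonneg_integral_le => x _.
    by rewrite patchE; case: ifPn.
  rewrite !patchE; case: ifPn; first by rewrite inE => -[Dx _]; rewrite mem_set.
  by case: ifPn.
rewrite integral_mkcond ge0_integralTE; last by move=> x; rewrite patchE; case: ifPn.
apply: ge_ereal_sup => _ [h hf <-].
rewrite -integralT_nnsfun.
rewrite (@ge0_negligible_integral _ _ _ mu setT N)//; last first.
  by move=> x _; rewrite lee_fin.
  exact/measurable_EFinP.
rewrite integral_mkcond [leRHS]integral_mkcond; apply: nonneg_integral_le => x _.
  by rewrite patchE; case: ifPn => // _; rewrite lee_fin.
rewrite !patchE; case: ifPn => [/set_mem[_ nNx]|_]; last by case: ifPn.
have := hf x; rewrite patchE; case: ifPn => [/set_mem Dx hx|_ hx].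
  by rewrite mem_set.
by case: ifPn => // _; exact: le_trans hx (f0 x).
Qed.

Lemma integral_null (D N : set R) (f : R -> \bar R) :
  @measurable _ (measurableTypeR R) N -> mu N = 0 ->
  \int[mu]_(x in D) f x = \int[mu]_(x in D `\` N) f x.
Proof.
move=> mN N0; rewrite integralE [RHS]integralE.
by congr (_ - _); apply: nonneg_integral_null.
Qed.

End NullSets.

(** * Integrals over compact intervals *)

Section IntervalIntegral.
Context (R : realType).
Notation mu := (@lebesgue_measure R).

Definition conull (c d : R) (A : set R) :=
  [/\ @measurable _ (measurableTypeR R) A, A `<=` `[c, d]%classic &
      mu (`[c, d]%classic `\` A) = 0%E].

(** A seminorm of a Lusin measurable function is in general Borel measurable only
    after a null set has been removed. *)
Definition itv_integrable (c d : R) (h : R -> R) :=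
  exists2 A, conull c d A & mu.-integrable A (EFin \o h).

Lemma conullI c d A B : conull c d A -> conull c d B -> conull c d (A `&` B).
Proof.
move=> [mA Acd A0] [mB Bcd B0]; split; first exact: measurableI.
  by move=> x [/Acd].
rewrite setDIr measureU0//.
  by apply: measurableD.
by apply: measurableD.
Qed.

Lemma conull_integral c d A (D : set R) (h : R -> R) : conull c d A -> D `<=` `[c, d]%classic ->
  \int[mu]_(x in D) h x = \int[mu]_(x in D `&` A) h x.
Proof.
move=> [mA Acd A0] Dcd; rewrite /Rintegral (@integral_null _ D (`[c, d]%classic `\` A))//.
  congr (fine (integral _ _ _)); apply/seteqP; split => x [Dx].
    by move=> nA; split => //; apply: contrapT => nAx; apply: nA; split => //; exact: Dcd.
  by move=> Ax; split => // -[].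
exact: measurableD.
Qed.

Lemma conull_sub c d A s t : conull c d A -> c <= s -> t <= d ->
  conull s t (A `&` `[s, t]%classic).
Proof.
move=> [mA Acd A0] cs td; split; [exact: measurableI|by move=> x []|].
apply: (subset_measure0 _ _ _ A0).
- by apply: measurableD => //; exact: measurableI.
- exact: measurableD.
move=> x [/= xst nA]; split; last by move=> Ax; apply: nA.
by move: xst; rewrite /= !in_itv/= => /andP[sx xt]; rewrite (le_trans cs sx) (le_trans xt td).
Qed.

Lemma itv_integrable_sub c d s t h :
  itv_integrable c d h -> c <= s -> t <= d -> itv_integrable s t h.
Proof.
move=> [A fA iA] cs td; exists (A `&` `[s, t]%classic); first exact: conull_sub fA cs td.
have [mA _ _] := fA.
by apply: (integrableS mA _ _ iA); [exact: measurableI|by move=> x []].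
Qed.

Lemma itv_integrable_common c d h1 h2 : itv_integrable c d h1 -> itv_integrable c d h2 ->
  exists A, [/\ conull c d A, mu.-integrable A (EFin \o h1) & mu.-integrable A (EFin \o h2)].
Proof.
move=> [A fA iA] [B fB iB]; have [mA _ _] := fA; have [mB _ _] := fB.
exists (A `&` B); split; first exact: conullI.
  by apply: (integrableS mA _ _ iA); [exact: measurableI|by move=> x []].
by apply: (integrableS mB _ _ iB); [exact: measurableI|by move=> x []].
Qed.

Lemma conull_integralE c d A h : conull c d A ->
  \int[mu]_(x in `[c, d]) h x = \int[mu]_(x in A) h x.
Proof.
move=> fA; rewrite (conull_integral _ fA)//; congr Rintegral.
by rewrite setIidr//; case: fA.
Qed.

Lemma itv_integralD c d h1 h2 : itv_integrable c d h1 -> itv_integrable c d h2 ->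
  itv_integrable c d (fun x => h1 x + h2 x) /\
  \int[mu]_(x in `[c, d]) (h1 x + h2 x) =
  \int[mu]_(x in `[c, d]) h1 x + \int[mu]_(x in `[c, d]) h2 x.
Proof.
move=> i1 i2; have [A [fA iA1 iA2]] := itv_integrable_common i1 i2; have [mA _ _] := fA.
split; first by exists A => //; exact: (integrableD mA iA1 iA2).
by rewrite !(conull_integralE _ fA) RintegralD.
Qed.

Lemma itv_integralZ c d (r : R) h : itv_integrable c d h ->
  itv_integrable c d (fun x => r * h x) /\
  \int[mu]_(x in `[c, d]) (r * h x) = r * \int[mu]_(x in `[c, d]) h x.
Proof.
move=> [A fA iA]; have [mA _ _] := fA; split.
  by exists A => //; exact: (integrableZl mA r iA).
by rewrite !(conull_integralE _ fA) RintegralZl.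
Qed.

Lemma itv_integralB c d h1 h2 : itv_integrable c d h1 -> itv_integrable c d h2 ->
  itv_integrable c d (fun x => h1 x - h2 x) /\
  \int[mu]_(x in `[c, d]) (h1 x - h2 x) =
  \int[mu]_(x in `[c, d]) h1 x - \int[mu]_(x in `[c, d]) h2 x.
Proof.
move=> i1 i2; have [A [fA iA1 iA2]] := itv_integrable_common i1 i2; have [mA _ _] := fA.
split; first by exists A => //; exact: (integrableB mA iA1 iA2).
by rewrite !(conull_integralE _ fA) RintegralB.
Qed.

Lemma itv_integrable_cst c d (r : R) : itv_integrable c d (fun=> r).
Proof.
exists `[c, d]%classic.
  by split => //; rewrite setDv measure0.
apply: continuous_compact_integrable; first exact: segment_compact.
by apply: continuous_subspaceT => x; exact: cvg_cst.
Qed.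

Lemma itv_integral_cst c d (r : R) : c <= d -> \int[mu]_(x in `[c, d]) r = r * (d - c).
Proof.
move=> cd; have -> : d - c = fine (mu `[c, d]%classic).
  rewrite lebesgue_measure_itv/= lte_fin; case: ifPn => //; rewrite -leNgt => dc.
  by have -> : d = c; [apply/le_anti; rewrite dc|rewrite subrr].
by rewrite -Rintegral_cst.
Qed.

Lemma itv_integral_le c d A h1 h2 :
  conull c d A -> itv_integrable c d h1 -> itv_integrable c d h2 ->
  (forall x, A x -> h1 x <= h2 x) ->
  \int[mu]_(x in `[c, d]) h1 x <= \int[mu]_(x in `[c, d]) h2 x.
Proof.
move=> fA i1 i2 h12; have [B [fB iB1 iB2]] := itv_integrable_common i1 i2.
have fAB := conullI fA fB; have [mAB _ _] := fAB; have [mB _ _] := fB.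
rewrite !(conull_integralE _ fAB); apply: le_Rintegral => //.
- by apply: (integrableS mB _ _ iB1) => // x [].
- by apply: (integrableS mB _ _ iB2) => // x [].
- by move=> x [Ax _]; exact: h12.
Qed.

Lemma itv_integral_norm_le c d h1 h2 : itv_integrable c d h1 -> itv_integrable c d h2 ->
  (forall x, c <= x <= d -> `|h1 x| <= h2 x) ->
  `|\int[mu]_(x in `[c, d]) h1 x| <= \int[mu]_(x in `[c, d]) h2 x.
Proof.
move=> i1 i2 h12; have [A [fA iA1 iA2]] := itv_integrable_common i1 i2; have [mA Acd _] := fA.
rewrite !(conull_integralE _ fA); apply: (le_trans (le_normr_Rintegral mA iA1)).
apply: le_Rintegral => //; first exact: (integrable_norm iA1).
by move=> x /Acd/=; rewrite in_itv/=; exact: h12.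
Qed.

Lemma itv_integral_split c m d h : c <= m -> m <= d -> itv_integrable c d h ->
  \int[mu]_(x in `[c, d]) h x =
  \int[mu]_(x in `[c, m]) h x + \int[mu]_(x in `[m, d]) h x.
Proof.
move=> cm md [A fA iA]; have [mA Acd A0] := fA.
have s1 : `[c, m]%classic `<=` `[c, d]%classic.
  by move=> x; rewrite /= !in_itv/= => /andP[-> /le_trans]; exact.
have s2 : `[m, d]%classic `<=` `[c, d]%classic.
  by move=> x; rewrite /= !in_itv/= => /andP[/(le_trans cm) -> ->].
(* without [m] the two parts are disjoint *)
have fA1 : conull c d (A `\ m).
  split; [exact: measurableD|by move=> x [/Acd]|].
  rewrite setDDr measureU0//.
  - exact: measurableD.
  - exact: measurableI.
  - have m1 : @measurable _ (measurableTypeR R) [set m] by exact: measurable_set1.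
    apply: (subset_measure0 _ m1 _ (lebesgue_measure_set1 m)); last by move=> x [].
    exact: measurableI.
rewrite (conull_integralE h fA1) (conull_integral h fA1 s1) (conull_integral h fA1 s2).
rewrite -Rintegral_setU//.
- congr Rintegral; apply/seteqP; split => x.
    move=> Ax; have [xm|mx] := leP x m; [left|right]; split => //.
      have := Acd x Ax.1; rewrite /= !in_itv/= => /andP[-> _]//.
    have := Acd x Ax.1; rewrite /= !in_itv/= => /andP[_ ->]//.
    by rewrite ltW.
  by move=> [] [].
- by apply: measurableI => //; case: fA1.
- by apply: measurableI => //; case: fA1.
- apply: (integrableS mA _ _ iA).
    by apply: measurableU; apply: measurableI => //; case: fA1.
  by move=> x [[_ []]|[_ []]].
- apply/disj_setPS => x [[/= + [_ xm]] [+ _]]; rewrite !in_itv/= => /andP[_ h1] /andP[h2 _].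
  by apply: xm; apply/le_anti; rewrite h1.
Qed.

Lemma itv_integrable_glue c m d h : c <= m -> m <= d ->
  itv_integrable c m h -> itv_integrable m d h -> itv_integrable c d h.
Proof.
move=> cm md [A fA iA] [B fB iB]; have [mA Acd A0] := fA; have [mB Bcd B0] := fB.
exists (A `|` B).
  split; first exact: measurableU.
    move=> x [/Acd|/Bcd]; rewrite /= !in_itv/= => /andP[h1 h2].
      by rewrite h1 (le_trans h2).
    by rewrite h2 (le_trans cm).
  apply: (@subset_measure0 _ _ _ mu _ ((`[c, m]%classic `\` A) `|` (`[m, d]%classic `\` B))).
  - by apply: measurableD => //; exact: measurableU.
  - by apply: measurableU; apply: measurableD.
  - move=> x [/= xcd nAB]; have [xm|mx] := leP x m; [left|right]; split.
    + by move: xcd; rewrite /= !in_itv/= xm => /andP[->].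
    + by move=> Ax; apply: nAB; left.
    + by move: xcd; rewrite /= !in_itv/= (ltW mx) => /andP[_ ->].
    + by move=> Bx; apply: nAB; right.
  - apply: (etrans (measureU0 _ _ B0)) => //; exact: measurableD.
apply/integrableP; split.
  apply/measurable_funU => //; split; exact: (measurable_int mu).
apply: (@le_lt_trans _ _ (\int[mu]_(x in A) `|(h x)%:E| + \int[mu]_(x in B) `|(h x)%:E|)%E).
  have -> : A `|` B = A `|` (B `\` A).
    apply/seteqP; split => x [Ax|]; [by left| |by left|by move=> [Bx _]; right].
    by move=> Bx; have [|] := pselect (A x); [left|right].
  have mBA : measurable (B `\` A) by exact: measurableD.
  rewrite ge0_integral_setU//=.
  - apply: leeD => //; rewrite integral_mkcond [leRHS]integral_mkcond.
    apply: nonneg_integral_le => x _; rewrite !patchE; case: ifPn => // [/set_mem[Bx _]|_].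
      by rewrite mem_set.
    by case: ifPn => // _; rewrite lee_fin.
  - apply/measurable_funU => //; split; first exact: (measurable_int mu (integrable_norm iA)).
    by apply: (measurable_funS mB _ (measurable_int mu (integrable_norm iB))) => x [].
  - by apply/disj_setPS => x [Ax [_]].
by apply: lte_add_pinfty; [case/integrableP : iA|case/integrableP : iB].
Qed.

Lemma ae_eq_conull c d (X : Type) (g h : R -> X) : ae_eq_on `[c, d]%classic g h ->
  exists A, conull c d A /\ forall x, A x -> g x = h x.
Proof.
move=> [N [mN N0 Nsub]]; exists (`[c, d]%classic `\` N); split.
  split; [exact: measurableD|by move=> x []|].
  apply: (subset_measure0 _ mN _ N0).
    by apply: measurableD => //; exact: measurableD.
  by move=> x [xcd] nxx; apply: contrapT => nN; apply: nxx.
by move=> x [xcd nN]; apply: contrapT => ne; apply: nN; apply: Nsub.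
Qed.

Lemma eq_conull_integral c d A h1 h2 : conull c d A -> (forall x, A x -> h1 x = h2 x) ->
  \int[mu]_(x in `[c, d]) h1 x = \int[mu]_(x in `[c, d]) h2 x.
Proof.
move=> fA e; rewrite !(conull_integralE _ fA); apply: eq_Rintegral => x /set_mem; exact: e.
Qed.

End IntervalIntegral.

(** * Lusin measurable functions *)

Section Lusin.
Context (R : realType).
Notation mu := (@lebesgue_measure R).

Lemma lusin_conull c d (X : topologicalType) (g : R -> X) :
  lusin_measurable `[c, d]%classic g -> exists K : nat -> set R,
  [/\ forall j, compact (K j) /\ K j `<=` `[c, d]%classic,
   forall j, {within K j, continuous g} & conull c d (\bigcup_j K j)].
Proof.
move=> [K [Kc gK K0]]; exists K; split => //; split => //.
  by apply: bigcup_measurable => j _; apply: compact_measurable; case: (Kc j).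
by move=> x [j _]; case: (Kc j) => _; exact.
Qed.

Lemma within_comp (T X Y : topologicalType) (K : set T) (g : T -> X) (f : X -> Y) :
  {within K, continuous g} -> (forall t, K t -> f @ g t --> f (g t)) ->
  {within K, continuous (f \o g)}.
Proof.
move=> /subspace_continuousP gc fc; apply/subspace_continuousP => t Kt.
by apply: (cvg_comp _ _ (gc t Kt)); exact: fc.
Qed.

Lemma within_pair (T X Y : topologicalType) (K : set T) (g : T -> X) (f : T -> Y) :
  {within K, continuous g} -> {within K, continuous f} ->
  {within K, continuous (fun t => (g t, f t))}.
Proof.
move=> /subspace_continuousP gc /subspace_continuousP fc.
apply/subspace_continuousP => t Kt.
by apply: pair_cvg; [exact: gc|exact: fc].
Qed.

Lemma within_itvS (T : topologicalType) (c d s t : R) (f : R -> T) : c <= s -> t <= d ->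
  {within `[c, d]%classic, continuous f} -> {within `[s, t]%classic, continuous f}.
Proof.
move=> cs td; apply: continuous_subspaceW => x; rewrite /= !in_itv/= => /andP[sx xt].
by rewrite (le_trans cs sx) (le_trans xt td).
Qed.

Lemma lusin_comp (I : set R) (X Y : topologicalType) (g : R -> X) (f : X -> Y) :
  lusin_measurable I g -> (forall t, I t -> f @ g t --> f (g t)) ->
  lusin_measurable I (f \o g).
Proof.
move=> [K [Kc gK K0]] fc; exists K; split => // j.
by apply: within_comp (gK j) _ => t Kt; apply: fc; case: (Kc j) => _; exact.
Qed.

Lemma lusin_ext (I : set R) (X : topologicalType) (g h : R -> X) :
  (forall t, I t -> g t = h t) -> lusin_measurable I g -> lusin_measurable I h.
Proof.
move=> gh [K [Kc gK K0]]; exists K; split => // j.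
have e t : K j t -> g t = h t by move=> Kt; apply: gh; case: (Kc j) => _; exact.
apply: (subspace_eq_continuous (f := g)) => //.
by move=> t /set_mem; exact: e.
Qed.

Lemma lusin_continuous (c d : R) (X : topologicalType) (g : R -> X) :
  {within `[c, d]%classic, continuous g} -> lusin_measurable `[c, d]%classic g.
Proof.
move=> gc; exists (fun=> `[c, d]%classic); split => //.
  by move=> j; split => //; exact: segment_compact.
rewrite (_ : \bigcup_j _ = `[c, d]%classic) ?setDv ?measure0//.
by apply/seteqP; split => [x []//|x xcd]; exists 0%N.
Qed.

Lemma lusin_pair (c d : R) (X Y : topologicalType) (g : R -> X) (f : R -> Y) :
  lusin_measurable `[c, d]%classic g -> lusin_measurable `[c, d]%classic f ->
  lusin_measurable `[c, d]%classic (fun t => (g t, f t)).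
Proof.
move=> /lusin_conull[K [Kc gK fK]] /lusin_conull[L [Lc fL fLL]].
have [mKL _ KL0] := conullI fK fLL.
pose M n := if unpickle n is Some ij then K ij.1 `&` L ij.2 else set0.
have cR := @Rhausdorff R.
exists M; split.
- move=> n; rewrite /M; case: unpickle => [[i j]|]; last by split; [exact: compact0|].
  split; last by move=> x [/(Kc i).2].
  by apply: compact_closedI; [exact: (Kc i).1|apply: compact_closed => //; exact: (Lc j).1].
- move=> n; rewrite /M; case: unpickle => [[i j]|]; last exact: continuous_subspace0.
  apply: within_pair.
    by apply: continuous_subspaceW (gK i) => x [].
  by apply: continuous_subspaceW (fL j) => x [].
- rewrite (_ : \bigcup_j M j = (\bigcup_j K j) `&` (\bigcup_j L j))//.
  apply/seteqP; split.
    move=> x [n _]; rewrite /M; case: unpickle => [[i j]|//] [Ki Lj].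
    by split; [exists i|exists j].
  move=> x [[i _ Ki] [j _ Lj]]; exists (pickle (i, j)) => //.
  by rewrite /M pickleK.
Qed.

Lemma lusin_sub (c d s t : R) (X : topologicalType) (g : R -> X) : c <= s -> t <= d ->
  lusin_measurable `[c, d]%classic g -> lusin_measurable `[s, t]%classic g.
Proof.
move=> cs td /lusin_conull[K [Kc gK fK]].
exists (fun j => K j `&` `[s, t]%classic); split.
- move=> j; split; last by move=> x [].
  by apply: compact_closedI; [exact: (Kc j).1|exact: itv_closed].
- by move=> j; apply: continuous_subspaceW (gK j) => x [].
- have [_ _ h] := conull_sub fK cs td.
  by rewrite -[X in _ `\` X]setI_bigcupl.
Qed.

(** A Lusin measurable function is Borel on the union of its compact sets. *)
Lemma lusin_itv_integrable (c d : R) (h : R -> R) :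
  lusin_measurable `[c, d]%classic h ->
  (\int[mu]_(t in `[c, d]%classic) `|h t|%:E < +oo)%E -> itv_integrable c d h.
Proof.
move=> /lusin_conull[K [Kc hK fK]] hoo; exists (\bigcup_j K j) => //.
apply/integrableP; split.
  apply/measurable_EFinP/measurable_fun_bigcup.
    by move=> j; apply: compact_measurable; exact: (Kc j).1.
  move=> j; apply: subspace_continuous_measurable_fun => //.
  by apply: compact_measurable; exact: (Kc j).1.
have [mK Kcd K0] := fK; apply: le_lt_trans hoo.
rewrite integral_mkcond [leRHS]integral_mkcond.
apply: nonneg_integral_le => x _; rewrite !patchE; case: ifPn => // [/set_mem/Kcd xcd|_].
  by rewrite mem_set.
by case: ifPn => // _; rewrite lee_fin.
Qed.

Lemma L1_itv_integrable (E : tvsType R) (c d : R) (g : R -> E) (q : E -> R) :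
  L1 c d g -> seminorm q -> continuous q -> itv_integrable c d (fun t => q (g t)).
Proof.
move=> [lg ig] sq cq; apply: lusin_itv_integrable.
  by apply: (lusin_comp lg) => t _; exact: cq.
have := ig q sq cq; apply: le_lt_trans; apply: nonneg_integral_le => t _; rewrite lee_fin//.
by rewrite ger0_norm// seminorm_ge0.
Qed.

Lemma linear_seminorm (E : tvsType R) (l : {linear E -> R^o}) : continuous l ->
  seminorm (fun x => `|l x| : R) /\ continuous (fun x => `|l x| : R).
Proof.
move=> cl; split; last by move=> x; apply: cvg_norm; exact: cl.
split=> [x y|t x]; first by rewrite linearD ler_normD.
by rewrite linearZ normrM.
Qed.

Lemma L1_itv_integrable_linear (E : tvsType R) (c d : R) (g : R -> E) (l : {linear E -> R^o}) :
  L1 c d g -> continuous l -> itv_integrable c d (fun t => l (g t)).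
Proof.
move=> [lg ig] cl; have [sq cq] := linear_seminorm cl; apply: lusin_itv_integrable.
  by apply: (lusin_comp lg) => t _; exact: cl.
exact: (ig _ sq cq).
Qed.

End Lusin.

(** * Induction on compact intervals *)

Section IntervalInduction.
Context (R : realType).

(** If [Q] is additive and holds on all small intervals around each point, the
    supremum of the [t] such that [Q c t] cannot be less than [d]. *)
Lemma interval_induction (Q : R -> R -> Prop) (c d : R) : c <= d ->
  (forall r s t, c <= r -> r <= s -> s <= t -> t <= d -> Q r s -> Q s t -> Q r t) ->
  (forall r, c <= r -> r <= d -> exists2 e, 0 < e &
     forall s t, c <= s -> s <= t -> t <= d -> `|s - r| < e -> `|t - r| < e -> Q s t) ->
  Q c d.
Proof.
move=> cd cat loc.
pose S := [set t | c <= t <= d /\ Q c t].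
have Sc : S c.
  split; first by rewrite lexx.
  have [e e0 h] := loc c (lexx _) cd.
  by apply: h => //; rewrite subrr normr0.
have Sd : ubound S d by move=> t [/andP[]].
have hS : has_sup S by split; [exists c|exists d].
set u := sup S.
have cu : c <= u by exact: sup_upper_bound.
have ud : u <= d by apply: ge_sup => //; exists c.
have [e e0 h] := loc u cu ud.
have [t [/andP[ct td] Qt] ut] : exists2 t, S t & u - e < t.
  by apply: sup_adherent.
have tu : t <= u by apply: sup_upper_bound => //; split => //; rewrite ct.
have tue : `|t - u| < e by rewrite ler0_norm ?subr_le0// opprB ltrBlDr -ltrBlDl.
pose v := Num.min d (u + e / 2).
have e2 : 0 < e / 2 by rewrite divr_gt0.
have uv : u <= v by rewrite le_min ud lerDl ltW.
have Qv : Q c v.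
  apply: (cat c t v) => //; first exact: le_trans uv.
    by rewrite ge_min lexx.
  apply: h => //; first exact: le_trans uv.
    by rewrite ge_min lexx.
  rewrite ger0_norm ?subr_ge0// ltrBlDl gt_min; apply/orP; right.
  by rewrite ltrD2l ltr_pdivrMr// ltr_pMr// ltr1n.
have Sv : S v.
  by split => //; rewrite (le_trans cu uv) ge_min lexx.
have : v <= u by exact: sup_upper_bound.
rewrite ge_min => /orP[du|]; last by rewrite gerDl leNgt e2.
by have -> : d = v by apply/le_anti; rewrite (le_trans du uv) ge_min lexx.
Qed.

End IntervalInduction.

(** * Absolutely continuous curves in locally convex spaces *)

Section Primitives.
Context (R : realType).
Notation mu := (@lebesgue_measure R).

(** The conditions of [primitive_of] on a compact interval, with ordered end
    points only and without reference to subintervals for integrability. *)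
Definition primitive_on (E : tvsType R) (c d : R) (g eta : R -> E) :=
  L1 c d g /\
  forall s t, c <= s -> s <= t -> t <= d ->
    forall l : {linear E -> R^o}, continuous l ->
      l (eta t - eta s) = \int[mu]_(u in `[s, t]) l (g u).

Lemma L1_sub (E : tvsType R) c d s t (g : R -> E) : c <= s -> t <= d ->
  L1 c d g -> L1 s t g.
Proof.
move=> cs td [lg ig]; split; first exact: lusin_sub lg.
move=> q sq cq; apply: le_lt_trans (ig q sq cq).
rewrite integral_mkcond [leRHS]integral_mkcond.
apply: nonneg_integral_le => x _; rewrite !patchE; case: ifPn => //.
- by rewrite lee_fin seminorm_ge0.
- move=> /set_mem/=; rewrite in_itv/= => /andP[sx xt].
  by rewrite mem_set//= in_itv/= (le_trans cs sx) (le_trans xt td).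
- by case: ifPn => // _; rewrite lee_fin seminorm_ge0.
Qed.

Lemma sub_itv (c d s t : R) : s < t -> `[s, t]%classic `<=` `[c, d]%classic ->
  c <= s /\ t <= d.
Proof.
move=> st h.
have := h s; rewrite /= !in_itv/= lexx (ltW st) => /(_ isT) /andP[-> _].
by have := h t; rewrite /= !in_itv/= lexx (ltW st) => /(_ isT) /andP[_ ->].
Qed.

Lemma primitive_onP (E : tvsType R) c d (g eta : R -> E) : c < d ->
  primitive_on c d g eta <-> primitive_of `[c, d]%classic g eta.
Proof.
move=> cd; split=> [[lg ig]|[lg ig]]; split.
- by move=> s t st /(sub_itv st)[cs td]; exact: L1_sub lg.
- move=> t s; rewrite /= !in_itv/= => /andP[ct td] /andP[cs sd] l cl.
  rewrite /oriented_integral; case: ifPn => [st|]; first exact: ig.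
  rewrite -ltNge => /ltW ts; rewrite -ig//.
  by rewrite -opprB linearN.
- exact: lg.
- move=> s t cs st td l cl; rewrite ig//; last 2 first.
  + by rewrite /= in_itv/= (le_trans cs st).
  + by rewrite /= in_itv/= cs (le_trans st).
  by rewrite /oriented_integral st.
Qed.

Lemma itv_integral_lty c d (h : R -> R) : itv_integrable c d h -> (forall x, 0 <= h x) ->
  (\int[mu]_(t in `[c, d]%classic) (h t)%:E < +oo)%E.
Proof.
move=> [A [mA Acd A0] iA] h0.
rewrite (@integral_null _ _ (`[c, d]%classic `\` A))//; last exact: measurableD.
have -> : `[c, d]%classic `\` (`[c, d]%classic `\` A) = A by rewrite setDD setIidr.
case/integrableP : iA => _; congr (_ < _)%E; apply: eq_integral => x _ /=.
by rewrite ger0_norm.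
Qed.

Lemma lusin_glue (X : topologicalType) c m d (g : R -> X) : c <= m -> m <= d ->
  lusin_measurable `[c, m]%classic g -> lusin_measurable `[m, d]%classic g ->
  lusin_measurable `[c, d]%classic g.
Proof.
move=> cm md /lusin_conull[K [Kc gK [mK _ K0]]] /lusin_conull[L [Lc gL [mL _ L0]]].
pose M n := if odd n then K n./2 else L n./2.
have s1 : `[c, m]%classic `<=` `[c, d]%classic.
  by move=> x; rewrite /= !in_itv/= => /andP[-> /le_trans]; exact.
have s2 : `[m, d]%classic `<=` `[c, d]%classic.
  by move=> x; rewrite /= !in_itv/= => /andP[/(le_trans cm) -> ->].
have MU : \bigcup_j M j = (\bigcup_j K j) `|` (\bigcup_j L j).
  apply/seteqP; split => [x [n _]|x [[n _ Kn]|[n _ Ln]]].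
  - by rewrite /M; case: ifPn => _ h; [left|right]; exists n./2.
  - by exists n.*2.+1 => //; rewrite /M /= odd_double/= uphalf_double.
  - by exists n.*2 => //; rewrite /M /= odd_double/= doubleK.
exists M; split.
- move=> n; rewrite /M; case: ifPn => _.
    by have [? /subset_trans] := Kc n./2; split => //; auto.
  by have [? /subset_trans] := Lc n./2; split => //; auto.
- by move=> n; rewrite /M; case: ifPn.
rewrite MU; apply: (@subset_measure0 _ _ _ mu _
   ((`[c, m]%classic `\` \bigcup_j K j) `|` (`[m, d]%classic `\` \bigcup_j L j))).
- by apply: measurableD => //; exact: measurableU.
- by apply: measurableU; apply: measurableD.
- move=> x [/= xcd nAB]; have [xm|mx] := leP x m; [left|right]; split.
  + by move: xcd; rewrite /= !in_itv/= xm => /andP[->].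
  + by move=> Ax; apply: nAB; left.
  + by move: xcd; rewrite /= !in_itv/= (ltW mx) => /andP[_ ->].
  + by move=> Bx; apply: nAB; right.
- apply: (etrans (measureU0 _ _ L0)) => //; exact: measurableD.
Qed.

Lemma primitive_glue (E : tvsType R) c m d (g eta : R -> E) : c <= m -> m <= d ->
  primitive_on c m g eta -> primitive_on m d g eta -> primitive_on c d g eta.
Proof.
move=> cm md [lg ig] [lg' ig'].
have L1g : L1 c d g.
  split; first by apply: (lusin_glue cm md); [case: lg|case: lg'].
  move=> q sq cq; apply: itv_integral_lty; last by move=> x; exact: seminorm_ge0.
  by apply: (itv_integrable_glue cm md); exact: L1_itv_integrable.
split=> // s t cs st td l cl.
have [tm|/ltW mt] := leP t m; first exact: ig.
have [ms|/ltW sm] := leP m s; first exact: ig'.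
rewrite (@itv_integral_split _ s m t)//.
  by rewrite -ig// -ig'// -linearD [X in _ = l X]addrC addrA subrK.
by apply: (itv_integrable_sub (L1_itv_integrable_linear L1g cl)).
Qed.

Lemma primitive_ae (E : tvsType R) c d (g h eta : R -> E) : primitive_on c d g eta ->
  lusin_measurable `[c, d]%classic h -> ae_eq_on `[c, d]%classic g h ->
  primitive_on c d h eta.
Proof.
move=> [[lg ig] pg] lh /ae_eq_conull[A [fA gh]]; split.
  split => // q sq cq; apply: le_lt_trans (ig q sq cq).
  have [mA Acd A0] := fA.
  have mN : @measurable _ (measurableTypeR R) (`[c, d]%classic `\` A) by exact: measurableD.
  rewrite (integral_null _ _ mN A0) [leRHS](integral_null _ _ mN A0).
  rewrite (_ : _ `\` _ = A); last by rewrite setDD setIidr.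
  by apply: nonneg_integral_le => x Ax; rewrite ?gh// lee_fin seminorm_ge0.
move=> s t cs st td l cl; rewrite pg//.
by apply: (eq_conull_integral (conull_sub fA cs td)) => x [Ax _]; rewrite gh.
Qed.

(** The seminorm of an integral is at most the integral of the seminorm: a
    Hahn-Banach form attains [q] at [eta t - eta s]. *)
Lemma primitive_bound (E : tvsType R) c d (g eta : R -> E) (q : E -> R) :
  primitive_on c d g eta -> seminorm q -> continuous q ->
  forall s t, c <= s -> s <= t -> t <= d ->
  q (eta t - eta s) <= \int[mu]_(u in `[s, t]) q (g u).
Proof.
move=> [lg ig] sq cq s t cs st td.
have [l [lE lq]] := hahn_banach sq (eta t - eta s).
have cl := linear_le_continuous sq cq lq.
rewrite -lE ig//; apply: le_trans (ler_norm _) _.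
apply: itv_integral_norm_le; last by move=> x _; exact: lq.
  by apply: (itv_integrable_sub (L1_itv_integrable_linear lg cl)).
by apply: (itv_integrable_sub (L1_itv_integrable lg sq cq)).
Qed.

Lemma primitive_ext (E : tvsType R) c d (g h eta zeta : R -> E) :
  (forall t, c <= t <= d -> g t = h t) -> (forall t, c <= t <= d -> eta t = zeta t) ->
  primitive_on c d g eta -> primitive_on c d h zeta.
Proof.
move=> gh ez [lg ig].
have : primitive_on c d h eta.
  apply: primitive_ae (conj lg ig) _ _.
    by apply: lusin_ext (lg.1) => t; rewrite /= in_itv/=; exact: gh.
  exists set0; split => // t [/=]; rewrite in_itv/= => /gh ->.
  by [].
move=> [lh ih]; split => // s t cs st td l cl.
by rewrite -!ez ?ih// ?cs ?td ?(le_trans st)//= ?(le_trans cs).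
Qed.

(** A continuous linear form on the product is the sum of its restrictions to the
    factors. *)
Lemma primitive_pair (E F : tvsType R) c d (g eta : R -> E) (h zeta : R -> F) :
  primitive_on c d g eta -> primitive_on c d h zeta ->
  primitive_on c d (fun t => (g t, h t)) (fun t => (eta t, zeta t)).
Proof.
move=> [lg ig] [lh ih].
pose i1 (x : E) : E * F := (x, 0). pose i2 (y : F) : E * F := (0, y).
have ci1 : continuous i1 by move=> x; apply: pair_cvg; [exact: cvg_id|exact: cvg_cst].
have ci2 : continuous i2 by move=> x; apply: pair_cvg; [exact: cvg_cst|exact: cvg_id].
have iE (z : E * F) : z = i1 z.1 + i2 z.2.
  by case: z => x y; congr pair; rewrite /= ?addr0 ?add0r.
have L1p : L1 c d (fun t => (g t, h t)).
  split; first exact: lusin_pair lg.1 lh.1.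
  move=> q sq cq.
  have s1 : seminorm (q \o i1).
    split=> [x y|t x] /=.
      have := sq.1 (i1 x) (i1 y); rewrite [X in q X](_ : _ = i1 (x + y))// /i1.
      by congr pair; rewrite addr0.
    by rewrite -sq.2; congr q; rewrite /i1; congr pair; rewrite /= scaler0.
  have s2 : seminorm (q \o i2).
    split=> [x y|t x] /=.
      have := sq.1 (i2 x) (i2 y); rewrite [X in q X](_ : _ = i2 (x + y))// /i2.
      by congr pair; rewrite addr0.
    by rewrite -sq.2; congr q; rewrite /i2; congr pair; rewrite /= scaler0.
  have c1 : continuous (q \o i1) by move=> x; apply: (cvg_comp _ _ (ci1 x)); exact: cq.
  have c2 : continuous (q \o i2) by move=> x; apply: (cvg_comp _ _ (ci2 x)); exact: cq.
  have [iq _] := itv_integralD (L1_itv_integrable lg s1 c1) (L1_itv_integrable lh s2 c2).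
  have /(itv_integral_lty iq) : forall x, 0 <= (q \o i1) (g x) + (q \o i2) (h x).
    by move=> x; rewrite addr_ge0 // seminorm_ge0.
  apply: le_lt_trans; apply: nonneg_integral_le => t _; rewrite lee_fin ?seminorm_ge0//.
  by rewrite [X in q X]iE; exact: sq.1.
split=> // s t cs st td l cl.
have ll1 : linear (fun x => l (i1 x)).
  move=> r x y; rewrite -linearP; congr (l _); rewrite /i1; congr pair.
  by rewrite /= scaler0 addr0.
have ll2 : linear (fun x => l (i2 x)).
  move=> r x y; rewrite -linearP; congr (l _); rewrite /i2; congr pair.
  by rewrite /= scaler0 addr0.
pose L1L := GRing.isLinear.Build R E R^o *:%R _ ll1.
pose l1 : {linear E -> R^o} := HB.pack (fun x => l (i1 x)) L1L.
pose L2L := GRing.isLinear.Build R F R^o *:%R _ ll2.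
pose l2 : {linear F -> R^o} := HB.pack (fun x => l (i2 x)) L2L.
have c1 : continuous l1 by move=> x; apply: (cvg_comp _ _ (ci1 x)); exact: cl.
have c2 : continuous l2 by move=> x; apply: (cvg_comp _ _ (ci2 x)); exact: cl.
have i1' := itv_integrable_sub (L1_itv_integrable_linear lg c1) cs td.
have i2' := itv_integrable_sub (L1_itv_integrable_linear lh c2) cs td.
have [_ e] := itv_integralD i1' i2'.
transitivity (l1 (eta t - eta s) + l2 (zeta t - zeta s)).
  rewrite -[RHS]/(l (i1 (eta t - eta s)) + l (i2 (zeta t - zeta s))).
  by rewrite -(linearD l) -(iE (eta t - eta s, zeta t - zeta s)).
rewrite ig// ih// -e; apply: eq_Rintegral => x _.
by rewrite (iE (g x, h x)) (linearD l).
Qed.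

End Primitives.

(** * Taylor estimates *)

Section Taylor.
Context (R : realType) (X H : tvsType R).
Hypotheses (hX : hausdorff_space X) (hH : hausdorff_space H).

(** The derivative at all points of the segment from [x1] to [x2] differs from the
    one at [x] by at most [e * p]; apply the mean value inequality. *)
Lemma taylor_estimate (F : X -> H) (q : H -> R) (p : X -> R) x e :
  seminorm q -> continuous q -> seminorm p -> e <= 1 ->
  (forall x', p (x' - x) < 1 -> smooth_at F x' /\
     forall w, q (dirder F x' w - dirder F x w) <= p (x' - x) * p w) ->
  forall x1 x2, p (x1 - x) < e -> p (x2 - x) < e ->
  q (F x2 - F x1 - dirder F x (x2 - x1)) <= e * p (x2 - x1).
Proof.
move=> sq cq sp e1 h x1 x2 px1 px2.
have seg (s : R) : 0 <= s <= 1 -> p (x1 + s *: (x2 - x1) - x) < e.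
  move=> /andP[s0 s1].
  have -> : x1 + s *: (x2 - x1) - x = (1 - s) *: (x1 - x) + s *: (x2 - x).
    rewrite scalerBl scale1r -[RHS]addrA -scalerN -scalerDr opprB.
    by rewrite [x - x1 + _]addrC addrA subrK addrAC.
  rewrite (le_lt_trans (sp.1 _ _))// !sp.2 !ger0_norm ?subr_ge0//.
  have [->|s0'] := eqVneq s 0; first by rewrite mul0r addr0 subr0 mul1r.
  have sp0 : 0 < s by rewrite lt_neqAle eq_sym s0'.
  have -> : e = (1 - s) * e + s * e by rewrite -mulrDl subrK mul1r.
  by rewrite ler_ltD// ?ltr_pM2l// ler_wpM2l ?subr_ge0// ltW.
have := @mean_value R X H q F x1 (x2 - x1) (fun s => dirder F (x1 + s *: (x2 - x1)) (x2 - x1))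
  (dirder F x (x2 - x1)) (e * p (x2 - x1)) sq cq.
rewrite [x1 + _]addrC subrK; apply.
  move=> s /seg/lt_le_trans/(_ e1)/h[Fs _]; apply: C1at_is => //; exact: smooth_at_C1.
move=> s /[dup] /seg ps /seg/lt_le_trans/(_ e1)/h[_ hs].
apply: le_trans (hs _) _; rewrite ler_wpM2r ?seminorm_ge0//; exact: ltW.
Qed.

(** Differentiability of [alpha] at [t] with respect to the single seminorm [p]
    suffices, as [p] controls [F] to second order at [alpha t]. *)
Lemma difference_quotient (F : X -> H) (p0 : H -> R) (p : X -> R)
    (alpha : R -> X) (v : X) (c d t : R) :
  seminorm p0 -> continuous p0 -> seminorm p ->
  (forall w, p0 (dirder F (alpha t) w) <= p w) ->
  (forall x', p (x' - alpha t) < 1 -> smooth_at F x' /\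
     forall w, p0 (dirder F x' w - dirder F (alpha t) w) <= p (x' - alpha t) * p w) ->
  (forall e, 0 < e -> exists2 r, 0 < r & forall s, c <= s <= d -> `|s - t| < r ->
     p (alpha s - alpha t - (s - t) *: v) <= e * `|s - t|) ->
  forall e, 0 < e -> exists2 r, 0 < r & forall s, c <= s <= d -> `|s - t| < r ->
    p0 (F (alpha s) - F (alpha t) - (s - t) *: dirder F (alpha t) v) <= e * `|s - t|.
Proof.
move=> sp0 cp0 sp e1 e2 da e e0.
have pv := seminorm_ge0 v sp.
have pv1 : 0 < p v + 1 by rewrite ltr_wpDl.
have p00 : p (alpha t - alpha t) < 1 by rewrite subrr (seminorm0 sp).
have C1 : C1at F (alpha t) by apply: smooth_at_C1; exact: (e2 _ p00).1.
have eh : 0 < e / 2 by rewrite divr_gt0.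
(* [p (alpha s - alpha t)] is at most [(p v + 1) * `|s - t|], so the Taylor estimate
   with constant [dl] costs [e / 2 * `|s - t|] *)
pose dl := Num.min 1 (e / 2 / (p v + 1)).
have dl0 : 0 < dl by rewrite lt_min ltr01 divr_gt0.
have dl1 : dl <= 1 by rewrite ge_min lexx.
have dl2 : dl * (p v + 1) <= e / 2.
  by rewrite -ler_pdivlMr// ge_min lexx orbT.
have [r1 r10 h1] := da _ ltr01.
have [r2 r20 h2] := da _ eh.
exists (Num.min r1 (Num.min r2 (dl / (p v + 1)))); first by rewrite !lt_min r10 r20 divr_gt0.
move=> s scd; rewrite !lt_min => /and3P[s1 s2 s3].
have n0 : 0 <= `|s - t| by [].
have q1 : p (alpha s - alpha t) <= (p v + 1) * `|s - t|.
  rewrite -[alpha s - alpha t](subrK ((s - t) *: v)) (le_trans (sp.1 _ _))//.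
  by rewrite sp.2 mulrDl [leLHS]addrC mulrC lerD// h1.
have q2 : p (alpha s - alpha t) < dl.
  by rewrite (le_lt_trans q1)// mulrC -ltr_pdivlMr.
have -> : F (alpha s) - F (alpha t) - (s - t) *: dirder F (alpha t) v =
    (F (alpha s) - F (alpha t) - dirder F (alpha t) (alpha s - alpha t)) +
    dirder F (alpha t) (alpha s - alpha t - (s - t) *: v).
  rewrite [X in _ + dirder _ _ X](_ : _ = alpha s - alpha t + (t - s) *: v); last first.
    by rewrite -scaleNr opprB.
  rewrite (dirderD hH (alpha s - alpha t) _ C1) (dirderZ hH _ _ C1) addrA subrK.
  by rewrite -[t - s]opprB scaleNr.
apply: le_trans (sp0.1 _ _) _; rewrite (splitr e) mulrDl; apply: lerD.
  have pz : p (alpha t - alpha t) < dl by rewrite subrr (seminorm0 sp).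
  apply: le_trans (taylor_estimate sp0 cp0 sp dl1 e2 pz q2) _.
  apply: le_trans (ler_wpM2l (ltW dl0) q1) _.
  by rewrite mulrA ler_wpM2r.
by apply: le_trans (e1 _) _; exact: h2.
Qed.

Lemma compact_estimate (F : X -> H) (q : H -> R) (K : set X) :
  seminorm q -> continuous q -> compact K -> (forall x, K x -> smooth_at F x) ->
  exists p : X -> R, [/\ seminorm p, continuous p &
    forall x, K x -> (forall w, q (dirder F x w) <= p w) /\
     (forall x', p (x' - x) < 1 -> smooth_at F x' /\
       forall w, q (dirder F x' w - dirder F x w) <= p (x' - x) * p w)].
Proof.
move=> sq cq cK KF.
(* the uniform estimate with a dummy parameter *)
pose T (z : X * X) := F z.1.
have Ts x y : smooth_at F x -> smooth_at T (x, y).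
  move=> Fx; apply: (smooth_at_comp (f := F) (g := fst)) => //.
    exact: hausdorff_prod.
  by apply: smooth_at_clinear => //; exact: clinear_fst.
have sT x y : smooth_at T (x, y) -> smooth_at F x.
  move=> Tx; apply: (smooth_at_comp (f := T) (g := fun x => (x, y))) => //.
    exact: hausdorff_prod.
  by apply: smooth_at_pair => //; [exact: smooth_at_id|exact: smooth_at_cst].
have [p [V [sp cp oV V0 est]]] := @uniform_estimate R X X H hX hX hH T q sq cq K [set 0] cK
  (@compact_set1 _ _) (fun x y Kx _ => Ts x y (KF x Kx)).
exists p; split => // x Kx; have [e1 e2] := est x 0 Kx (V0 _ erefl).
split; first exact: e1.
by move=> x' /e2[/sT Fx' h]; split.
Qed.

(** [dirder F x] is continuous and linear, so forms composed with it may be applied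
    to weak integrals. *)
Lemma dirder_linear (F : X -> H) x (l : {linear H -> R^o}) : smooth_at F x ->
  continuous l -> exists2 l' : {linear X -> R^o}, continuous l' &
  forall w, l' w = l (dirder F x w).
Proof.
move=> Fx cl; have C1 := smooth_at_C1 Fx.
have ll : linear (fun w => l (dirder F x w)).
  by move=> r v w; rewrite dirderD// dirderZ// linearP.
pose lL := GRing.isLinear.Build R X R^o *:%R _ ll.
pose l' : {linear X -> R^o} := HB.pack (fun w => l (dirder F x w)) lL.
exists l' => // w.
have c : (fun w : X => (x, w)) @ w --> (x, w) by apply: pair_cvg; [exact: cvg_cst|exact: cvg_id].
exact: (cvg_comp _ _ (cvg_comp _ _ c (smooth_at_cvg (smooth_at_dirder w Fx))) (cl _)).
Qed.

End Taylor.

(** * The chain rule for absolutely continuous curves *)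

Section ChainRuleAC.
Context (R : realType) (X H : tvsType R).
Hypotheses (hX : hausdorff_space X) (hH : hausdorff_space H).
Notation mu := (@lebesgue_measure R).

(** The chain rule. The amount [D s t] by which a form [l] violates the integral
    formula is additive in the interval. If [zeta] stays [e]-close to [zeta r] on
    `[s, t], then [F] is replaced by its linearization at [zeta r], for which the
    formula holds: the Taylor estimate for the increment of [F] and the Lipschitz
    bound for its derivative under the integral both cost [e * \int p (g u)]. By
    interval induction [`|D s t| <= 2 * e * \int p (g u)] on each interval, for
    all small [e]. *)
Theorem primitive_comp c d (g zeta : R -> X) (F : X -> H) : c <= d ->
  primitive_on c d g zeta -> {within `[c, d]%classic, continuous zeta} ->
  (forall t, c <= t <= d -> smooth_at F (zeta t)) ->
  primitive_on c d (fun t => dirder F (zeta t) (g t)) (F \o zeta).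
Proof.
move=> cd pg cz Fz; have [lg ig] := pg.
pose K := zeta @` `[c, d]%classic.
have cK : compact K by apply: continuous_compact => //; exact: segment_compact.
have KF x : K x -> smooth_at F x by move=> [t]; rewrite /= in_itv/= => /Fz h <-.
have Kz t : c <= t <= d -> K (zeta t) by move=> tcd; exists t => //=; rewrite in_itv.
have L1h : L1 c d (fun t => dirder F (zeta t) (g t)).
  split.
    apply: (@lusin_comp R _ (X * X)%type H (fun t => (zeta t, g t)) (fun z => dirder F z.1 z.2)).
      by apply: lusin_pair lg.1; exact: lusin_continuous.
    move=> t; rewrite /= in_itv/= => /Fz Ft.
    exact: (smooth_at_cvg (smooth_at_dirder (g t) Ft)).
  move=> q sq cq; have [p [sp cp est]] := compact_estimate hX hH sq cq cK KF.
  apply: le_lt_trans (lg.2 p sp cp); apply: nonneg_integral_le => t.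
    by rewrite lee_fin seminorm_ge0.
  by rewrite /= in_itv/= lee_fin => /Kz/est[].
split => // s t cs st td l cl.
have [sl cnl] := linear_seminorm cl.
pose q x : R := `|l x|.
have [p [sp cp est]] := compact_estimate hX hH sl cnl cK KF.
pose D s t := l (F (zeta t)) - l (F (zeta s)) -
  \int[mu]_(u in `[s, t]) l (dirder F (zeta u) (g u)).
have Rh : itv_integrable c d (fun u => l (dirder F (zeta u) (g u))).
  exact: L1_itv_integrable_linear.
have Rp : itv_integrable c d (fun u => p (g u)) by exact: L1_itv_integrable.
suff D0 : D s t = 0.
  by move/eqP: D0; rewrite /D subr_eq0 -linearB => /eqP.
have key e : 0 < e -> e <= 1 -> `|D s t| <= 2 * e * \int[mu]_(u in `[s, t]) p (g u).
  move=> e0 e1.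
  apply: (@interval_induction R
    (fun s t => `|D s t| <= 2 * e * \int[mu]_(u in `[s, t]) p (g u)) s t st).
    move=> r' s' t' h1 h2 h3 h4 h5 h6.
    have -> : D r' t' = D s' t' + D r' s'.
      rewrite /D (@itv_integral_split _ r' s' t')//; last first.
        by apply: (itv_integrable_sub Rh); [exact: le_trans cs h1|exact: le_trans h4 td].
      by rewrite -[l (F (zeta t'))]/(l (F (zeta t')) : R); ring.
    rewrite (@itv_integral_split _ r' s' t')//; last first.
      by apply: (itv_integrable_sub Rp); [exact: le_trans cs h1|exact: le_trans h4 td].
    by rewrite mulrDr; apply: le_trans (ler_normD _ _) _; rewrite [leLHS]addrC lerD.
  move=> r sr rt.
  have rcd : c <= r <= d by rewrite (le_trans cs sr) (le_trans rt td).
  have [e1r e2r] := est _ (Kz r rcd).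
  have /subspace_continuousP/(_ r) := cz.
  rewrite /= in_itv/= => /(_ rcd) /(_ _ (seminorm_ball (zeta r) sp cp e0)).
  case=> d' /= d'0 hd'; exists d' => // s' t' ss' st' tt' s'r t'r.
  have near u : s' <= u <= t' -> p (zeta u - zeta r) < e.
    move=> /andP[su ut]; apply: hd'; last first.
      by rewrite /= in_itv/= (le_trans cs)// ?(le_trans ss')// (le_trans ut)// (le_trans tt').
    rewrite /= distrC ltr_norml; move: s'r t'r; rewrite !ltr_norml => /andP[a1 _] /andP[_ a2].
    by rewrite (lt_le_trans a1) ?lerB// (le_lt_trans _ a2)// lerB.
  have cs' : c <= s' by exact: le_trans ss'.
  have td' : t' <= d by exact: le_trans td.
  have [l' cl' l'E] := dirder_linear hH (KF _ (Kz r rcd)) cl.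
  have Rl' := itv_integrable_sub (L1_itv_integrable_linear lg cl') cs' td'.
  have Rh' := itv_integrable_sub Rh cs' td'.
  have Rp' := itv_integrable_sub Rp cs' td'.
  have [Rl'h Il'h] := itv_integralB Rl' Rh'.
  have [Rep Iep] := itv_integralZ e Rp'.
  have -> : D s' t' = l (F (zeta t') - F (zeta s') - dirder F (zeta r) (zeta t' - zeta s'))
     + \int[mu]_(u in `[s', t']) (l' (g u) - l (dirder F (zeta u) (g u))).
    rewrite Il'h -ig// l'E !linearB/= /D.
    ring.
  have -> : 2 * e * \int[mu]_(u in `[s', t']) p (g u) =
    e * \int[mu]_(u in `[s', t']) p (g u) + e * \int[mu]_(u in `[s', t']) p (g u).
    by rewrite -mulrA mulr_natl mulr2n.
  apply: le_trans (ler_normD _ _) _; apply: lerD.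
    apply: le_trans (taylor_estimate hH sl cnl sp e1 e2r (near s' _) (near t' _)) _.
    - by rewrite lexx.
    - by rewrite lexx andbT.
    by rewrite ler_pM2l//; exact: (primitive_bound pg sp cp).
  rewrite -Iep; apply: itv_integral_norm_le => // u sut.
  rewrite l'E -linearB -normrN -linearN opprB.
  have pu := near u sut.
  have [_ /(_ (g u)) h] := e2r _ (lt_le_trans pu e1).
  by apply: le_trans h _; rewrite ler_wpM2r ?seminorm_ge0// ltW.
apply/eqP; rewrite -normr_le0; apply/ler_addgt0Pr => e e0; rewrite add0r.
set I := \int[mu]_(u in `[s, t]) p (g u) in key.
have I0 : 0 <= I by apply: Rintegral_ge0 => x _; exact: seminorm_ge0.
pose e' := Num.min 1 (e / (2 * (I + 1))).
have I1 : 0 < 2 * (I + 1) by rewrite mulr_gt0// ltr_wpDl.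
have e'0 : 0 < e' by rewrite lt_min ltr01 divr_gt0.
apply: le_trans (key e' e'0 _) _; first by rewrite ge_min lexx.
apply: (@le_trans _ _ (2 * (e / (2 * (I + 1))) * I)).
  by rewrite ler_wpM2r// ler_pM2l// ge_min lexx orbT.
have I2 : 0 < I + 1 by rewrite ltr_wpDl.
have -> : 2 * (e / (2 * (I + 1))) * I = e * (I / (I + 1)) by field; rewrite gt_eqF.
by rewrite ler_piMr ?(ltW e0)// ler_pdivrMr// mul1r lerDl.
Qed.

End ChainRuleAC.

(** * Lebesgue points *)

Section LebesguePoints.
Context (R : realType).
Notation mu := (@lebesgue_measure R).

Lemma derivable0_small (F : R -> R) t : derivable F t 1 -> derive1 F t = 0 ->
  forall e, 0 < e -> exists2 d, 0 < d & forall s, `|s - t| < d -> `|F s - F t| <= e * `|s - t|.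
Proof.
move=> dF F0 e e0.
have D0 : derive (F : R^o -> R^o) (t : R^o) (1 : R^o) = 0 by rewrite -derive1E F0.
have c : (fun h => h^-1 *: ((F \o shift t) (h *: (1 : R^o)) - F t)) @ (0 : R)^' -->
    (derive (F : R^o -> R^o) (t : R^o) (1 : R^o)) by exact: dF.
rewrite D0 in c.
have c' : is_dirder (F : R^o -> R^o) (t : R^o) 1 (0 : R^o).
  rewrite /is_dirder (_ : (fun _ => _) =
     (fun h => h^-1 *: ((F \o shift t) (h *: (1 : R^o)) - F t)))//.
  by apply/funext => h /=; rewrite [t + _]addrC.
have [sq cq] : seminorm (fun x : R^o => `|x| : R) /\ continuous (fun x : R^o => `|x| : R).
  split; last by move=> x; exact: cvg_norm.
  by split=> [x y|r x]; [exact: ler_normD|exact: normrM].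
have [d d0 h] := (is_dirderP _ _ _ _).1 c' _ sq cq e e0.
exists d => // s st; have := h (s - t) st.
rewrite -[(s - t) *: 1]/((s - t) * 1) mulr1 scaler0 subr0.
by rewrite [t + _]addrC subrK.
Qed.

(** Lebesgue's differentiation theorem at the points where the density
    vanishes. *)
Lemma integral_small (A : set R) (f : R -> R) :
  @measurable _ (measurableTypeR R) A -> mu.-integrable A (EFin \o f) ->
  exists N, [/\ @measurable _ (measurableTypeR R) N, mu N = 0%E &
    forall t, ~ N t -> (f \_ A) t = 0 -> forall e, 0 < e -> exists2 d, 0 < d &
      forall a b, a <= b -> a = t \/ b = t -> b - a < d ->
       \int[mu]_(x in `[a, b]) (f \_ A) x <= e * (b - a)].
Proof.
move=> mA iA; set h := f \_ A.
have lh := integrable_locally_restrict mA iA.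
have ih (D : set R) : @measurable _ (measurableTypeR R) D -> mu.-integrable D (EFin \o h).
  move=> mD; have iT : mu.-integrable setT (EFin \o h).
    by move: iA; rewrite integrable_mkcond// restrict_EFin.
  by apply: (integrableS _ _ _ iT).
have [N [mN N0 NP]] := FTC1Ny (fun y => ih _ (measurable_itv `]-oo, y])) lh.
exists N; split => // t nNt ht e e0.
have [dF F't] : derivable (fun x : R => \int[mu]_(t in [set` `]-oo, x]]) h t) t 1 /\
    derive1 (fun x : R => \int[mu]_(t in [set` `]-oo, x]]) h t) t = h t.
  by apply: contrapT => nF; apply: nNt; apply: NP.
rewrite ht in F't.
have [d d0 hd] := derivable0_small dF F't e0.
exists d => // a b ab abt bad.
have -> : \int[mu]_(x in `[a, b]) h x =
    \int[mu]_(x in [set` `]-oo, b]]) h x - \int[mu]_(x in [set` `]-oo, a]]) h x.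
  rewrite (@Rintegral_itvB _ h -oo%O (BRight b) a)//; last by apply: ih.
  by rewrite Rintegral_itv_obnd_cbnd//; apply: ih.
have ba0 : 0 <= b - a by rewrite subr_ge0.
apply: le_trans (ler_norm _) _.
case: abt => e1; subst t.
  by have := hd b; rewrite ger0_norm//; apply.
have := hd a; rewrite !(distrC a) (distrC (\int[mu]_(x in [set` `]-oo, a]]) h x)).
by rewrite ger0_norm//; apply.
Qed.

Lemma primitive_shift (E : tvsType R) c d (g eta : R -> E) (v : E) : primitive_on c d g eta ->
  primitive_on c d (fun r => g r - v) (fun s => eta s - s *: v).
Proof.
move=> [lg ig]; have lgv : L1 c d (fun r => g r - v).
  split.
    apply: (@lusin_comp R _ E E g (fun x => x - v) lg.1) => t _.
    by apply: tcvgB; [exact: cvg_id|exact: cvg_cst].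
  move=> q sq cq.
  have [i _] := itv_integralD (L1_itv_integrable lg sq cq) (itv_integrable_cst c d (q v)).
  have /(itv_integral_lty i) : forall x, 0 <= q (g x) + q v.
    by move=> x; rewrite addr_ge0// seminorm_ge0.
  apply: le_lt_trans; apply: nonneg_integral_le => t _; rewrite lee_fin ?seminorm_ge0//.
  exact: seminormB.
split => // s t cs st td l cl.
have i := itv_integrable_sub (L1_itv_integrable_linear lg cl) cs td.
have -> : \int[mu]_(u in `[s, t]) l (g u - v) = \int[mu]_(u in `[s, t]) (l (g u) - l v).
  by apply: eq_Rintegral => x _; rewrite linearB.
have [_ ->] := itv_integralB i (itv_integrable_cst s t (l v)).
rewrite itv_integral_cst// -ig//.
have -> : eta t - t *: v - (eta s - s *: v) = (eta t - eta s) - (t - s) *: v.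
  by rewrite scalerBl [in LHS]opprD [in RHS]opprD addrACA.
by rewrite linearB linearZ mulrC.
Qed.

(** Almost every [t] lies in one of the compact sets [K j] on which [g] is
    continuous, and is a point at which the integral of [1 + p (g x)] over the
    complement of [K j] is infinitesimal compared with the length of the interval.
    Near such a [t], [p (g x - g t)] is small on [K j] by continuity, and on the
    complement it is at most [(1 + p (g t)) * (1 + p (g x))]. *)
Lemma lebesgue_points (E : tvsType R) c d (g eta : R -> E) (p : E -> R) :
  primitive_on c d g eta -> seminorm p -> continuous p ->
  exists I, conull c d I /\ forall t, I t -> forall e, 0 < e -> exists2 r, 0 < r &
    forall s, c <= s <= d -> `|s - t| < r ->
      p (eta s - eta t - (s - t) *: g t) <= e * `|s - t|.
Proof.
move=> pg sp cp; have [lg ig] := pg.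
have [K [Kc gK fK]] := lusin_conull lg.1.
have ip := L1_itv_integrable lg sp cp.
have [i1 _] := itv_integralD (itv_integrable_cst c d 1) ip.
pose A0 := \bigcup_j K j.
have [B fB iB] := i1.
pose A := A0 `&` B.
have fA : conull c d A by exact: conullI.
have [mA Acd A0'] := fA; have [mB _ _] := fB.
pose f r := 1 + p (g r).
have mK j : @measurable _ (measurableTypeR R) (K j).
  by apply: compact_measurable; exact: (Kc j).1.
have mAK j : @measurable _ (measurableTypeR R) (A `\` K j) by exact: measurableD.
have iAK j : mu.-integrable (A `\` K j) (EFin \o f).
  by apply: (integrableS mB _ _ iB) => // x [[]].
have sm j := integral_small (mAK j) (iAK j).
pose N j := projT1 (cid (sm j)).
have NP j : [/\ @measurable _ (measurableTypeR R) (N j), mu (N j) = 0%E &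
    forall t, ~ N j t -> (f \_ (A `\` K j)) t = 0 -> forall e, 0 < e -> exists2 d, 0 < d &
      forall a b, a <= b -> a = t \/ b = t -> b - a < d ->
       \int[mu]_(x in `[a, b]) (f \_ (A `\` K j)) x <= e * (b - a)].
  by rewrite /N; case: cid.
have fN j : conull c d (`[c, d]%classic `\` N j).
  have [mN N0 _] := NP j; split; [exact: measurableD|by move=> x []|].
  apply: (subset_measure0 _ mN _ N0).
    by apply: measurableD => //; exact: measurableD.
  by move=> x [xcd] nxx; apply: contrapT => nN; apply: nxx.
have fI : conull c d (A `\` \bigcup_j N j).
  have mU : @measurable _ (measurableTypeR R) (\bigcup_j N j).
    by apply: bigcup_measurable => j _; have [] := NP j.
  have U0 : mu (\bigcup_j N j) = 0%E.
    apply/(negligibleP _ mU); apply: negligible_bigcup => j.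
    by have [mN N0 _] := NP j; exists (N j); split.
  split; [exact: measurableD|by move=> x [/Acd]|].
  rewrite setDDr; apply: (etrans (measureU0 _ _ _)) => //.
  - exact: measurableD.
  - exact: measurableI.
  - by apply: (subset_measure0 _ mU _ U0); [exact: measurableI|move=> x []].
exists (A `\` \bigcup_j N j); split => // t [[[j _ Kjt] Bt] nNt] e e0.
have [_ _ /(_ t)] := NP j.
have nNjt : ~ N j t by move=> Njt; apply: nNt; exists j.
have ht : (f \_ (A `\` K j)) t = 0.
  by rewrite patchE; case: ifPn => // /set_mem[].
set h := f \_ (A `\` K j) in ht *.
pose c0 := 1 + p (g t).
have c00 : 0 < c0 by rewrite ltr_pwDl// seminorm_ge0.
pose e' := e / (2 * c0).
have e'0 : 0 < e' by rewrite divr_gt0// mulr_gt0.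
move=> /(_ nNjt ht e' e'0)[d1 d10 hd1].
have e2 : 0 < e / 2 by rewrite divr_gt0.
have /subspace_continuousP/(_ t Kjt) := gK j.
move=> /(_ _ (seminorm_ball (g t) sp cp e2))[d2 /= d20 hd2].
have key a b : c <= a -> a <= b -> b <= d -> a = t \/ b = t -> b - a < d1 -> b - a < d2 ->
    p (eta b - b *: g t - (eta a - a *: g t)) <= e * (b - a).
  move=> ca ab bd abt bad1 bad2.
  (* the increment of [eta] minus the linear part is the integral of [g - g t] *)
  have pgt := primitive_shift (g t) pg.
  apply: le_trans (primitive_bound pgt sp cp ca ab bd) _.
  have Rh : itv_integrable a b h.
    have [mAb _ _] := conull_sub fA ca bd.
    exists `[a, b]%classic; first by split => //; rewrite setDv measure0.
    have iT : mu.-integrable setT (EFin \o h).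
      by move: (iAK j); rewrite integrable_mkcond// restrict_EFin.
    by apply: (integrableS _ _ _ iT).
  have [Rch Ich] := itv_integralZ c0 Rh.
  have [Rs Is] := itv_integralD (itv_integrable_cst a b (e / 2)) Rch.
  have Rg := itv_integrable_sub (L1_itv_integrable pgt.1 sp cp) ca bd.
  apply: le_trans (itv_integral_le (conull_sub fA ca bd) Rg Rs _) _.
    move=> x [Ax /=]; rewrite in_itv/= => /andP[ax xb].
    have [Kjx|nKjx] := pselect (K j x).
      have -> : h x = 0 by rewrite /h patchE; case: ifPn => // /set_mem[].
      rewrite mulr0 addr0; apply/ltW/hd2 => //=.
      apply: le_lt_trans bad2; case: abt => e1; subst t.
        by rewrite distrC ger0_norm ?subr_ge0// lerB.
      by rewrite ger0_norm ?subr_ge0// lerB.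
    have -> : h x = f x by rewrite /h patchE mem_set.
    apply: (@le_trans _ _ (c0 * f x)); last by rewrite lerDr ltW.
    apply: le_trans (seminormB _ _ sp) _.
    have := seminorm_ge0 (g x) sp; have := seminorm_ge0 (g t) sp.
    rewrite /c0 /f => h1 h2; rewrite mulrDl mul1r mulrDr mulr1.
    have : 0 <= p (g t) * p (g x) by rewrite mulr_ge0.
    lra.
  rewrite Is itv_integral_cst// Ich.
  have := hd1 a b ab abt bad1; rewrite -(ler_pM2l c00) => hI.
  apply: le_trans (lerD (lexx _) hI) _.
  have -> : c0 * (e' * (b - a)) = e / 2 * (b - a).
    by rewrite /e'; field; rewrite gt_eqF.
  by rewrite -mulrDl -splitr.
exists (Num.min d1 d2); first by rewrite lt_min d10.
move=> s /andP[cs sd]; rewrite lt_min => /andP[st1 st2].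
have [/= ct td] : c <= t /\ t <= d.
  by have := Acd t; rewrite /= in_itv/= => /(_ _)/andP; apply; split => //; exists j.
have e1 : eta s - eta t - (s - t) *: g t = eta s - s *: g t - (eta t - t *: g t).
  by rewrite scalerBl [in LHS]opprD [in RHS]opprD addrACA.
have [ts|/ltW st] := leP t s.
  by rewrite e1 ger0_norm ?subr_ge0// in st1 st2 *; apply: key => //; left.
rewrite e1 -seminormN// opprB distrC ger0_norm ?subr_ge0//.
by rewrite distrC ger0_norm ?subr_ge0// in st1; rewrite distrC ger0_norm ?subr_ge0// in st2;
  apply: key => //; right.
Qed.

End LebesguePoints.

(** * Smooth maps into manifolds *)

Section ManifoldSmoothness.
Context (R : realType).

Lemma open_preimage (S T : topologicalType) (U : set S) (V : set T) (g : S -> T) :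
  open U -> open V -> (forall x, U x -> g @ x --> g x) -> open (U `&` g @^-1` V).
Proof.
move=> oU oV gc; rewrite openE => x [Ux Vgx]; rewrite /interior.
apply: filterI; first exact: open_nbhs_in.
by apply: (gc x Ux); exact: open_nbhs_in.
Qed.

Lemma chart_cvg (F : tvsType R) (M : topologicalType) (phi : chart F M) p :
  chart_dom phi p -> phi @ p --> phi p.
Proof. exact: (within_open _ (chart_dom_open phi)).1 (chart_map_continuous (c:=phi)) p. Qed.

Lemma chart_inv_cvg (F : tvsType R) (M : topologicalType) (phi : chart F M) v :
  chart_img phi v -> chart_inv phi @ v --> chart_inv phi v.
Proof. exact: (within_open _ (chart_img_open phi)).1 (chart_inv_continuous (c:=phi)) v. Qed.

Lemma chart_near (F : tvsType R) (M : topologicalType) (phi : chart F M) p :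
  chart_dom phi p -> nbhs p (chart_dom phi).
Proof. exact: open_nbhs_in (chart_dom_open phi). Qed.

Lemma chart_inj (F : tvsType R) (M : topologicalType) (phi : chart F M) p q :
  chart_dom phi p -> chart_dom phi q -> phi p = phi q -> p = q.
Proof. by move=> dp dq e; rewrite -(chart_mapK dp) e chart_mapK. Qed.

(** Maps from a vector space into a manifold: composing with charts of the source
    only, the action and the group operations take this form. *)
Definition msmooth_at (E F : tvsType R) (M : smoothManifoldType F) (u : E -> M) (x : E) :=
  u @ x --> u x /\
  forall psi : chart F M, atlas psi -> chart_dom psi (u x) -> smooth_at (psi \o u) x.

Lemma chart_atP (F : tvsType R) (M : smoothManifoldType F) (p : M) :
  atlas (chart_at p) /\ chart_dom (chart_at p) p.
Proof. by rewrite /chart_at; case: cid. Qed.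

Lemma msmooth_chart_inv (F : tvsType R) (M : smoothManifoldType F) (phi : chart F M) x :
  atlas phi -> chart_img phi x -> msmooth_at (chart_inv phi) x.
Proof.
move=> aphi ix; split; first exact: chart_inv_cvg.
move=> psi apsi dx.
apply: (@smooth_at_on _ _ _ (chart_img phi `&` chart_inv phi @^-1` chart_dom psi)).
- by apply: open_preimage; [exact: chart_img_open|exact: chart_dom_open|exact: chart_inv_cvg].
- exact: atlas_compat.
- by [].
Qed.

Lemma msmooth_comp (E' E F : tvsType R) (M : smoothManifoldType F) (g : E' -> E) (u : E -> M) x :
  hausdorff_space E' -> hausdorff_space E -> hausdorff_space F ->
  smooth_at g x -> msmooth_at u (g x) -> msmooth_at (u \o g) x.
Proof.
move=> hE' hE hF gx [cu su]; split; first exact: (cvg_comp _ _ (smooth_at_cvg gx) cu).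
by move=> psi apsi d; apply: (smooth_at_comp (f := psi \o u) (g := g)) => //; exact: su.
Qed.

Lemma msmooth_cst (E F : tvsType R) (M : smoothManifoldType F) (p : M) (x : E) :
  hausdorff_space F -> msmooth_at (fun=> p) x.
Proof. by move=> hF; split; [exact: cvg_cst|move=> psi _ _; exact: smooth_at_cst]. Qed.

Lemma msmooth_map2 (E F1 F2 F : tvsType R) (M1 : smoothManifoldType F1)
  (M2 : smoothManifoldType F2) (N : smoothManifoldType F) (f : M1 -> M2 -> N)
  (u : E -> M1) (w : E -> M2) x :
  hausdorff_space E -> hausdorff_space F1 -> hausdorff_space F2 -> hausdorff_space F ->
  smooth_map2 f -> msmooth_at u x -> msmooth_at w x ->
  msmooth_at (fun z => f (u z) (w z)) x.
Proof.
move=> hE h1 h2 hF [cf sf] [cu su] [cw sw]; split.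
  exact: (cvg_comp _ _ (pair_cvg cu cw) (cf (u x, w x))).
move=> psi apsi dx.
have [a1 d1] := chart_atP (u x); have [a2 d2] := chart_atP (w x).
set phi1 := chart_at (u x) in a1 d1; set phi2 := chart_at (w x) in a2 d2.
pose g (v : (F1 * F2)%type) := f (chart_inv phi1 v.1) (chart_inv phi2 v.2).
apply: (@smooth_at_ext _ _ _ ((psi \o g) \o (fun z => (phi1 (u z), phi2 (w z))))).
  near=> z; rewrite /= /g /= !chart_mapK//; near: z.
    exact: (cw _ (chart_near d2)).
  exact: (cu _ (chart_near d1)).
apply: smooth_at_comp => //; first exact: hausdorff_prod.
  by apply: smooth_at_pair => //; [exact: su|exact: sw].
apply: (@smooth_at_on _ _ _ ((chart_img phi1 `*` chart_img phi2) `&` g @^-1` chart_dom psi)).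
- apply: open_preimage; [|exact: chart_dom_open|].
    by apply: openXX; exact: chart_img_open.
  move=> [v1 v2] [/= i1 i2].
  have c1 : (fun v : F1 * F2 => chart_inv phi1 v.1) @ (v1, v2) --> chart_inv phi1 v1.
    by apply: (cvg_comp _ _ cvg_fst); exact: chart_inv_cvg.
  have c2 : (fun v : F1 * F2 => chart_inv phi2 v.2) @ (v1, v2) --> chart_inv phi2 v2.
    by apply: (cvg_comp _ _ cvg_snd); exact: chart_inv_cvg.
  exact: (cvg_comp _ _ (pair_cvg c1 c2) (cf (chart_inv phi1 v1, chart_inv phi2 v2))).
- exact: sf.
- split; first by split => /=; exact: chart_map_img.
  by rewrite /g /= !chart_mapK.
Unshelve. all: by end_near. Qed.

Lemma msmooth_map (E F1 F : tvsType R) (M1 : smoothManifoldType F1)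
  (N : smoothManifoldType F) (f : M1 -> N) (u : E -> M1) x :
  hausdorff_space E -> hausdorff_space F1 -> hausdorff_space F ->
  smooth_map f -> msmooth_at u x -> msmooth_at (f \o u) x.
Proof.
move=> hE h1 hF [cf sf] [cu su]; split.
  exact: (cvg_comp _ _ cu (cf (u x))).
move=> psi apsi dx.
have [a1 d1] := chart_atP (u x); set phi1 := chart_at (u x) in a1 d1.
apply: (@smooth_at_ext _ _ _ ((psi \o f \o chart_inv phi1) \o (phi1 \o u))).
  near=> z; rewrite /= chart_mapK//; near: z.
  exact: (cu _ (chart_near d1)).
apply: smooth_at_comp => //; first exact: su.
apply: (@smooth_at_on _ _ _ (chart_img phi1 `&` (f \o chart_inv phi1) @^-1` chart_dom psi)).
- apply: open_preimage; [exact: chart_img_open|exact: chart_dom_open|].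
  by move=> v iv; apply: (cvg_comp _ _ (chart_inv_cvg iv)); exact: cf.
- exact: sf.
- by split; [exact: chart_map_img|rewrite /= chart_mapK].
Unshelve. all: by end_near. Qed.

(** The left-hand side is the coordinate in [psi] of the tangent vector
    [T u (x, y)], which is stored by its coordinate in the chosen chart at [q]. *)
Lemma chart_diffE (E F : tvsType R) (M : smoothManifoldType F) (u : E -> M) x y q
  (psi : chart F M) : hausdorff_space E -> hausdorff_space F ->
  msmooth_at u x -> u x = q -> atlas psi -> chart_dom psi q ->
  chart_diff psi (Tangent (dirder (chart_at q \o u) x y : tangent_space q)) =
  dirder (psi \o u) x y.
Proof.
move=> hE hF [cu su] uq apsi dq; rewrite /chart_diff /=.
have [aq dqq] := chart_atP q; set c := chart_at q in aq dqq *.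
have -> : c q = (c \o u) x by rewrite /= uq.
rewrite -(dirder_comp (f := psi \o chart_inv c) (g := c \o u))//.
- apply: dirder_ext; near=> z; rewrite /= chart_mapK//; near: z.
  by apply: cu; rewrite uq; exact: chart_near.
- by apply: su => //; rewrite uq.
- have /= := (msmooth_chart_inv aq (chart_map_img dqq)).2 psi apsi.
  by rewrite uq chart_mapK//; apply.
Unshelve. all: by end_near. Qed.

Lemma chart_tangent_invK (F : tvsType R) (M : smoothManifoldType F) (phi : chart F M)
  (u : tangent M) : hausdorff_space F -> atlas phi -> chart_dom phi (tbase u) ->
  chart_tangent_inv phi (phi (tbase u)) (chart_diff phi u) = u.
Proof.
case: u => p w hF aphi dp; rewrite /chart_tangent_inv /=.
rewrite chart_mapK//; congr Tangent; rewrite /chart_diff /=.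
have [ap dpp] := chart_atP p; set c := chart_at p in ap dpp *.
have cphi : phi p = (phi \o chart_inv c) (c p) by rewrite /= chart_mapK.
rewrite cphi -(dirder_comp (f := c \o chart_inv phi) (g := phi \o chart_inv c))//.
- rewrite (dirder_ext (g := id)).
    by apply: dirder_clinear => //; split => // ?; exact: cvg_id.
  near=> z; rewrite /= chart_mapK.
    apply: chart_invK; near: z.
    exact: open_nbhs_in (chart_img_open c) (chart_map_img dpp).
  near: z; apply: (chart_inv_cvg (chart_map_img dpp)).
  by rewrite chart_mapK//; exact: chart_near.
- have /= := (msmooth_chart_inv ap (chart_map_img dpp)).2 phi aphi.
  by rewrite chart_mapK//; apply.
- have /= := (msmooth_chart_inv aphi (chart_map_img dp)).2 c ap.
  by rewrite !chart_mapK//; apply.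
Unshelve. all: by end_near. Qed.

End ManifoldSmoothness.

(** * Fundamental vector fields *)

Section FundamentalField.
Context (R : realType) (EG EM : tvsType R).
Hypotheses (hG : hausdorff_space EG) (hM : hausdorff_space EM).
Context (G : lieGroupType EG) (M : smoothManifoldType EM) (sigma : M -> G -> M).
Hypotheses (ss : smooth_map2 sigma) (act : right_action sigma).

Let c := chart_at (1%g : G).
Let ac : atlas c := (chart_atP (1%g : G)).1.
Let dc : chart_dom c 1%g := (chart_atP (1%g : G)).2.
Let ic : chart_img c (c 1%g) := chart_map_img dc.

Lemma fundamental_field_base v y : tbase (fundamental_field sigma v y) = y.
Proof. exact: act.1. Qed.

Let msm_c : msmooth_at (chart_inv c) (c 1%g) := msmooth_chart_inv ac ic.

Lemma fundamental_field_chart (psi : chart EM M) (v : EG) y : atlas psi -> chart_dom psi y ->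
  chart_diff psi (fundamental_field sigma v y) =
  dirder (psi \o sigma y \o chart_inv c) (c 1%g) v.
Proof.
move=> apsi dy.
rewrite /fundamental_field /tangent_map /=.
apply: (@chart_diffE R EG EM M (sigma y \o chart_inv c) (c 1%g) v (sigma y 1%g) psi) => //.
- by apply: msmooth_map2 => //; exact: msmooth_cst.
- by rewrite /= chart_mapK.
- by rewrite act.1.
Qed.

(** [v_sharp y] is the derivative at [(y, 1)], in the direction [(0, v)], of the
    coordinate expression of the action, which is jointly smooth. *)
Lemma fundamental_field_chart_cvg (psi : chart EM M) (v0 : EG) y0 : atlas psi -> chart_dom psi y0 ->
  (fun z : (EG * M)%type => chart_diff psi (fundamental_field sigma (z.1 : lie_algebra G) z.2))
    @ (v0, y0) --> chart_diff psi (fundamental_field sigma (v0 : lie_algebra G) y0).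
Proof.
move=> apsi dy0.
pose T (z : (EM * EG)%type) := psi (sigma (chart_inv psi z.1) (chart_inv c z.2)).
have Ts y : chart_dom psi y -> smooth_at T (psi y, c 1%g).
  move=> dy.
  have hEE : hausdorff_space (EM * EG)%type by exact: hausdorff_prod.
  have m : msmooth_at (fun z : (EM * EG)%type =>
      sigma (chart_inv psi z.1) (chart_inv c z.2)) (psi y, c 1%g).
    apply: msmooth_map2 => //.
      apply: (msmooth_comp (u := chart_inv psi) (g := fst)) => //.
        by apply: smooth_at_clinear => //; exact: clinear_fst.
      by apply: msmooth_chart_inv => //; exact: chart_map_img.
    apply: (msmooth_comp (u := chart_inv c) (g := snd)) => //.
    by apply: smooth_at_clinear => //; exact: clinear_snd.
  by apply: m.2 => //=; rewrite !chart_mapK// act.1.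
have dT y v : chart_dom psi y -> chart_diff psi (fundamental_field sigma (v : lie_algebra G) y) =
    dirder T (psi y, c 1%g) (0, v).
  move=> dy; rewrite fundamental_field_chart//.
  have -> : (0, v) = dirder (fun z : EG => (psi y, z)) (c 1%g) v :> EM * EG.
    rewrite dirder_pair//; last 2 first.
      exact: smooth_at_cst.
      exact: smooth_at_id.
    by rewrite dirder_cst// (dirder_clinear (L := id))//; split => // ?; exact: cvg_id.
  rewrite -(dirder_comp (f := T) (g := fun z : EG => (psi y, z)))//.
  - apply: dirder_ext; near=> z; rewrite /= /T /=.
    by rewrite chart_mapK.
  - exact: hausdorff_prod.
  - by apply: smooth_at_pair => //; [exact: smooth_at_cst|exact: smooth_at_id].
  - exact: Ts.
have c1 : (fun z : (EG * M)%type => (psi z.2, c 1%g)) @ (v0, y0) --> (psi y0, c 1%g).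
  apply: pair_cvg; last exact: cvg_cst.
  by apply: (cvg_comp _ _ cvg_snd); exact: chart_cvg.
have c2 : (fun z : (EG * M)%type => ((0 : EM), z.1)) @ (v0, y0) --> ((0 : EM), v0).
  by apply: pair_cvg; [exact: cvg_cst|exact: cvg_fst].
have : (fun z : (EG * M)%type => dirder T (psi z.2, c 1%g) (0, z.1)) @ (v0, y0) -->
    dirder T (psi y0, c 1%g) (0, v0).
  exact: (cvg_comp _ _ (pair_cvg c1 c2) (smooth_at_cvg (smooth_at_dirder (0, v0) (Ts y0 dy0)))).
rewrite dT//; apply: cvg_trans; apply: near_eq_cvg.
exists (setT, chart_dom psi) => /=.
  by split; [exact: filterT|exact: chart_near].
by move=> [v y] [/= _ dy]; rewrite dT.
Unshelve. all: by end_near. Qed.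

Lemma fundamental_field_cvg (v0 : EG) y0 :
  (fun z : (EG * M)%type => fundamental_field sigma (z.1 : lie_algebra G) z.2)
    @ (v0, y0) --> fundamental_field sigma (v0 : lie_algebra G) y0.
Proof.
move=> A /nbhs_openP[B [oB Bf BA]].
have [apsi dy0] := chart_atP y0; set psi := chart_at y0 in apsi dy0.
have [V [oV BV]] : exists V : set (EM * EM)%type, open V /\
    forall u, chart_dom psi (tbase u) -> (B u <-> V (chart_tangent psi u)) by exact: oB.
have c1 : (fun z : (EG * M)%type => psi z.2) @ (v0, y0) --> psi y0.
  by apply: (cvg_comp _ _ cvg_snd); exact: chart_cvg.
have c2 := fundamental_field_chart_cvg (v0 := v0) apsi dy0.
have V0 : nbhs (psi y0, chart_diff psi (fundamental_field sigma (v0 : lie_algebra G) y0)) V.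
  apply: open_nbhs_in => //.
  have [|+ _] := BV (fundamental_field sigma (v0 : lie_algebra G) y0).
    by rewrite fundamental_field_base.
  by rewrite /chart_tangent fundamental_field_base; apply.
have [[A1 A2] /= [A1v A2y] AV] := pair_cvg c1 c2 V0.
exists (A1, A2 `&` chart_dom psi) => /=.
  by split => //; apply: filterI => //; exact: chart_near.
move=> [v y] [/= A1v' [A2y' dy]]; apply: BA.
apply/BV; first by rewrite fundamental_field_base.
by rewrite /chart_tangent fundamental_field_base; apply: (AV (v, y)).
Qed.

Lemma fundamental_field_lusin (a b : R) (gamma : R -> EG) (y : R -> M) :
  lusin_measurable `[a, b]%classic gamma -> {within `[a, b]%classic, continuous y} ->
  lusin_measurable `[a, b]%classic
    (fun t => fundamental_field sigma (gamma t : lie_algebra G) (y t)).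
Proof.
move=> lg cy.
apply: (@lusin_comp R _ (EG * M)%type (tangent M) (fun t => (gamma t, y t))
  (fun z => fundamental_field sigma (z.1 : lie_algebra G) z.2)).
  by apply: lusin_pair => //; exact: lusin_continuous.
by move=> t _; exact: fundamental_field_cvg.
Qed.

Lemma fundamental_field_chart_lusin (a b : R) (gamma : R -> EG) (y : R -> M) (psi : chart EM M) :
  atlas psi -> (forall t, a <= t <= b -> chart_dom psi (y t)) ->
  lusin_measurable `[a, b]%classic gamma -> {within `[a, b]%classic, continuous y} ->
  lusin_measurable `[a, b]%classic
    (fun t => chart_diff psi (fundamental_field sigma (gamma t : lie_algebra G) (y t))).
Proof.
move=> apsi dy lg cy.
apply: (@lusin_comp R _ (EG * M)%type EM (fun t => (gamma t, y t))
  (fun z => chart_diff psi (fundamental_field sigma (z.1 : lie_algebra G) z.2))).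
  by apply: lusin_pair => //; exact: lusin_continuous.
by move=> t; rewrite /= in_itv/= => tab; apply: fundamental_field_chart_cvg => //; exact: dy.
Qed.

(** Velocities are defined through some subdivision with some charts. Where the
    curve stays in one chart domain, the chain rule for chart changes replaces
    those charts by the given one, and the pieces are joined. *)
Lemma velocity_chart (I : set R) (s t : R) (gamma : R -> EG) (y : R -> M) (psi : chart EM M) :
  s < t -> `[s, t]%classic `<=` I -> lusin_measurable `[s, t]%classic gamma ->
  has_velocity I y (fun t => fundamental_field sigma (gamma t : lie_algebra G) (y t)) ->
  {within `[s, t]%classic, continuous y} ->
  atlas psi -> (forall r, s <= r <= t -> chart_dom psi (y r)) ->
  primitive_on s t
    (fun r => chart_diff psi (fundamental_field sigma (gamma r : lie_algebra G) (y r)))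
    (psi \o y).
Proof.
move=> st sI lg [_ _ /(_ s t st sI)[n [u [u0 un uS up]]]] cy apsi dy.
have umono i j : (i <= j)%N -> (j <= n)%N -> u i <= u j.
  elim: j => [|j IH]; first by rewrite leqn0 => /eqP ->.
  rewrite leq_eqVlt => /orP[/eqP -> //|]; rewrite ltnS => ij jn.
  by rewrite (le_trans (IH ij (ltnW jn)))// ltW// uS.
have piece i : (i < n)%N -> primitive_on (u i) (u i.+1)
    (fun r => chart_diff psi (fundamental_field sigma (gamma r : lie_algebra G) (y r))) (psi \o y).
  move=> ilt; have [phi [aphi [[cyi dphi _] [g [pg [_ _ _ aeq]]]]]] := up i ilt.
  have ui := uS i ilt.
  have si : s <= u i by rewrite -u0 umono// ltnW.
  have it : u i.+1 <= t by rewrite -un umono.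
  have dphi' r : u i <= r <= u i.+1 -> chart_dom phi (y r).
    by move=> h; apply: dphi; rewrite /= in_itv.
  have dpsi' r : u i <= r <= u i.+1 -> chart_dom psi (y r).
    by move=> /andP[h1 h2]; apply: dy; rewrite (le_trans si h1) (le_trans h2 it).
  have msm r : u i <= r <= u i.+1 -> msmooth_at (chart_inv phi) (phi (y r)).
    by move=> h; apply: msmooth_chart_inv => //; apply: chart_map_img; exact: dphi'.
  have sF r : u i <= r <= u i.+1 -> smooth_at (psi \o chart_inv phi) (phi (y r)).
    by move=> h; apply: (msm r h).2 => //; rewrite chart_mapK; [exact: dpsi'|exact: dphi'].
  have := primitive_comp hM hM (ltW ui) ((primitive_onP _ _ ui).2 pg) _ (sF).
  have cphi : {within `[u i, u i.+1]%classic, continuous (phi \o y)}.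
    apply: within_comp cyi _ => r; rewrite /= in_itv/= => h.
    by apply: chart_cvg; exact: dphi'.
  move=> /(_ cphi) pF.
  apply: (@primitive_ext R EM (u i) (u i.+1) _ _ ((psi \o chart_inv phi) \o (phi \o y))
    (psi \o y) (fun _ _ => erefl)).
    by move=> r h; rewrite /= chart_mapK//; exact: dphi'.
  apply: (primitive_ae pF).
    exact: (fundamental_field_chart_lusin apsi dpsi' (lusin_sub si it lg) cyi).
  apply: negligibleS aeq => r [/= rin ne]; split => //= e; apply: ne.
  rewrite -e /chart_tangent_inv.
  have h : u i <= r <= u i.+1 by move: rin; rewrite in_itv.
  rewrite (chart_diffE (u := chart_inv phi) (x := phi (y r)) (g r))//.
  - exact: msm.
  - by rewrite chart_mapK; [exact: dpsi'|exact: dphi'].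
have all i : (i < n)%N -> primitive_on (u 0%N) (u i.+1)
    (fun r => chart_diff psi (fundamental_field sigma (gamma r : lie_algebra G) (y r))) (psi \o y).
  elim: i => [|i IH] ilt; first exact: piece.
  apply: (@primitive_glue _ _ _ (u i.+1)); last exact: piece.
  - by apply: umono => //; exact: ltnW.
  - exact: umono.
  - by apply: IH; exact: ltnW.
have n0 : (0 < n)%N by case: n un {up uS umono piece all} => // un; move: st; rewrite -u0 -un ltxx.
by have := all n.-1; rewrite prednK// u0 un; apply.
Qed.

End FundamentalField.

(** * Subdivisions into pieces in chart domains *)

Section Piecewise.
Context (R : realType) (E : tvsType R) (N : smoothManifoldType E).

Lemma piecewise_mono (P Q : chart E N -> R -> R -> Prop) s t :
  (forall phi u v, P phi u v -> Q phi u v) ->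
  piecewise_in_charts P s t -> piecewise_in_charts Q s t.
Proof.
move=> PQ [n [u [u0 un uS up]]]; exists n, u; split => // i ilt.
by have [phi [aphi Pi]] := up i ilt; exists phi; split => //; exact: PQ.
Qed.

Lemma piecewise_cat (P : chart E N -> R -> R -> Prop) r s t :
  piecewise_in_charts P r s -> piecewise_in_charts P s t -> piecewise_in_charts P r t.
Proof.
move=> [n [u [u0 un uS up]]] [m [v [v0 vm vS vp]]].
pose w i := if (i < n)%N then u i else v (i - n)%N.
have wl i : (i <= n)%N -> w i = u i.
  by rewrite /w leq_eqVlt => /orP[/eqP ->|->//]; rewrite ltnn subnn v0 un.
have wr i : (n <= i)%N -> w i = v (i - n)%N by rewrite /w ltnNge => ->.
exists (n + m)%N, w; split.
- by rewrite wl.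
- by rewrite wr ?leq_addr// addKn.
- move=> i; have [ilt _|ni im] := ltnP i n; first by rewrite !wl ?(ltnW ilt)//; exact: uS.
  by rewrite !wr ?(leqW ni)// subSn//; apply: vS; rewrite ltn_subLR.
- move=> i; have [ilt _|ni im] := ltnP i n; first by rewrite !wl ?(ltnW ilt)//; exact: up.
  by rewrite !wr ?(leqW ni)// subSn//; apply: vp; rewrite ltn_subLR.
Qed.

Lemma piecewise1 (P : chart E N -> R -> R -> Prop) s t phi :
  s < t -> atlas phi -> P phi s t -> piecewise_in_charts P s t.
Proof.
move=> st aphi Ps; exists 1%N, (fun i => if i is 0%N then s else t); split => //.
  by case.
by case=> // _; exists phi.
Qed.

(** Interval induction provides the subdivision. *)
Lemma piecewise_local (P : chart E N -> R -> R -> Prop) a b : a < b ->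
  (forall r, a <= r -> r <= b -> exists2 e, 0 < e & forall s t, a <= s -> s < t -> t <= b ->
     `|s - r| < e -> `|t - r| < e -> exists phi, atlas phi /\ P phi s t) ->
  piecewise_in_charts P a b.
Proof.
move=> ab loc.
suff : a < b -> piecewise_in_charts P a b by exact.
apply: (@interval_induction R (fun s t => s < t -> piecewise_in_charts P s t) a b (ltW ab)).
  move=> r s t ar rs st tb Qrs Qst rt.
  have [sr|rs'] := leP s r.
    have e : s = r by apply/le_anti; rewrite sr.
    by rewrite -e in rt *; exact: Qst.
  have [ts|st'] := leP t s.
    have e : s = t by apply/le_anti; rewrite st.
    by rewrite e in Qrs; exact: Qrs.
  exact: piecewise_cat (Qrs rs') (Qst st').
move=> r ar rb; have [e e0 h] := loc r ar rb; exists e => // s t as_ st tb sr tr st'.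
have [phi [aphi Pphi]] := h s t as_ st' tb sr tr.
exact: piecewise1 Pphi.
Qed.

Lemma within_near (T : topologicalType) (s t r : R) (y : R -> T) (D : set T) :
  {within `[s, t]%classic, continuous y} -> s <= r -> r <= t -> open D -> D (y r) ->
  exists2 e, 0 < e & forall u, s <= u <= t -> `|u - r| < e -> D (y u).
Proof.
move=> /subspace_continuousP/(_ r) + sr rt oD Dr.
rewrite /= in_itv/= sr rt => /(_ isT _ (open_nbhs_in oD Dr))[e /= e0 h].
exists e => // u ust ur; apply: h => /=; first by rewrite distrC.
by rewrite in_itv.
Qed.

Lemma between_near (r e s t u : R) : `|s - r| < e -> `|t - r| < e -> s <= u <= t -> `|u - r| < e.
Proof.
rewrite !ltr_norml => /andP[a1 _] /andP[_ a2] /andP[su ut].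
by rewrite (lt_le_trans a1) ?lerB// (le_lt_trans _ a2)// lerB.
Qed.

End Piecewise.

(** * Derivatives along orbits of the action *)

Section Solutions.
Context (R : realType) (EG EM : tvsType R).
Hypotheses (hG : hausdorff_space EG) (hM : hausdorff_space EM).
Context (G : lieGroupType EG) (M : smoothManifoldType EM) (sigma : M -> G -> M).
Hypotheses (ss : smooth_map2 sigma) (act : right_action sigma).

Notation ff v y := (fundamental_field sigma (v : lie_algebra G) y).

Lemma chart_velocity_primitive (s t : R) (gamma : R -> EG) (y : R -> M) (psi : chart EM M) :
  s < t -> lusin_measurable `[s, t]%classic gamma ->
  {within `[s, t]%classic, continuous y} ->
  atlas psi -> (forall r, s <= r <= t -> chart_dom psi (y r)) ->
  primitive_on s t (fun r => chart_diff psi (ff (gamma r) (y r))) (psi \o y) ->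
  chart_velocity psi s t y (fun r => ff (gamma r) (y r)).
Proof.
move=> st lg cy apsi dy /(primitive_onP _ _ st) p; split.
  split => //.
  by exists (fun r => chart_diff psi (ff (gamma r) (y r))).
exists (fun r => chart_diff psi (ff (gamma r) (y r))); split => //.
have lth := fundamental_field_lusin hG hM ss act lg cy.
have e r : s <= r <= t ->
    chart_tangent_inv psi (psi (y r)) (chart_diff psi (ff (gamma r) (y r))) =
    ff (gamma r) (y r).
  move=> h; have := @chart_tangent_invK R EM M psi (ff (gamma r) (y r)) hM apsi.
  by rewrite fundamental_field_base//; apply; exact: dy.
split => //.
- by apply: lusin_ext lth => r rst; rewrite e.
- by move=> r rst; rewrite e.
- by exists set0; split => // r [rst]; apply; exact: e.
Qed.

(** A local version of the integral equation in charts implies the global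
    notions of absolute continuity and velocity. *)
Lemma velocity_of_charts (a b : R) (gamma : R -> EG) (y : R -> M) :
  lusin_measurable `[a, b]%classic gamma ->
  {within `[a, b]%classic, continuous y} ->
  (forall r, a <= r -> r <= b -> exists2 e, 0 < e & forall s t, a <= s -> s < t -> t <= b ->
     `|s - r| < e -> `|t - r| < e -> exists psi, [/\ atlas psi,
       forall u, s <= u <= t -> chart_dom psi (y u) &
       primitive_on s t (fun r => chart_diff psi (ff (gamma r) (y r))) (psi \o y)]) ->
  manifold_abs_continuous `[a, b]%classic y /\
  has_velocity `[a, b]%classic y (fun r => ff (gamma r) (y r)).
Proof.
move=> lg cy loc.
have pw al be : al < be -> `[al, be]%classic `<=` `[a, b]%classic ->
    piecewise_in_charts
      (fun phi s t => chart_velocity phi s t y (fun r => ff (gamma r) (y r))) al be.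
  move=> albe /(sub_itv albe)[aal beb]; apply: piecewise_local => // r alr rbe.
  have [e e0 h] := loc r (le_trans aal alr) (le_trans rbe beb).
  exists e => // s t als st tbe sr tr.
  have [psi [apsi dpsi p]] := h s t (le_trans aal als) st (le_trans tbe beb) sr tr.
  exists psi; split => //; apply: chart_velocity_primitive => //.
    by apply: (lusin_sub _ _ lg); [exact: le_trans als|exact: le_trans beb].
  by apply: (within_itvS _ _ cy); [exact: le_trans als|exact: le_trans beb].
split.
  move=> al be albe abi; have [aal beb] := sub_itv albe abi.
  split; first exact: within_itvS cy.
  by apply: piecewise_mono (pw al be albe abi) => phi u v [].
split => //; first exact: fundamental_field_lusin.
by move=> r _; exact: fundamental_field_base.
Qed.

(** [G] acts on itself, and the fundamental field of this action is
    [v |-> h.v]: the equation of the evolution is the case [M = G] of the equation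
    under study, and the results on fundamental fields apply to [eta]. *)
Lemma mul_right_action : right_action (fun g h : G => (g * h)%g).
Proof. by split=> [g|x g h]; [exact: mulg1|rewrite mulgA]. Qed.

Notation ffG v z := (fundamental_field (fun g1 g2 : G => (g1 * g2)%g) (v : lie_algebra G) z).

Let c := chart_at (1%g : G).
Let ac : atlas c := (chart_atP (1%g : G)).1.
Let dc : chart_dom c 1%g := (chart_atP (1%g : G)).2.
Let ic : chart_img c (c 1%g) := chart_map_img dc.
Let msm_c : msmooth_at (chart_inv c) (c 1%g) := msmooth_chart_inv ac ic.
Let smul : smooth_map2 (fun g h : G => (g * h)%g) := lie_mul_smooth.

Lemma transport_smooth (chi : chart EG G) (g : G) (y : M) (h : G) :
  atlas chi -> chart_dom chi h ->
  msmooth_at (fun x => sigma y (g * chart_inv chi x)%g) (chi h).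
Proof.
move=> achi dh; apply: msmooth_map2 => //; first exact: msmooth_cst.
apply: (msmooth_map2 (f := fun g h : G => (g * h)%g)) => //; first exact: msmooth_cst.
by apply: msmooth_chart_inv => //; exact: chart_map_img.
Qed.

Let mulc_smooth (h : G) : msmooth_at (fun z => (h * chart_inv c z)%g) (c 1%g).
Proof.
by apply: (msmooth_map2 (f := fun g h : G => (g * h)%g)) => //; exact: msmooth_cst.
Qed.

Let actc_smooth (y : M) : msmooth_at (fun z => sigma y (chart_inv c z)) (c 1%g).
Proof. by apply: msmooth_map2 => //; exact: msmooth_cst. Qed.

(** [sigma y (g * (h * k)) = sigma (sigma y (g * h)) k], differentiated at
    [k = 1]. *)
Lemma transport_field (chi : chart EG G) (psi : chart EM M) (g : G) (y : M) (h : G) (v : EG) :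
  atlas chi -> atlas psi -> chart_dom chi h -> chart_dom psi (sigma y (g * h)%g) ->
  dirder (psi \o (fun x => sigma y (g * chart_inv chi x)%g)) (chi h)
     (chart_diff chi (ffG v h)) = chart_diff psi (ff v (sigma y (g * h)%g)).
Proof.
move=> achi apsi dh dy.
rewrite (fundamental_field_chart hG hG smul mul_right_action v achi dh).
rewrite (fundamental_field_chart hG hM ss act v apsi dy).
have hE : chi h = (chi \o (fun z => (h * chart_inv c z)%g)) (c 1%g).
  by rewrite /= chart_mapK// mulg1.
rewrite -/c [X in dirder _ X _]hE.
rewrite -(dirder_comp (f := psi \o (fun x => sigma y (g * chart_inv chi x)%g))
   (g := chi \o (fun z => (h * chart_inv c z)%g)))//.
- apply: dirder_ext; near=> z; rewrite /= chart_mapK.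
    by rewrite act.2 mulgA.
  near: z; apply: (mulc_smooth h).1 => /=.
  by rewrite chart_mapK// mulg1; exact: chart_near.
- by apply: (mulc_smooth h).2 => //; rewrite /= chart_mapK// mulg1.
- rewrite -hE; apply: (transport_smooth _ _ _ _).2 => //.
  by rewrite chart_mapK.
Unshelve. all: by end_near. Qed.

Lemma comoving_smooth (psi : chart EM M) (chi : chart EG G) (y : M) (h : G) :
  atlas psi -> atlas chi -> chart_dom psi y -> chart_dom chi h ->
  msmooth_at (fun z : (EM * EG)%type => sigma (chart_inv psi z.1) (chart_inv chi z.2)^-1%g)
    (psi y, chi h).
Proof.
move=> apsi achi dy dh.
have hEE : hausdorff_space (EM * EG)%type by exact: hausdorff_prod.
apply: msmooth_map2 => //.
  apply: (msmooth_comp (u := chart_inv psi) (g := fst)) => //.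
    by apply: smooth_at_clinear => //; exact: clinear_fst.
  by apply: msmooth_chart_inv => //; exact: chart_map_img.
apply: (msmooth_map (f := fun g : G => (g^-1)%g) (u := chart_inv chi \o snd)) => //.
  exact: lie_inv_smooth.
apply: (msmooth_comp (u := chart_inv chi) (g := snd)) => //.
  by apply: smooth_at_clinear => //; exact: clinear_snd.
by apply: msmooth_chart_inv => //; exact: chart_map_img.
Qed.

(** The direction is the derivative of [k |-> (sigma y k, h * k)] at [k = 1], and
    [sigma (sigma y k) (h * k)^-1 = sigma y h^-1]. *)
Lemma comoving_derivative0 (psi psi' : chart EM M) (chi : chart EG G) (y : M) (h : G) (v : EG) :
  atlas psi -> atlas psi' -> atlas chi -> chart_dom psi y -> chart_dom chi h ->
  chart_dom psi' (sigma y h^-1%g) ->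
  dirder (psi' \o (fun z : (EM * EG)%type => sigma (chart_inv psi z.1) (chart_inv chi z.2)^-1%g))
    (psi y, chi h) (chart_diff psi (ff v y), chart_diff chi (ffG v h)) = 0.
Proof.
move=> apsi apsi' achi dy dh dy'.
have hEE : hausdorff_space (EM * EG)%type by exact: hausdorff_prod.
rewrite (fundamental_field_chart hG hG smul mul_right_action v achi dh).
rewrite (fundamental_field_chart hG hM ss act v apsi dy).
rewrite -/c.
pose H1 := psi \o (fun z => sigma y (chart_inv c z)).
pose H2 := chi \o (fun z => (h * chart_inv c z)%g).
have e1 : psi y = H1 (c 1%g) by rewrite /H1 /= chart_mapK// act.1.
have e2 : chi h = H2 (c 1%g) by rewrite /H2 /= chart_mapK// mulg1.
have s1 : smooth_at H1 (c 1%g) by apply: (actc_smooth y).2 => //; rewrite chart_mapK// act.1.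
have s2 : smooth_at H2 (c 1%g) by apply: (mulc_smooth h).2 => //; rewrite chart_mapK// mulg1.
have -> : (dirder (psi \o sigma y \o chart_inv c) (c 1%g) v,
    dirder (chi \o (fun h0 : G => (h * h0)%g) \o chart_inv c) (c 1%g) v) =
    dirder (fun z => (H1 z, H2 z)) (c 1%g) v by rewrite dirder_pair.
rewrite [X in dirder _ (X, _) _]e1 [X in dirder _ (_, X) _]e2.
rewrite -(dirder_comp (g := fun z => (H1 z, H2 z)))//.
- rewrite (dirder_ext (g := fun=> psi' (sigma y h^-1%g))); first exact: dirder_cst.
  near=> z; rewrite /= /H1 /H2 /= !chart_mapK.
  + by rewrite act.2 invgM mulgA mulgV mul1g.
  + near: z; apply: (mulc_smooth h).1 => /=.
    by rewrite chart_mapK// mulg1; exact: chart_near.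
  + near: z; apply: (actc_smooth y).1 => /=.
    by rewrite chart_mapK// act.1; exact: chart_near.
- exact: smooth_at_pair.
- rewrite -e1 -e2; apply: (comoving_smooth _ _ _ _).2 => //=.
  by rewrite !chart_mapK.
Unshelve. all: by end_near. Qed.

End Solutions.

(** * Solutions and the maximal flow *)

Section Flow.
Context (R : realType) (EG EM : tvsType R).
Hypotheses (hG : hausdorff_space EG) (hM : hausdorff_space EM).
Context (G : lieGroupType EG) (M : smoothManifoldType EM) (sigma : M -> G -> M).
Hypotheses (ss : smooth_map2 sigma) (act : right_action sigma).

Notation ff v y := (fundamental_field sigma (v : lie_algebra G) y).
Notation ffG v z := (fundamental_field (fun g1 g2 : G => (g1 * g2)%g) (v : lie_algebra G) z).
Notation mu := (@lebesgue_measure R).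

Variables (a b : R) (ab : a < b) (gamma : R -> EG) (eta : R -> G).
Hypotheses (gL1 : L1 a b gamma)
  (eta_ac : manifold_abs_continuous `[a, b]%classic eta)
  (eta_vel : has_velocity `[a, b]%classic eta (fun t => ffG (gamma t) (eta t))).

Let J := `[a, b]%classic.
Let W := J `*` [set: M].
Let f := fun t y => ff (gamma t) y.

Lemma evolution_continuous : {within `[a, b]%classic, continuous eta}.
Proof. by have [] := eta_ac ab (fun x => id). Qed.

Lemma sub_itvS (s t : R) : a <= s -> t <= b -> `[s, t]%classic `<=` `[a, b]%classic.
Proof.
move=> as_ tb x; rewrite /= !in_itv/= => /andP[sx xt].
by rewrite (le_trans as_ sx) (le_trans xt tb).
Qed.

Lemma evolution_primitive (chi : chart EG G) (s t : R) : a <= s -> s < t -> t <= b -> atlas chi ->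
  (forall r, s <= r <= t -> chart_dom chi (eta r)) ->
  primitive_on s t (fun r => chart_diff chi (ffG (gamma r) (eta r))) (chi \o eta).
Proof.
move=> as_ st tb achi dchi.
apply: (velocity_chart hG hG lie_mul_smooth (mul_right_action G) st (sub_itvS as_ tb)) => //.
  exact: lusin_sub gL1.1.
exact: within_itvS evolution_continuous.
Qed.

(** The chain rule for [eta] followed by [h |-> sigma y (g * h)]. *)
Lemma flow_primitive (chi : chart EG G) (psi : chart EM M) (y : M) (g : G) (s t : R) :
  a <= s -> s < t -> t <= b -> atlas chi -> atlas psi ->
  (forall r, s <= r <= t -> chart_dom chi (eta r)) ->
  (forall r, s <= r <= t -> chart_dom psi (sigma y (g * eta r)%g)) ->
  primitive_on s t (fun r => chart_diff psi (ff (gamma r) (sigma y (g * eta r)%g)))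
    (psi \o (fun r => sigma y (g * eta r)%g)).
Proof.
move=> as_ st tb achi apsi dchi dpsi.
pose F := psi \o (fun x => sigma y (g * chart_inv chi x)%g).
have pe := evolution_primitive as_ st tb achi dchi.
have ce : {within `[s, t]%classic, continuous (chi \o eta)}.
  apply: (within_comp (within_itvS as_ tb evolution_continuous)) => r; rewrite /= in_itv/= => h.
  by apply: chart_cvg; exact: dchi.
have sF r : s <= r <= t -> smooth_at F ((chi \o eta) r).
  move=> h; apply: (transport_smooth hG hM ss _ _ achi (dchi r h)).2 => //.
  by rewrite chart_mapK; [exact: dpsi|exact: dchi].
apply: primitive_ext (primitive_comp hG hM (ltW st) pe ce sF) => r h; last first.
  by rewrite /F /= chart_mapK//; exact: dchi.
by apply: (transport_field hG hM ss act) => //; [exact: dchi|exact: dpsi].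
Qed.

Lemma mulg_cvg (T : Type) (F : set_system T) (FF : Filter F) (u v : T -> G) (g h : G) :
  u @ F --> g -> v @ F --> h -> (fun t => (u t * v t)%g) @ F --> (g * h)%g.
Proof.
move=> ug vh; have [cm _] := (lie_mul_smooth : smooth_map2 (fun g h : G => (g * h)%g)).
exact: (cvg_comp _ _ (pair_cvg ug vh) (cm (g, h))).
Qed.

Lemma sigma_cvg (T : Type) (F : set_system T) (FF : Filter F) (u : T -> M) (v : T -> G) y h :
  u @ F --> y -> v @ F --> h -> (fun t => sigma (u t) (v t)) @ F --> sigma y h.
Proof.
by move=> ug vh; exact: (cvg_comp _ _ (pair_cvg ug vh) (ss.1 (y, h))).
Qed.

Lemma invg_cvg (T : Type) (F : set_system T) (FF : Filter F) (u : T -> G) (g : G) :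
  u @ F --> g -> (fun t => (u t)^-1%g) @ F --> (g^-1)%g.
Proof.
move=> ug; have [cm _] := (lie_inv_smooth : smooth_map (fun g : G => (g^-1)%g)).
exact: (cvg_comp _ _ ug (cm g)).
Qed.

Lemma flow_continuous (y : M) (g : G) :
  {within `[a, b]%classic, continuous (fun r => sigma y (g * eta r)%g)}.
Proof.
have /subspace_continuousP ce := evolution_continuous.
apply/subspace_continuousP => r rab.
by apply: sigma_cvg; [exact: cvg_cst|apply: mulg_cvg; [exact: cvg_cst|exact: ce]].
Qed.

Lemma flow_velocity (y : M) (g : G) :
  manifold_abs_continuous `[a, b]%classic (fun r => sigma y (g * eta r)%g) /\
  has_velocity `[a, b]%classic (fun r => sigma y (g * eta r)%g)
    (fun r => ff (gamma r) (sigma y (g * eta r)%g)).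
Proof.
apply: velocity_of_charts => //; [exact: gL1.1|exact: flow_continuous|].
move=> r ar rb.
have [achi dchi] := chart_atP (eta r); have [apsi dpsi] := chart_atP (sigma y (g * eta r)%g).
set chi := chart_at _ in achi dchi; set psi := chart_at _ in apsi dpsi.
have [e1 e10 h1] := within_near evolution_continuous ar rb (chart_dom_open chi) dchi.
have [e2 e20 h2] := within_near (@flow_continuous y g) ar rb (chart_dom_open psi) dpsi.
exists (Num.min e1 e2); first by rewrite lt_min e10.
move=> s t as_ st tb; rewrite !lt_min => /andP[s1 s2] /andP[t1 t2].
have inab u : s <= u <= t -> a <= u <= b.
  by move=> /andP[su ut]; rewrite (le_trans as_ su) (le_trans ut tb).
have d1 u : s <= u <= t -> chart_dom chi (eta u).
  by move=> h; apply: h1; [exact: inab|exact: between_near s1 t1 h].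
have d2 u : s <= u <= t -> chart_dom psi (sigma y (g * eta u)%g).
  by move=> h; apply: h2; [exact: inab|exact: between_near s2 t2 h].
exists psi; split => //; exact: (flow_primitive as_ st tb achi apsi).
Qed.

Lemma nondeg_ab : nondeg_interval J.
Proof.
split; last by exists a, b; rewrite /J /= !in_itv/= !lexx (ltW ab).
move=> x y; rewrite /J /= !in_itv/= => /andP[ax _] /andP[_ yb] z /andP[xz zy].
by rewrite in_itv/= (le_trans ax xz) (le_trans zy yb).
Qed.

Lemma flow_solution (t0 : R) (y0 : M) : J t0 ->
  ivp_solution W f t0 y0 J (fun t => sigma y0 ((eta t0)^-1 * eta t)%g).
Proof.
move=> Jt0; split => //; last by rewrite mulVg act.1.
have [h1 h2] := flow_velocity y0 (eta t0)^-1%g.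
by split => //; exact: nondeg_ab.
Qed.

(** On a short interval the curve is, in charts, a smooth function of the pair
    [(y, eta)]; by the chain rule its integrand is zero. *)
Lemma solution_comoving (I : set R) (y : R -> M) (s t : R) : solution W f I y ->
  I s -> I t -> s < t -> sigma (y s) (eta s)^-1%g = sigma (y t) (eta t)^-1%g.
Proof.
move=> [[Iint _] yac yW yvel] Is It st.
have stI : `[s, t]%classic `<=` I.
  by move=> r; rewrite /= in_itv/= => h; exact: Iint h.
have as_ : a <= s by have [/=] := yW s Is; rewrite /J /= in_itv/= => /andP[].
have tb : t <= b by have [/=] := yW t It; rewrite /J /= in_itv/= => /andP[].
have cy : {within `[s, t]%classic, continuous y} by have [] := yac s t st stI.
have ce := within_itvS as_ tb evolution_continuous.
pose w r := sigma (y r) (eta r)^-1%g.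
have cw : {within `[s, t]%classic, continuous w}.
  apply/subspace_continuousP => r rst; apply: sigma_cvg.
    by have /subspace_continuousP := cy; apply.
  by apply: invg_cvg; have /subspace_continuousP := ce; apply.
apply: (@interval_induction R (fun s t => w s = w t) s t (ltW st)).
  by move=> r1 r2 r3 _ _ _ _ -> ->.
move=> r sr rt.
have [achi dchi] := chart_atP (eta r); have [apsi dpsi] := chart_atP (y r).
have [apsi' dpsi'] := chart_atP (w r).
set chi := chart_at _ in achi dchi; set psi := chart_at _ in apsi dpsi.
set psi' := chart_at _ in apsi' dpsi'.
have [e1 e10 h1] := within_near ce sr rt (chart_dom_open chi) dchi.
have [e2 e20 h2] := within_near cy sr rt (chart_dom_open psi) dpsi.
have [e3 e30 h3] := within_near cw sr rt (chart_dom_open psi') dpsi'.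
exists (Num.min e1 (Num.min e2 e3)); first by rewrite !lt_min e10 e20.
move=> s' t' ss' + tt'; rewrite le_eqVlt => /orP[/eqP -> //|st'].
rewrite !lt_min => /and3P[s1 s2 s3] /and3P[t1 t2 t3].
have inst u : s' <= u <= t' -> s <= u <= t.
  by move=> /andP[su ut]; rewrite (le_trans ss' su) (le_trans ut tt').
have d1 u : s' <= u <= t' -> chart_dom chi (eta u).
  by move=> h; apply: h1; [exact: inst|exact: between_near s1 t1 h].
have d2 u : s' <= u <= t' -> chart_dom psi (y u).
  by move=> h; apply: h2; [exact: inst|exact: between_near s2 t2 h].
have d3 u : s' <= u <= t' -> chart_dom psi' (w u).
  by move=> h; apply: h3; [exact: inst|exact: between_near s3 t3 h].
have as' := le_trans as_ ss'; have tb' := le_trans tt' tb.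
have cy' := within_itvS ss' tt' cy; have ce' := within_itvS ss' tt' ce.
have p1 := evolution_primitive as' st' tb' achi d1.
have stI' : `[s', t']%classic `<=` I.
  by apply: subset_trans stI => x; rewrite /= !in_itv/=; exact: inst.
have p2 := velocity_chart hG hM ss act st' stI' (lusin_sub as' tb' gL1.1) yvel cy' apsi d2.
pose F := psi' \o (fun z : (EM * EG)%type => sigma (chart_inv psi z.1) (chart_inv chi z.2)^-1%g).
have cp : {within `[s', t']%classic, continuous (fun u => ((psi \o y) u, (chi \o eta) u))}.
  apply: within_pair.
    by apply: (within_comp cy') => u; rewrite /= in_itv/= => h; apply: chart_cvg; exact: d2.
  by apply: (within_comp ce') => u; rewrite /= in_itv/= => h; apply: chart_cvg; exact: d1.
have sF u : s' <= u <= t' -> smooth_at F ((psi \o y) u, (chi \o eta) u).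
  move=> h; apply: (comoving_smooth hG hM ss apsi achi (d2 u h) (d1 u h)).2 => //=.
  by rewrite !chart_mapK; [exact: d3|exact: d1|exact: d2].
have [_ pF] := primitive_comp (hausdorff_prod hM hG) hM (ltW st') (primitive_pair p2 p1) cp sF.
have Fw u : s' <= u <= t' -> F ((psi \o y) u, (chi \o eta) u) = psi' (w u).
  by move=> h; rewrite /F /= !chart_mapK//; [exact: d1|exact: d2].
have hs' : s' <= s' <= t' by rewrite lexx ltW.
have ht' : s' <= t' <= t' by rewrite lexx ltW.
apply: (chart_inj (d3 s' hs') (d3 t' ht')).
apply/esym/eqP; rewrite -subr_eq0; apply/eqP; apply: linear_sep => // l cl.
rewrite -!Fw//.
have := pF s' t' (lexx _) (ltW st') (lexx _) l cl; rewrite /= => ->.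
rewrite (_ : \int[mu]_(u in _) _ = \int[mu]_(u in `[s', t']) 0).
  by rewrite itv_integral_cst ?ltW// mul0r.
apply: eq_Rintegral => u /set_mem; rewrite /= in_itv/= => h.
rewrite (comoving_derivative0 hG hM ss act) ?linear0//; [exact: d2|exact: d1|exact: d3].
Qed.

Lemma solution_formula (I : set R) (y : R -> M) (s t : R) : solution W f I y ->
  I s -> I t -> y t = sigma (y s) ((eta s)^-1 * eta t)%g.
Proof.
move=> sol Is It.
have e : sigma (y s) (eta s)^-1%g = sigma (y t) (eta t)^-1%g.
  have [st|ts|-> //] := ltgtP s t; first exact: solution_comoving sol _ _ _.
  by apply/esym; exact: solution_comoving sol _ _ _.
by rewrite -act.2 e act.2 mulVg act.1.
Qed.

Lemma flow_local_existence : local_existence J W f.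
Proof.
move=> t0 y0 [/= Jt0 _]; exists J, (fun t => sigma y0 ((eta t0)^-1 * eta t)%g); split.
  by exists setT; split; [exact: openT|rewrite setIT].
exact: flow_solution.
Qed.

Lemma flow_local_uniqueness : local_uniqueness W f.
Proof.
move=> I1 I2 y1 y2 t0 sol1 sol2 I1t I2t e.
have [[i1 _] _ _ _] := sol1; have [[i2 _] _ _ _] := sol2.
exists (I1 `&` I2); split => //.
- by move=> x z [? ?] [? ?] u xuz; split; [exact: i1 xuz|exact: i2 xuz].
- by exists setT; split; [exact: openT|rewrite setIT].
- move=> t [J1 J2].
  by rewrite (solution_formula sol1 I1t J1) (solution_formula sol2 I2t J2) e.
Qed.

Lemma flow_maximal : is_maximal_flow W f (J `*` J `*` [set: M])
  (fun t t0 y0 => sigma y0 ((eta t0)^-1 * eta t)%g).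
Proof.
exists (fun _ _ => J); split.
  move=> t0 y0 [/= Jt0 _]; split; first exact: flow_solution.
  move=> I y [sol It0 yt0]; have [_ _ yW _] := sol; split.
    by move=> t /yW[].
  by move=> t It; rewrite (solution_formula sol It0 It) yt0.
by apply/seteqP; split => -[[t t0] y0] /=; [case=> -[? ?] _|case=> -[? ?] ?].
Qed.

End Flow.

(** * Local flows *)

Section LocalFlows.
Context (R : realType) (EG EM : tvsType R).
Hypotheses (sG : sclc_space EG) (sM : sclc_space EM).
Let hG : hausdorff_space EG := sG.1.
Let hM : hausdorff_space EM := sM.1.
Context (G : lieGroupType EG) (M : smoothManifoldType EM) (sigma : M -> G -> M).
Hypotheses (ss : smooth_map2 sigma) (act : right_action sigma).

Notation ff v y := (fundamental_field sigma (v : lie_algebra G) y).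
Notation ffG v z := (fundamental_field (fun g1 g2 : G => (g1 * g2)%g) (v : lie_algebra G) z).

Variables (a b : R) (ab : a < b) (gamma : R -> EG) (eta : R -> G).
Hypotheses (gL1 : L1 a b gamma)
  (eta_ac : manifold_abs_continuous `[a, b]%classic eta)
  (eta_vel : has_velocity `[a, b]%classic eta (fun t => ffG (gamma t) (eta t))).

Section Coordinates.
Variables (phi : chart EM M) (chi : chart EG G).
Hypotheses (aphi : atlas phi) (achi : atlas chi).

(** The flow is the pullback of this map along [chi \o eta] in both arguments
    from [G]. *)
Definition quotient_act (z : (EG * EG * EM)%type) : M :=
  sigma (chart_inv phi z.2) ((chart_inv chi z.1.2)^-1 * chart_inv chi z.1.1)%g.

Lemma quotient_act_smooth z : chart_img chi z.1.1 -> chart_img chi z.1.2 -> chart_img phi z.2 ->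
  msmooth_at quotient_act z.
Proof.
move=> i1 i2 i3.
have hGG : hausdorff_space (EG * EG)%type by exact: hausdorff_prod.
have hE : hausdorff_space (EG * EG * EM)%type by exact: hausdorff_prod.
apply: msmooth_map2 => //.
  apply: (msmooth_comp (u := chart_inv phi) (g := snd)) => //; last exact: msmooth_chart_inv.
  by apply: smooth_at_clinear => //; exact: clinear_snd.
apply: (msmooth_map2 (f := fun g h : G => (g * h)%g)) => //; first exact: lie_mul_smooth.
  apply: (msmooth_map (f := fun g : G => (g^-1)%g) (u := chart_inv chi \o (snd \o fst))) => //.
    exact: lie_inv_smooth.
  apply: (msmooth_comp (u := chart_inv chi) (g := snd \o fst)) => //; last exact: msmooth_chart_inv.
  apply: smooth_at_clinear => //; apply: clinear_comp; [exact: clinear_fst|exact: clinear_snd].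
apply: (msmooth_comp (u := chart_inv chi) (g := fst \o fst)) => //; last exact: msmooth_chart_inv.
by apply: smooth_at_clinear => //; apply: clinear_comp; exact: clinear_fst.
Qed.

Let Psi z := phi (quotient_act z).

Lemma quotient_act_chart_smooth z :
  chart_img chi z.1.1 -> chart_img chi z.1.2 -> chart_img phi z.2 ->
  chart_dom phi (quotient_act z) -> smooth_at Psi z.
Proof. by move=> i1 i2 i3 dS; exact: (quotient_act_smooth i1 i2 i3).2. Qed.

(** At [(x0, x0, y0)] the map takes the value [y0], so continuity provides the
    neighbourhoods. *)
Lemma flow_box (x0 : EG) (y0 : EM) : chart_img chi x0 -> chart_img phi y0 ->
  exists (V1 : set EG) (V Y : set EM),
  [/\ [/\ open V1, V1 x0 & V1 `<=` chart_img chi],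
      [/\ open V, V y0 & V `<=` chart_img phi],
      [/\ open Y, Y y0 & Y `<=` V],
      forall x1 x2 y, V1 x1 -> V1 x2 -> V y -> chart_dom phi (quotient_act (x1, x2, y)) &
      forall x1 x2 y, V1 x1 -> V1 x2 -> Y y -> V (Psi (x1, x2, y))].
Proof.
move=> ix iy; pose z0 := ((x0, x0), y0).
have S0 : quotient_act z0 = chart_inv phi y0 by rewrite /quotient_act /= mulVg act.1.
have dS0 : chart_dom phi (quotient_act z0) by rewrite S0; exact: chart_inv_dom.
have [cS _] := @quotient_act_smooth z0 ix ix iy.
have [[A B] /= [A0 B0] AB] := cS _ (chart_near dS0).
have [[A1 A2] /= [A10 A20] A12] := A0.
have [V [oV V0 VB]] : exists V, [/\ open V, V y0 & V `<=` B `&` chart_img phi].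
  by apply: nbhs_openP; apply: filterI => //; exact: open_nbhs_in (chart_img_open phi) iy.
have P0 : Psi z0 = y0 by rewrite /Psi S0 chart_invK.
have := smooth_at_cvg (@quotient_act_chart_smooth z0 ix ix iy dS0); rewrite P0.
move=> /(_ _ (open_nbhs_in oV V0))[[A' B'] /= [A'0 B'0] AB'].
have [[A1' A2'] /= [A1'0 A2'0] A12'] := A'0.
have [V1 [oV1 V10 V1A]] : exists V1, [/\ open V1, V1 x0 &
    V1 `<=` (A1 `&` A2) `&` (A1' `&` A2') `&` chart_img chi].
  apply: nbhs_openP; apply: filterI; last exact: open_nbhs_in (chart_img_open chi) ix.
  by apply: filterI; exact: filterI.
have [Y [oY Y0 YB]] : exists Y, [/\ open Y, Y y0 & Y `<=` B' `&` V].
  by apply: nbhs_openP; apply: filterI => //; exact: open_nbhs_in.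
exists V1, V, Y; split.
- by split => // x /V1A[].
- by split => // y /VB[].
- by split => // y /YB[].
- move=> x1 x2 y /V1A[[[h1 _] _] _] /V1A[[[_ h2] _] _] /VB[By _].
  by apply: (AB (x1, x2, y)); split => //; exact: (A12 (x1, x2)).
- move=> x1 x2 y /V1A[[_ [h1 _]] _] /V1A[[_ [_ h2]] _] /YB[By _].
  by apply: (AB' (x1, x2, y)); split => //; exact: (A12' (x1, x2)).
Qed.

End Coordinates.

(** The interval `[c, d] is chosen so small that [chi \o eta] stays in the set [V1]
    of [flow_box]. *)
Theorem flow_local_flows :
  smooth_local_flows `[a, b]%classic (`[a, b]%classic `*` [set: M])
    (fun t y => ff (gamma t) y).
Proof.
move=> phi aphi tb yb [/= Jtb iyb _].
have [achi dchi] := chart_atP (eta tb); set chi := chart_at _ in achi dchi.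
have ichi := chart_map_img dchi.
have [V1 [V [Y [[oV1 V10 V1i] [oV V0 Vi] [oY Y0 YV] SV PY]]]] := flow_box aphi achi ichi iyb.
have /andP[atb tbb] : a <= tb <= b by move: Jtb; rewrite in_itv.
have ce := evolution_continuous ab eta_ac.
have [e e0 he] : exists2 e, 0 < e & forall u, a <= u <= b -> `|u - tb| < e ->
    (chart_dom chi `&` chi @^-1` V1) (eta u).
  apply: (within_near ce atb tbb); last by split.
  by apply: open_preimage => //; [exact: chart_dom_open|exact: chart_cvg].
have e2 : 0 < e / 2 by rewrite divr_gt0.
have ee : e / 2 < e by rewrite ltr_pdivrMr// ltr_pMr// ltr1n.
pose c := Num.max a (tb - e / 2); pose d := Num.min b (tb + e / 2).
have ac : a <= c by rewrite le_max lexx.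
have db : d <= b by rewrite ge_min lexx.
have cd : c < d.
  rewrite gt_max !lt_min ab /=; apply/and3P; split.
  - by rewrite (le_lt_trans atb)// ltrDl.
  - by rewrite (lt_le_trans _ tbb)// gtrBl.
  - by rewrite ltrD2l gtrN.
have Iab u : c <= u <= d -> a <= u <= b.
  by move=> /andP[cu ud]; rewrite (le_trans ac cu) (le_trans ud db).
have near_tb u : c <= u <= d -> `|u - tb| < e.
  move=> /andP[]; rewrite /c /d ge_max le_min => /andP[_ h1] /andP[_ h2].
  by rewrite (le_lt_trans _ ee)// ler_norml lerBrDl h1/= lerBlDl.
have dI u : c <= u <= d -> chart_dom chi (eta u).
  by move=> h; have [] := he u (Iab u h) (near_tb u h).
have VI u : c <= u <= d -> V1 (chi (eta u)).
  by move=> h; have [] := he u (Iab u h) (near_tb u h).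
pose Phi t t0 y := phi (sigma (chart_inv phi y) ((eta t0)^-1 * eta t)%g).
have dPhi t t0 y : c <= t <= d -> c <= t0 <= d -> V y ->
    chart_dom phi (sigma (chart_inv phi y) ((eta t0)^-1 * eta t)%g).
  move=> ht ht0 Vy; have := SV _ _ _ (VI t ht) (VI t0 ht0) Vy.
  by rewrite /quotient_act /= !chart_mapK //; exact: dI.
exists c, d, V, Phi; split.
- split => //.
  exists `]tb - e / 2, tb + e / 2[%classic; split.
  + exact: interval_open.
  + by rewrite /= in_itv/= gtrBl ltrDl e2.
  + move=> x [/=]; rewrite !in_itv/= /c /d ge_max le_min => /andP[-> ->] /andP[h1 h2].
    by rewrite !ltW.
- split => //.
  move=> [t y] [/= tI Vy].
  have tJ : t \in `[a, b] by move: tI; rewrite !in_itv/=; exact: Iab.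
  by split => //; exact: Vi.
- move=> t0 y0; rewrite /= in_itv/= => ht0 Vy0.
  have pf := flow_primitive hG hM ss act ab gL1 eta_ac eta_vel ac cd db achi aphi dI
    (fun r hr => dPhi r t0 y0 hr ht0 Vy0).
  have pf' : primitive_of `[c, d]%classic
      (fun t => chart_diff phi (ff (gamma t) (chart_inv phi (Phi t t0 y0)))) (fun t => Phi t t0 y0).
    apply/(primitive_onP _ _ cd); apply: primitive_ext pf => r hr //.
    by rewrite /Phi chart_mapK//; exact: dPhi.
  split; last by rewrite /Phi mulVg act.1 chart_invK//; exact: Vi.
  split.
  + split; last by exists c, d; rewrite /= !in_itv/= !lexx (ltW cd).
    move=> x z; rewrite /= !in_itv/= => /andP[cx _] /andP[_ zd] u /andP[xu uz].
    by rewrite in_itv/= (le_trans cx xu) (le_trans uz zd).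
  + by eexists; exact: pf'.
  + move=> t; rewrite /= in_itv/= => ht; split => //=.
    * by rewrite in_itv/=; exact: Iab.
    * by apply: chart_map_img; exact: dPhi.
    * by split => //; rewrite /= in_itv/=; exact: Iab.
  + eexists; split; first exact: pf'.
      by have [[lf _] _] := (primitive_onP _ _ cd).2 pf'; exact: lf.
    by exists set0; split => // t [].
- exists Y; split => //.
  + move=> t0 t1 y; rewrite /= !in_itv/= => ht0 ht1 Yy.
    have := PY _ _ _ (VI t1 ht1) (VI t0 ht0) Yy.
    by rewrite /quotient_act /= !chart_mapK//; exact: dI.
  + move=> t0 t1 t2 y0; rewrite /= !in_itv/= => ht0 ht1 ht2 Yy.
    rewrite /Phi chart_mapK; last by apply: dPhi => //; exact: YV.
    by rewrite act.2 -mulgA mulVKg.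
pose alpha := chi \o eta.
have pa := evolution_primitive hG ab gL1 eta_ac eta_vel ac cd db achi dI.
pose Psi z := phi (quotient_act phi chi z).
have Psis x1 x2 y : V1 x1 -> V1 x2 -> V y -> smooth_at Psi (x1, x2, y).
  move=> h1 h2 Vy; apply: (quotient_act_chart_smooth aphi achi) => //=.
  - exact: V1i.
  - exact: V1i.
  - exact: Vi.
  - exact: SV.
have PhiE t t0 y : c <= t <= d -> c <= t0 <= d -> Phi t t0 y = Psi (alpha t, alpha t0, y).
  by move=> ht ht0; rewrite /Psi /quotient_act /alpha /= !chart_mapK//; exact: dI.
split.
  exists EG, EG, V1, V1, alpha, alpha, Psi; split.
  - by split.
  - split; first by eexists; exact/(primitive_onP _ _ cd)/pa.
    by move=> t; rewrite /= in_itv/=; exact: VI.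
  - split; first by eexists; exact/(primitive_onP _ _ cd)/pa.
    by move=> t; rewrite /= in_itv/=; exact: VI.
  - apply: Csmooth_of_germs; first by apply: openXX => //; exact: openXX.
    by move=> [[x1 x2] y] [[/= h1 h2] Vy]; exact: Psis.
  - by move=> t t0 y; rewrite /= !in_itv/= => ht ht0 _; exact: PhiE.
move=> F q cq C cC CV.
pose p0 x : R := `|q x|.
have sp0 : seminorm p0.
  split=> [x y|r x]; first by rewrite /p0 linearD ler_normD.
  by rewrite /p0 linearZ normrZ.
have cp0 : continuous p0 by move=> x; apply: cvg_norm; exact: cq.
(* the first variable, in which [t] moves, is separated from the parameters *)
pose T (z : (EG * (EG * EM))%type) := Psi (z.1, z.2.1, z.2.2).
have hGM : hausdorff_space (EG * EM)%type by exact: hausdorff_prod.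
have hGG : hausdorff_space (EG * EG)%type by exact: hausdorff_prod.
have Ts x1 x2 y : V1 x1 -> V1 x2 -> V y -> smooth_at T (x1, (x2, y)).
  move=> h1 h2 Vy.
  apply: (smooth_at_comp (f := Psi) (g := fun z : (EG * (EG * EM))%type => (z.1, z.2.1, z.2.2))).
  - exact: hausdorff_prod.
  - exact: hausdorff_prod.
  - by [].
  - apply: smooth_at_clinear; first exact: hausdorff_prod.
    apply: clinear_pair.
      apply: clinear_pair; first exact: clinear_fst.
      by apply: (clinear_comp (K := fst)); [exact: clinear_snd|exact: clinear_fst].
    by apply: (clinear_comp (K := snd)); exact: clinear_snd.
  - exact: Psis.
have ca : {within `[c, d]%classic, continuous alpha}.
  apply: (within_comp (within_itvS ac db ce)) => r; rewrite /= in_itv/= => h.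
  by apply: chart_cvg; exact: dI.
pose K := alpha @` `[c, d]%classic.
have cK : compact K by apply: continuous_compact => //; exact: segment_compact.
have KV x : K x -> V1 x by move=> [t]; rewrite /= in_itv/= => ht <-; exact: VI.
have KC x z : K x -> (K `*` C) z -> smooth_at T (x, z).
  by case: z => x2 y Kx [/= Kx2 Cy]; apply: Ts; [exact: KV|exact: KV|exact: CV].
have [p [Om [sp cp oOm OmC est]]] :=
  uniform_estimate hG hGM hM sp0 cp0 cK (compact_setX cK cC) KC.
(* the parameters of the uniform estimate are the pairs [(x2, y)]; by compactness of
   [K] the condition on [y] can be made uniform in [x2] *)
have [Omq [oOmq COmq OmqV OmqOm]] : exists Omq, [/\ open Omq, C `<=` Omq, Omq `<=` V &
    forall y, Omq y -> forall x2, K x2 -> Om (x2, y)].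
  exists ([set y | forall x2, K x2 -> Om (x2, y)]° `&` V); split.
  - by apply: openI => //; exact: open_interior.
  - move=> y Cy; split; last exact: CV.
    move/compact_near_coveringP: cK => cK.
    have := cK EM (nbhs y) (fun y x => Om (x, y)) _; apply.
    move=> x Kx.
    have [[A B] /= [Ax By] AB] := open_nbhs_in oOm (OmC (x, y) (conj Kx Cy)).
    by exists (A, B) => // -[x' y'] [/= Ax' By']; exact: (AB (x', y')).
  - by move=> y [].
  - by move=> y [/interior_subset h _].
have [Iq [[mIq Iqcd Iq0] IqP]] := lebesgue_points pa sp cp.
exists Iq, Omq; split => //.
move=> y0 t0 t Oy0; rewrite /= in_itv/= => ht0 Iqt.
have ht : c <= t <= d by have := Iqcd t Iqt; rewrite /= in_itv.
have Vy0 := OmqV _ Oy0.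
have Kat : K (alpha t) by exists t => //=; rewrite in_itv.
have Kat0 : K (alpha t0) by exists t0 => //=; rewrite in_itv.
pose z0 := (alpha t0, y0).
have [est1 est2] := est (alpha t) z0 Kat (OmqOm _ Oy0 _ Kat0).
pose F1 x := T (x, z0).
have sT : smooth_at T (alpha t, z0) by apply: Ts => //; exact: KV.
have e1 w : p0 (dirder F1 (alpha t) w) <= p w.
  by rewrite (dirder_partial w hG hGM hM sT).2.
have e2' x' : p (x' - alpha t) < 1 -> smooth_at F1 x' /\
    forall w, p0 (dirder F1 x' w - dirder F1 (alpha t) w) <= p (x' - alpha t) * p w.
  move=> /est2[Tx' h]; split; first exact: (dirder_partial 0 hG hGM hM Tx').1.
  by move=> w; rewrite (dirder_partial w hG hGM hM sT).2 (dirder_partial w hG hGM hM Tx').2.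
have fE : chart_diff phi (ff (gamma t) (chart_inv phi (Phi t t0 y0))) =
    dirder F1 (alpha t) (chart_diff chi (ffG (gamma t) (eta t))).
  rewrite /Phi chart_mapK; last exact: dPhi.
  rewrite -(transport_field hG hM ss act (chi := chi))//.
  - apply: dirder_ext; near=> x.
    by rewrite /F1 /T /z0 /Psi /quotient_act /alpha /= (chart_mapK (dI t0 ht0)).
  - exact: dI.
  - exact: dPhi.
rewrite fE; apply/cvgrPdist_le => e' e'0.
have [r r0 hr] := difference_quotient hM sp0 cp0 sp e1 e2' (IqP t Iqt) e'0.
exists r => //= s st sneq; rewrite /= in_itv/= => hs.
have st0 : 0 < `|s - t| by rewrite normr_gt0 subr_eq0.
have st' : `|s - t| < r by rewrite distrC.
have h := hr s hs st'.
rewrite -(ler_pM2l st0) [leRHS]mulrC; apply: le_trans h.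
rewrite [X in _ * X]distrC -normrZ scalerBr scalerA divff; last first.
  by rewrite subr_eq0.
have Fs u : c <= u <= d -> Phi u t0 y0 = F1 (alpha u) by move=> hu; rewrite PhiE.
by rewrite scale1r /p0 (linearB q) (linearB q) (linearZ_LR q) !Fs.
Unshelve. all: by end_near. Qed.

End LocalFlows.

Theorem theorem10p19 (R : realType) (EG EM : tvsType R)
    (sclcG : sclc_space EG) (sclcM : sclc_space EM)
    (G : lieGroupType EG) (M : smoothManifoldType EM)
    (sigma : M -> G -> M) (sigma_smooth : smooth_map2 sigma)
    (sigma_action : right_action sigma)
    (a b : R) (ab : a < b)
    (gamma : R -> lie_algebra G) (gamma_L1 : L1 a b gamma)
    (eta : R -> G) (eta_evol : is_evolution a b gamma eta) :
  let J := `[a, b]%classic in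
  let W := J `*` [set: M] in
  let f := fun t y => fundamental_field sigma (gamma t) y in
  [/\ local_existence J W f,
      local_uniqueness W f,
      is_maximal_flow W f (J `*` J `*` [set: M])
        (fun t t0 y0 => sigma y0 ((eta t0)^-1 * eta t)%g) &
      smooth_local_flows J W f].
Proof.
have [hG _] := sclcG; have [hM _] := sclcM; have [eta_ac _ eta_vel] := eta_evol.
split.
- exact: (flow_local_existence hG hM sigma_smooth sigma_action ab gamma_L1 eta_ac eta_vel).
- exact: (flow_local_uniqueness hG hM sigma_smooth sigma_action ab gamma_L1 eta_ac eta_vel).
- exact: (flow_maximal hG hM sigma_smooth sigma_action ab gamma_L1 eta_ac eta_vel).
- exact: (flow_local_flows sclcG sclcM sigma_smooth sigma_action ab gamma_L1 eta_ac eta_vel).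
Qed.
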